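(* Let $\mathcal{K}(t)\subset V$, $t\in[0,T]$, be closed subsets contained in the open set $U\subset V$ and satisfying, for each $t\in[0,T]$: (III) $\mathcal{K}(t)$ is invariant under parallel translation defined by the connection $\nabla(t)$; (IV) in each fiber $V_x$ the set $\mathcal{K}_x(t)=\mathcal{K}(t)\cap V_x$ is nonempty, closed and convex; and such that the space-time track $\mathcal{T}=\{(v,t)\in V\times[0,T]: v\in\mathcal{K}(t),\ t\in[0,T]\}$ is closed. Assume that $u(x,t):V_x\times T_xM^*\to V_x$ is a smooth family of bundle maps of diagonal form and that $F(x,\sigma,t)$ is continuous in $x,t$ and Lipschitz in $\sigma$. Suppose that, for any $x\in M$ and any initial time $t_0\in[0,T)$, any solution $\sigma_x(t)$, $t\in[t_0,T]$, of the ODE $$\frac{d}{dt}\sigma_x(t)=F(x,\sigma_x(t),t)$$ in the fiber $V_x$ which starts in $\mathcal{K}_x(t_0)$ (i.e. $\sigma_x(t_0)\in\mathcal{K}_x(t_0)$) will remain in $\mathcal{K}_x(t)$ for all later times, i.e. $\sigma_x(t)\in\mathcal{K}_x(t)$ for all $t\in[t_0,T]$. Then for any initial time $t_0\in[0,T)$ the solution $\sigma(x,t)$, $t\in[t_0,T]$, of the PDE $$\frac{\partial}{\partial t}\sigma(x,t)=\Delta(t)\sigma(x,t)+u(x,t)(\nabla(t)\sigma(x,t))+F(x,\sigma(x,t),t)$$ will remain in $\mathcal{K}(t)$ for all later times (i.e. $\sigma(x,t)\in\mathcal{K}_x(t)$ for all $x\in M$ and all $t\in[t_0,T]$) if $\sigma(x,t)$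 starts in $\mathcal{K}(t_0)$ at time $t_0$ (i.e. $\sigma(x,t_0)\in\mathcal{K}_x(t_0)$ for all $x\in M$).
   Context: $M^n$ is a closed oriented $n$-dimensional manifold with a smooth family of Riemannian metrics $g(t)$, $t\in[0,T]$. $V\to M$ is a real vector bundle with a time-independent bundle metric $h$; $V_x$ is the fiber over $x$; $\Gamma(V)$ is the space of $C^\infty$ sections. $\nabla(t):\Gamma(V)\to\Gamma(V\otimes TM^* )$, $t\in[0,T]$, is a smooth family of connections compatible with $h$: $X[h(\sigma,\tau)]=h(\nabla(t)_X\sigma,\tau)+h(\sigma,\nabla(t)_X\tau)$ for all $X\in TM$, $\sigma,\tau\in\Gamma(V)$ and $t\in[0,T]$. The time-dependent Laplacian is $\Delta(t)\sigma=\mathrm{trace}_{g(t)}(\widehat\nabla(t)(\nabla(t)\sigma))$, where $\widehat\nabla(t):\Gamma(V\otimes TM^* )\to\Gamma(V\otimes TM^*\otimes TM^* )$ is given by $\widehat\nabla(t)_X(\sigma\otimes\alpha)=(\nabla(t)_X\sigma)\otimes\alpha+\sigma\otimes(D(t)_X\alpha)$, with $D(t)$ the Levi-Civita connection of $g(t)$ on $TM^*$. $U$ is an open subset of $V$. $F:U\times[0,T]\to V$ is a fiber-preserving map, i.e. $F(x,\sigma,t)$ is a time-dependent vector field defined on $U$ and tangent to the fibers. ''Diagonal form'' for $u$ means that $u(x,t)(\sigma,dx^i)=u^i(x,t)\cdot\sigma$ with $u^i(x,t)$ smooth functions, so that $u(x,t)(\nabla(t)\sigma)=\sum_i u^i(x,t)\,\nabla(t)_{\partial/\partial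 x^i}\sigma$. Solutions $\sigma(\cdot,t)$ of the PDE are time-dependent sections of $V$.
   Formalization: The ODE hypothesis is required for solutions on every [t0,t1] with t1 ≤ T (as long as they exist in U), not only for those on all of [t0,T]; with the literal wording the claim fails when ODE solutions leave U before T. *)

(* Defs.v *)
(* Smooth manifolds, vector bundles, metrics and connections are presented in
   the classical way, by an atlas and by components in the charts subject to
   the transformation laws.  Vectors of R^n and R^k are row vectors, so linear
   maps act on the right: [w *m A].  Points of a manifold are denoted x, their
   coordinates y, chart indices i, j, coordinate directions a, b, c, d. *)
From HB Require Import structures.
From mathcomp Require Import all_boot all_order all_algebra.
From mathcomp Require Import all_classical all_reals all_analysis.

Set Implicit Arguments.
Unset Strict Implicit.
Unset Printing Implicit Defensive.

Import Order.TTheory GRing.Theory Num.Theory.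
Import numFieldNormedType.Exports.

Local Open Scope classical_set_scope.
Local Open Scope ring_scope.

Section Calculus.
Context {R : realType}.

(* C^oo on an open set O: all iterated directional derivatives of f are
   (Frechet) differentiable at the points of O. *)
Definition smooth_open {X Y : normedModType R} (O : set X) (f : X -> Y) :=
  forall (vs : seq X) (p : X), O p ->
    differentiable (foldr (fun v g => fun q => 'D_v g q) f vs) p.

(* C^oo on an arbitrary set: local C^oo extensions exist.  Used for sets of the
   form W * [0, T], where it means smoothness up to the boundary times. *)
Definition smooth_on {X Y : normedModType R} (A : set X) (f : X -> Y) :=
  forall p, A p -> exists (O : set X) (f' : X -> Y),
    [/\ open O, O p, smooth_open O f' & forall q, O q -> A q -> f q = f' q].

(* f'(s) = l, where only arguments in J are used: at an end point of an
   interval J this is the one-sided derivative. *)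
Definition deriv_within {Y : normedModType R} (J : set R) (f : R -> Y)
    (s : R) (l : Y) :=
  (fun r => (r - s)^-1 *: (f r - f s)) @ within J s^' --> l.

Definition basis_vec {n} (a : 'I_n) : 'rV[R]_n := delta_mx 0 a.

End Calculus.

(* A smooth n-manifold without boundary, with a smooth atlas.  The functions
   cmap i and cinv i are meaningful only on cdom i and on its image. *)
Record manifold (R : realType) (n : nat) := Manifold {
  mpoint :> topologicalType;
  mhausdorff : hausdorff_space mpoint;
  cidx : Type;
  cdom : cidx -> set mpoint;
  cmap : cidx -> mpoint -> 'rV[R]_n;
  cinv : cidx -> 'rV[R]_n -> mpoint;
  cdom_open : forall i, open (cdom i);
  cdom_cover : forall x, exists i, cdom i x;
  cimg_open : forall i, open (cmap i @` cdom i);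
  cmapK : forall i x, cdom i x -> cinv i (cmap i x) = x;
  cmap_continuous : forall i, {within cdom i, continuous (cmap i)};
  cinv_continuous : forall i, {within cmap i @` cdom i, continuous (cinv i)};
  ctrans_smooth : forall i j,
    smooth_open (cmap i @` (cdom i `&` cdom j)) (cmap j \o cinv i)
}.

Section Manifold.
Context {R : realType} {n : nat} (M : manifold R n).
Implicit Types i j : cidx M.

Definition cimg i : set 'rV[R]_n := @cmap _ _ M i @` cdom i.

(* The charts form an oriented atlas. *)
Definition oriented := forall i j x, cdom i x -> cdom j x ->
  0 < \det (jacobian (@cmap _ _ M j \o cinv i) (cmap i x)).

Definition cylinder (T : R) i : set ('rV[R]_n * R) :=
  [set p | cimg i p.1 /\ 0 <= p.2 <= T].

End Manifold.

(* A real vector bundle of rank k; the atlas of M is chosen fine enough for V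
   to be trivial over its charts, and triv i x is the fiber coordinate over the
   i-th chart (meaningful for x in cdom i). *)
Record vbundle (R : realType) (n : nat) (M : manifold R n) (k : nat) := VBundle {
  fiber :> M -> lmodType R;
  triv : forall (i : cidx M) (x : M), {linear fiber x -> 'rV[R]_k};
  tinv : forall (i : cidx M) (x : M), 'rV[R]_k -> fiber x;
  trivK : forall i x, cdom i x -> cancel (triv i x) (tinv i x);
  tinvK : forall i x, cdom i x -> cancel (tinv i x) (triv i x);
  ttrans_smooth : forall i j,
    smooth_open (@cmap _ _ M i @` (cdom i `&` cdom j))
      (fun y => lin1_mx (triv j (cinv i y) \o tinv i (cinv i y)))
}.

Section Bundle.
Context {R : realType} {n k : nat} {M : manifold R n} (V : vbundle M k).
Implicit Types (i j : cidx M) (y : 'rV[R]_n).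

(* triv j = triv i *m ttrans i j on the overlaps *)
Definition ttrans i j y : 'M[R]_k :=
  lin1_mx (@triv _ _ _ _ V j (cinv i y) \o tinv V i (cinv i y)).

Record total_space := Tot { tot_base : M; tot_vec : V tot_base }.

HB.instance Definition _ := gen_eqMixin total_space.
HB.instance Definition _ := gen_choiceMixin total_space.

(* A subset of the total space is open iff its images in all the bundle charts
   cimg i * R^k are. *)
Definition tot_op (W : set total_space) := forall i,
  open [set p : 'rV[R]_n * 'rV[R]_k |
    cimg i p.1 /\ W (Tot (tinv V i (cinv i p.1) p.2))].

Let cyl_open i : open [set p : 'rV[R]_n * 'rV[R]_k | cimg i p.1].
Proof.
apply: (@open_comp _ _ fst (@cimg _ _ M i)); first by move=> p _; exact: cvg_fst.
exact: cimg_open.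
Qed.

Let tot_opT : tot_op setT.
Proof.
move=> i; rewrite (_ : [set p | _] = [set p | cimg i p.1]); first exact: cyl_open.
by apply/seteqP; split=> p //= [].
Qed.

Let tot_opI : setI_closed tot_op.
Proof.
move=> A B oA oB i; have := openI (oA i) (oB i).
congr open; apply/seteqP; split=> p /=.
  by move=> [[? ?] [? ?]].
by move=> [? [? ?]].
Qed.

Let tot_op_bigU (I : Type) (f : I -> set total_space) :
  (forall s, tot_op (f s)) -> tot_op (\bigcup_s f s).
Proof.
move=> of_ i; have := @bigcup_open _ I setT _ (fun s _ => of_ s i).
congr open; apply/seteqP; split=> p /=.
  by move=> [s _ [? ?]]; split=> //; exists s.
by move=> [? [s _ ?]]; exists s.
Qed.

HB.instance Definition _ :=
  isOpenTopological.Build total_space tot_opT tot_opI tot_op_bigU.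

(* the section s read in the i-th bundle chart *)
Definition lrep i (s : forall x, V x) (y : 'rV[R]_n) : 'rV[R]_k :=
  triv V i (cinv i y) (s (cinv i y)).

Definition smooth_section (W : set M) (s : forall x, V x) := forall i,
  smooth_open (@cmap _ _ M i @` (cdom i `&` W)) (lrep i s).

End Bundle.

(* A smooth family g(t), t in [0, T], of Riemannian metrics;
   (gmet t i y) a b = g(t)(d/dx^a, d/dx^b). *)
Record riemannian_family (R : realType) (n : nat) (M : manifold R n) (T : R) :=
  RiemannianFamily {
  gmet :> R -> cidx M -> 'rV[R]_n -> 'M[R]_n;
  gmet_smooth : forall i, smooth_on (cylinder T i) (fun p => gmet p.2 i p.1);
  gmet_sym : forall t i y, 0 <= t <= T -> cimg i y ->
    (gmet t i y)^T = gmet t i y;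
  gmet_pos : forall t i y (v : 'rV[R]_n), 0 <= t <= T -> cimg i y -> v != 0 ->
    0 < (v *m gmet t i y *m v^T) 0 0;
  gmet_trans : forall t i j x, 0 <= t <= T -> cdom i x -> cdom j x ->
    let J := jacobian (@cmap _ _ M j \o cinv i) (cmap i x) in
    gmet t i (cmap i x) = J *m gmet t j (cmap j x) *m J^T
}.

(* The Levi-Civita connection D(t) of g(t): the torsion-free metric connection.  lc t i y a b c is the Christoffel symbol Gamma_ab^c, i.e.
   D_a d/dx^b = sum_c Gamma_ab^c d/dx^c.  The transformation law is a
   consequence of uniqueness. *)
Record levi_civita (R : realType) (n : nat) (M : manifold R n) (T : R)
    (g : riemannian_family M T) := LeviCivita {
  lc :> R -> cidx M -> 'rV[R]_n -> 'I_n -> 'I_n -> 'I_n -> R;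
  lc_torsion_free : forall t i y a b c, 0 <= t <= T -> cimg i y ->
    lc t i y a b c = lc t i y b a c;
  lc_metric : forall t i y a b c, 0 <= t <= T -> cimg i y ->
    'D_(basis_vec a) (fun z => g t i z b c) y =
    \sum_d (lc t i y a b d * g t i y d c + lc t i y a c d * g t i y b d)
}.

(* A smooth family u(x, t) of bundle maps V_x * T_xM^* -> V_x of diagonal form
   (sigma, dx^a) |-> u^a sigma is given by the components (ucomp t i y) 0 a =
   u^a; its being independent of the chart means that they transform as those
   of a vector field. *)
Record diagonal_family (R : realType) (n : nat) (M : manifold R n) (T : R) :=
  DiagonalFamily {
  ucomp :> R -> cidx M -> 'rV[R]_n -> 'rV[R]_n;
  ucomp_smooth : forall i, smooth_on (cylinder T i) (fun p => ucomp p.2 i p.1);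
  ucomp_trans : forall t i j x, 0 <= t <= T -> cdom i x -> cdom j x ->
    ucomp t j (cmap j x) =
    ucomp t i (cmap i x) *m jacobian (@cmap _ _ M j \o cinv i) (cmap i x)
}.

Record bundle_metric (R : realType) (n k : nat) (M : manifold R n)
    (V : vbundle M k) := BundleMetric {
  hmet :> forall x, V x -> V x -> R;
  hmet_sym : forall x (v w : V x), hmet v w = hmet w v;
  hmet_lin : forall x (r : R) (v v' w : V x),
    hmet (r *: v + v') w = r * hmet v w + hmet v' w;
  hmet_pos : forall x (v : V x), v != 0 -> 0 < hmet v v;
  hmet_smooth : forall i, smooth_open (@cimg _ _ M i)
    (fun y => \matrix_(p < k, q < k)
       hmet (tinv V i (cinv i y) (basis_vec p))
            (tinv V i (cinv i y) (basis_vec q)))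
}.

Definition hnorm (R : realType) (n k : nat) (M : manifold R n)
    (V : vbundle M k) (h : bundle_metric V) (x : M) (v : V x) : R :=
  Num.sqrt (h x v v).

(* A smooth family nabla(t), t in [0, T], of connections on V, given by the
   connection matrices: over the i-th chart
   nabla(t)_(d/dx^a) s = ds/dx^a + s *m conn t i y a.
   The transformation law says that nabla(t) s does not depend on the chart. *)
Record connection_family (R : realType) (n k : nat) (M : manifold R n)
    (V : vbundle M k) (T : R) := ConnectionFamily {
  conn :> R -> cidx M -> 'rV[R]_n -> 'I_n -> 'M[R]_k;
  conn_smooth : forall i a,
    smooth_on (cylinder T i) (fun p => conn p.2 i p.1 a);
  conn_trans : forall t i j x a, 0 <= t <= T -> cdom i x -> cdom j x ->
    let y := cmap i x in
    let J := jacobian (@cmap _ _ M j \o cinv i) y in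
    conn t i y a *m ttrans V i j y =
    'D_(basis_vec a) (ttrans V i j) y +
    \sum_b J a b *: (ttrans V i j y *m conn t j (cmap j x) b)
}.

Section Connections.
Context {R : realType} {n k : nat} {M : manifold R n} {V : vbundle M k}.
Context {T : R} (A : connection_family V T).
Implicit Types (i j : cidx M) (y : 'rV[R]_n) (t : R) (a b c : 'I_n).

(* (nabla(t)_(d/dx^a) s)(y) for a V-valued function s on the i-th chart *)
Definition cov_deriv t i a (s : 'rV[R]_n -> 'rV[R]_k) y : 'rV[R]_k :=
  'D_(basis_vec a) s y + s y *m A t i y a.

(* X[h(s, s')] = h(nabla_X s, s') + h(s, nabla_X s'), for sections over open
   subsets W of M, on which the connection acts because it is local. *)
Definition metric_compatible (h : bundle_metric V) :=
  forall t (W : set M) (s s' : forall x, V x), 0 <= t <= T -> open W ->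
  smooth_section W s -> smooth_section W s' ->
  forall i x a, cdom i x -> W x ->
  let y := cmap i x in
  'D_(basis_vec a) (fun z => h (cinv i z) (s (cinv i z)) (s' (cinv i z))) y =
  h x (tinv V i x (cov_deriv t i a (lrep i s) y)) (s' x) +
  h x (s x) (tinv V i x (cov_deriv t i a (lrep i s') y)).

(* The section tau = sum_b tau_b (x) dx^b of V (x) TM^* over the i-th chart is
   the family of its components tau_b.  As D_a dx^c = - sum_b Gamma_ab^c dx^b,
   the b-th component of (nabla^)_(d/dx^a) tau is the following. *)
Definition hat_deriv (g : riemannian_family M T) (D : levi_civita g) t i a
    (tau : 'I_n -> 'rV[R]_n -> 'rV[R]_k) b y : 'rV[R]_k :=
  cov_deriv t i a (tau b) y - \sum_c D t i y a b c *: tau c y.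

Definition laplacian (g : riemannian_family M T) (D : levi_civita g) t i
    (s : 'rV[R]_n -> 'rV[R]_k) y : 'rV[R]_k :=
  \sum_a \sum_b (invmx (g t i y)) a b *:
    hat_deriv D t i a (fun c => cov_deriv t i c s) b y.

Definition smooth_curve (gam : R -> M) :=
  {within `[0, 1], continuous gam} /\
  forall i, smooth_on [set r : R | 0 <= r <= 1 /\ cdom i (gam r)]
                      (@cmap _ _ M i \o gam).

(* w : [0, 1] -> V is parallel along its projection to M with respect to nabla(t) *)
Definition parallel t (w : R -> total_space V) :=
  forall i r (vel : 'rV[R]_n), 0 <= r <= 1 -> cdom i (tot_base (w r)) ->
  deriv_within `[0, 1] (fun q => cmap i (tot_base (w q))) r vel ->
  let W q := triv V i (tot_base (w q)) (tot_vec (w q)) in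
  deriv_within `[0, 1] W r
    (- \sum_a vel 0 a *: (W r *m A t i (cmap i (tot_base (w r))) a)).

Definition parallel_invariant t (K : set (total_space V)) :=
  forall w : R -> total_space V,
  smooth_curve (fun r => tot_base (w r)) -> parallel t w -> K (w 0) -> K (w 1).

End Connections.

Section Evolution.
Context {R : realType} {n k : nat} {M : manifold R n} {V : vbundle M k}.
Context (T : R) (U : set (total_space V)) (F : forall x : M, V x -> R -> V x).

(* joint continuity of F : U * [0, T] -> V *)
Definition continuous_field :=
  {within [set p : total_space V * R | U p.1 /\ 0 <= p.2 <= T],
    continuous (fun p => Tot (F (tot_vec p.1) p.2))}.

(* Lipschitz along the fibers with a constant that is locally uniform on
   U * [0, T]; a global Lipschitz constant is a special case. *)
Definition lipschitz_field (h : bundle_metric V) :=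
  forall (v0 : total_space V) (t0 : R), U v0 -> 0 <= t0 <= T ->
  exists (N : set (total_space V * R)) (L : R), nbhs (v0, t0) N /\
    forall t x (v w : V x), 0 <= t <= T ->
    U (Tot v) -> U (Tot w) -> N (Tot v, t) -> N (Tot w, t) ->
    hnorm h (F v t - F w t) <= L * hnorm h (v - w).

(* F is only defined on U, so solutions of the ODE and of the PDE take their
   values in U. *)
Definition ode_solution (t0 t1 : R) (x : M) (s : R -> V x) :=
  forall t, t0 <= t <= t1 -> U (Tot (s t)) /\
    forall i, cdom i x ->
    deriv_within `[t0, t1] (fun r => triv V i x (s r)) t
      (triv V i x (F (s t) t)).

(* Time-dependent sections that are C^2 in space on [t0, t1]: the space
   derivatives of order <= 2 exist and are continuous in (x, t). *)
Definition C2_sections (t0 t1 : R) (s : R -> forall x, V x) :=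
  forall i : cidx M,
  let Q := [set p : 'rV[R]_n * R | cimg i p.1 /\ t0 <= p.2 <= t1] in
  let d1 a t y := 'D_(basis_vec a) (lrep i (s t)) y in
  let d2 a b t y := 'D_(basis_vec b) (d1 a t) y in
  [/\ forall p a, Q p -> derivable (lrep i (s p.2)) p.1 (basis_vec a),
      forall p a b, Q p -> derivable (d1 a p.2) p.1 (basis_vec b),
      {within Q, continuous (fun p => lrep i (s p.2) p.1)},
      forall a, {within Q, continuous (fun p => d1 a p.2 p.1)} &
      forall a b, {within Q, continuous (fun p => d2 a b p.2 p.1)}].

(* Classical solutions on M * [t0, t1] of
   ds/dt = Delta(t) s + u(nabla(t) s) + F(x, s, t). *)
Definition pde_solution (A : connection_family V T)
    (g : riemannian_family M T) (D : levi_civita g) (u : diagonal_family M T)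
    (t0 t1 : R) (s : R -> forall x, V x) :=
  [/\ forall t x, t0 <= t <= t1 -> U (Tot (s t x)),
      C2_sections t0 t1 s &
      forall t i y, t0 <= t <= t1 -> cimg i y ->
      deriv_within `[t0, t1] (fun r => lrep i (s r) y) t
        (laplacian A D t i (lrep i (s t)) y
         + \sum_a (u t i y) 0 a *: cov_deriv A t i a (lrep i (s t)) y
         + triv V i (cinv i y) (F (s t (cinv i y)) t))].

End Evolution.

(* Main.v *)
(** Let [d(x, t)] be the [h]-distance of the solution [s] from [K_x(t)]. The
    squared bound [beta(t) = theta * exp (2 C (t - T))], with [C] larger than
    the Lipschitz constant of [F] along [s], is shown to dominate [d^2]; then
    [theta] tends to [0]. Let [t1] be the last time up to which [d^2 <= beta].
    Since the track of [K] is closed, [d] can only jump down, so the bound holds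
    at [t1]. If every [d(x, t1)^2 < beta(t1)], the bound persists: a point of
    [K_x(t1)] is moved forward in time by the ODE and to the neighbouring fibers
    by parallel transport without leaving [K]. Otherwise
    [d(x, t1)^2 = beta(t1)] at some [x] with [t1 > t0]; let [ks] be the nearest
    point of [K_x(t1)] and [nu = s - ks].
    - In space: along the image [y + r v] of a segment in a chart,
      [h(s, N)], with [N] parallel and [N(0) = nu], is maximal at [r = 0], because
      parallel transport is an isometry that preserves [K(t1)]. The first and
      second derivatives give [h(nabla s, nu) = 0] and [h(Delta s, nu) <= 0].
    - In time: the nearest points of [K_x(t)], [t < t1], tend to [ks] as [t]
      tends to [t1]; moving them to time [t1] by the ODE gives
      [beta'(t1) <= 2 h(nu, ds/dt - F(ks))].
    Together [2 C beta(t1) <= 2 L beta(t1)] with [L < C], which is absurd. *)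

(* The sets [K t] have no regularity in time beyond the closed track, so the distance to them may be
   discontinuous, and its maximum over [M] is never formed. The argument runs on the predicate
   [close], which asserts one witness in [K t]; compactness of [M] enters only through coverings by
   neighbourhoods. New witnesses come from the ODE and from parallel transport alone. The hypotheses
   speak about given solutions and given parallel fields, so both must first be constructed; one
   Picard theorem in R^k serves both purposes. Coordinate segments can replace geodesics: the
   Christoffel terms of the Laplacian are multiplied by [h(nabla s, nu)], which vanishes at the
   contact point, and the diagonal form of [u] kills the first-order term for the same reason. [F]
   is only locally Lipschitz, so a Lipschitz bound along the solution holds in a tube of squared
   radius [eta] only. The exponent [t - T] is nonpositive, whence [beta <= theta <= eta] keeps the
   nearest points inside the tube. *)
From HB Require Import structures.
Require Import Defs.
From mathcomp Require Import all_boot all_order all_algebra.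
From mathcomp Require Import all_classical all_reals all_analysis.
From mathcomp Require Import ring lra.

Import Order.TTheory GRing.Theory Num.Theory.
Import numFieldNormedType.Exports.

Set Implicit Arguments.
Unset Strict Implicit.
Unset Printing Implicit Defensive.

Local Open Scope classical_set_scope.
Local Open Scope ring_scope.

(** * Positive definite matrices *)

Section LinearAlgebra.
Context {R : realType}.

Definition bil {k} (G : 'M[R]_k) (v w : 'rV[R]_k) : R := (v *m G *m w^T) 0 0.

Definition posdef {k} (G : 'M[R]_k) :=
  G^T = G /\ forall v : 'rV[R]_k, v != 0 -> 0 < bil G v v.

Lemma bilDl k (G : 'M[R]_k) u v w : bil G (u + v) w = bil G u w + bil G v w.
Proof. by rewrite /bil !mulmxDl mxE. Qed.

Lemma bilDr k (G : 'M[R]_k) u v w : bil G u (v + w) = bil G u v + bil G u w.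
Proof. by rewrite /bil linearD mulmxDr mxE. Qed.

Lemma bilZl k (G : 'M[R]_k) c v w : bil G (c *: v) w = c * bil G v w.
Proof. by rewrite /bil -!scalemxAl mxE. Qed.

Lemma bilZr k (G : 'M[R]_k) c v w : bil G v (c *: w) = c * bil G v w.
Proof. by rewrite /bil linearZ -scalemxAr mxE. Qed.

Lemma bilNl k (G : 'M[R]_k) v w : bil G (- v) w = - bil G v w.
Proof. by rewrite -scaleN1r bilZl mulN1r. Qed.

Lemma bilNr k (G : 'M[R]_k) v w : bil G v (- w) = - bil G v w.
Proof. by rewrite -scaleN1r bilZr mulN1r. Qed.

Lemma bilC k (G : 'M[R]_k) v w : G^T = G -> bil G v w = bil G w v.
Proof.
move=> Gs; have vw : w *m G *m v^T = (v *m G *m w^T)^T.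
  by rewrite !trmx_mul trmxK Gs mulmxA.
by rewrite /bil vw [RHS]mxE.
Qed.

Lemma bil_suml k (G : 'M[R]_k) I (r : seq I) P (F : I -> 'rV[R]_k) w :
  bil G (\sum_(i <- r | P i) F i) w = \sum_(i <- r | P i) bil G (F i) w.
Proof.
apply: (big_morph (fun v => bil G v w)) => [u v|]; first exact: bilDl.
by rewrite /bil !mul0mx mxE.
Qed.

Lemma bilE k (G : 'M[R]_k) v w :
  bil G v w = \sum_p \sum_q v 0 p * G p q * w 0 q.
Proof.
rewrite /bil mxE exchange_big; apply: eq_bigr => q _; rewrite !mxE mulr_suml.
by apply: eq_bigr => p _.
Qed.

Lemma bilBl k (G : 'M[R]_k) u v w : bil G (u - v) w = bil G u w - bil G v w.
Proof. by rewrite bilDl bilNl. Qed.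

Lemma bilBr k (G : 'M[R]_k) u v w : bil G u (v - w) = bil G u v - bil G u w.
Proof. by rewrite bilDr bilNr. Qed.

Lemma posdef_ge0 k (G : 'M[R]_k) v : posdef G -> 0 <= bil G v v.
Proof.
move=> [_ Gp]; have [->|/Gp/ltW//] := eqVneq v 0.
by rewrite /bil !mul0mx mxE.
Qed.

Lemma bil_cauchy_schwarz k (G : 'M[R]_k) v w : posdef G ->
  bil G v w ^+ 2 <= bil G v v * bil G w w.
Proof.
move=> Gp; have [->|w0] := eqVneq w 0.
  by rewrite /bil trmx0 !mulmx0 mxE expr0n mulr0.
have ww : 0 < bil G w w by case: Gp => _; apply.
pose t := bil G v w / bil G w w.
have tw : t * bil G w w = bil G v w by rewrite /t divfK ?gt_eqF.
have := posdef_ge0 (v - t *: w) Gp.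
rewrite bilBl !bilBr !bilZl !bilZr (bilC w v) ?(proj1 Gp) // tw => h.
rewrite -ler_pdivrMr // expr2 mulrAC -/t; lra.
Qed.

(* Gram-Schmidt: rows are added to E one at a time. *)
Lemma posdef_orthonormal_rows n (G : 'M[R]_n) m : posdef G -> (m <= n)%N ->
  exists E : 'M[R]_(m, n), E *m G *m E^T = 1%:M.
Proof.
move=> Gp; elim: m => [_|m IH mn]; first by exists 0; apply/matrixP => -[].
have [E EG] := IH (ltnW mn).
have kn0 : kermx (G *m E^T) != 0.
  rewrite -mxrank_eq0 mxrank_ker subn_eq0 -ltnNge.
  by rewrite (leq_ltn_trans (rank_leq_col _)).
have [r rk r0] : exists2 r : 'rV_n, (r <= kermx (G *m E^T))%MS & r != 0.
  by exists (nz_row (kermx (G *m E^T))); [exact: nz_row_sub|rewrite nz_row_eq0].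
have rE : r *m G *m E^T = 0 by rewrite -mulmxA; apply/sub_kermxP.
have rr : 0 < bil G r r by case: Gp => _; apply.
pose v := (Num.sqrt (bil G r r))^-1 *: r.
have vE : v *m G *m E^T = 0 by rewrite /v -!scalemxAl rE scaler0.
have Ev : E *m G *m v^T = 0.
  by apply: trmx_inj; rewrite !trmx_mul trmxK (proj1 Gp) mulmxA vE trmx0.
have vv : v *m G *m v^T = 1%:M.
  apply/matrixP => a b; rewrite !ord1 [RHS]mxE eqxx -[LHS]/(bil G v v) bilZl bilZr.
  rewrite mulrA -expr2 exprVn sqr_sqrtr ?ltW // mulVf ?gt_eqF //.
rewrite -addn1; exists (col_mx E v).
rewrite mul_col_mx tr_col_mx mul_col_row EG Ev vE vv.
by rewrite -scalar_mx_block.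
Qed.

(** The rows of [E] form a [G]-orthonormal basis, so [E *m G *m E^T = 1]; solving for [G] and for
    its inverse gives both formulas. They turn traces against the inverse metric into sums over a
    frame, and the form itself into a sum of squares. *)
Lemma posdef_frame n (G : 'M[R]_n) : posdef G ->
  exists2 E : 'M[R]_n, E \in unitmx & invmx G = E^T *m E /\ G = invmx E *m (invmx E)^T.
Proof.
move=> Gp; have [E EG] := posdef_orthonormal_rows Gp (leqnn n).
have Eu : E \in unitmx.
  by have := EG; rewrite -mulmxA => /mulmx1_unit[].
have EGE : G = invmx E *m (invmx E)^T.
  rewrite trmx_inv; apply: (can_inj (mulKmx Eu)); rewrite mulKVmx //.
  have ETu : E^T \in unitmx by rewrite unitmx_tr.
  by apply: (can_inj (mulmxK ETu)); rewrite EG mulVmx.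
exists E => //; split => //.
have Gu : G \in unitmx by rewrite EGE unitmx_mul unitmx_tr unitmx_inv Eu.
apply: (can_inj (mulmxK Gu)); rewrite mulVmx // [in RHS]EGE -mulmxA mulKVmx //.
by rewrite trmx_inv mulmxV // unitmx_tr.
Qed.

(** With [invmx G = E^T *m E] the trace is the sum of the values of the quadratic form [H] at the
    rows of [E]. Only these diagonal values enter, which matters because second covariant
    derivatives need not commute. *)
Lemma trace_posdef_le0 n (G : 'M[R]_n) (H : 'I_n -> 'I_n -> R) : posdef G ->
  (forall v : 'rV[R]_n, \sum_a \sum_b v 0 a * v 0 b * H a b <= 0) ->
  \sum_a \sum_b invmx G a b * H a b <= 0.
Proof.
move=> Gp Hneg; have [E _ [-> _]] := posdef_frame Gp.
rewrite [leLHS](_ : _ = \sum_c \sum_a \sum_b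
    (row c E) 0 a * (row c E) 0 b * H a b).
  by apply: sumr_le0 => c _.
rewrite [RHS]exchange_big; apply: eq_bigr => a _.
rewrite [RHS]exchange_big; apply: eq_bigr => b _.
by rewrite !mxE mulr_suml; apply: eq_bigr => c _; rewrite !mxE.
Qed.

Lemma mx_norm_coord m n (A : 'M[R]_(m, n)) i j : `|A i j| <= `|A|.
Proof.
rewrite [leRHS]/Num.Def.normr/= mx_normrE.
exact: (le_bigmax _ (fun ij : 'I_m * 'I_n => `|A ij.1 ij.2|) (i, j)).
Qed.

Lemma mx_norm_le m n (A : 'M[R]_(m, n)) e : 0 <= e ->
  (forall i j, `|A i j| <= e) -> `|A| <= e.
Proof.
move=> e0 H; rewrite [leLHS]/Num.Def.normr/= mx_normrE.
by apply: bigmax_le => // ij _; exact: H.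
Qed.

Lemma mx_norm_mulmx m n p (A : 'M[R]_(m, n)) (B : 'M[R]_(n, p)) :
  `|A *m B| <= n%:R * `|A| * `|B|.
Proof.
apply: mx_norm_le => [|i j]; first by rewrite !mulr_ge0.
rewrite mxE (le_trans (ler_norm_sum _ _ _)) //.
have -> : n%:R * `|A| * `|B| = \sum_(q < n) `|A| * `|B|.
  by rewrite sumr_const card_ord -mulrA mulr_natl.
by apply: ler_sum => q _; rewrite normrM ler_pM // mx_norm_coord.
Qed.

Lemma mx_norm_tr m n (A : 'M[R]_(m, n)) : `|A^T| = `|A|.
Proof.
wlog suff le : m n A / `|A^T| <= `|A|.
  by apply/eqP; rewrite eq_le le -{1}[A]trmxK le.
by apply: mx_norm_le => // i j; rewrite mxE mx_norm_coord.
Qed.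

Lemma bil_le k (G : 'M[R]_k) v w :
  `|bil G v w| <= k%:R ^+ 2 * `|G| * `|v| * `|w|.
Proof.
rewrite /bil (le_trans (mx_norm_coord _ _ _)) // (le_trans (mx_norm_mulmx _ _)) //.
rewrite mx_norm_tr ler_wpM2r // expr2 -!mulrA ler_wpM2l //.
by rewrite (le_trans (mx_norm_mulmx _ _)) // mulrAC mulrA.
Qed.

Lemma posdef_coercive k (G : 'M[R]_k) : posdef G ->
  exists2 c, 0 < c & forall v, c * `|v| ^+ 2 <= bil G v v.
Proof.
move=> Gp; have [E Eu [_ EG]] := posdef_frame Gp.
(* [d] bounds the norm of [z |-> z *m E]; the summand 1 keeps it positive even for [k = 0]. *)
pose d := k%:R * `|E| + 1.
have d0 : 0 < d by rewrite ltr_wpDl // mulr_ge0.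
exists (d ^- 2); first by rewrite invr_gt0 exprn_gt0.
move=> v; rewrite mulrC ler_pdivrMr ?exprn_gt0 //.
pose z := v *m invmx E.
have zz : `|z| ^+ 2 <= bil G v v.
  have -> : bil G v v = \sum_j z 0 j ^+ 2.
    rewrite /bil EG mulmxA -mulmxA -trmx_mul -/z mxE.
    by apply: eq_bigr => j _; rewrite !mxE expr2.
  have s0 : 0 <= \sum_j z 0 j ^+ 2 by apply: sumr_ge0 => j _; exact: sqr_ge0.
  rewrite -(sqr_sqrtr s0) ler_sqr ?nnegrE ?sqrtr_ge0 //.
  apply: mx_norm_le; first exact: sqrtr_ge0.
  move=> i j; rewrite ord1 -sqrtr_sqr ler_wsqrtr // (bigD1 j) //= lerDl.
  by apply: sumr_ge0 => ? _; exact: sqr_ge0.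
rewrite (le_trans _ (ler_wpM2r _ zz)) ?sqr_ge0 // -exprMn.
rewrite ler_sqr ?nnegrE ?mulr_ge0 ?(ltW d0) //.
have -> : v = z *m E by rewrite mulmxKV.
rewrite (le_trans (mx_norm_mulmx _ _)) // mulrAC mulrC ler_wpM2l //.
by rewrite /d; lra.
Qed.

End LinearAlgebra.

(** * Calculus of matrix-valued functions *)

Section MatrixCalculus.
Context {R : realType}.

Lemma cvg_mxP T (F : set_system T) {FF : Filter F} m n
    (f : T -> 'M[R]_(m, n)) (l : 'M[R]_(m, n)) :
  f @ F --> l <-> forall i j, (fun x => f x i j) @ F --> l i j.
Proof.
split=> [fl i j|fl].
  apply: (@cvg_comp _ _ _ f (fun M : 'M[R]_(m, n) => M i j) _ _ _ fl).
  exact: coord_continuous.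
apply/cvgrPdist_le => e e0; near=> x.
apply: mx_norm_le; first exact: ltW.
move=> i j; rewrite !mxE; move: i j; near: x.
apply: filter_forall => i; apply: filter_forall => j.
by have /cvgrPdist_le := fl i j; exact.
Unshelve. all: by end_near. Qed.

Lemma cvg_sum T (F : set_system T) {FF : Filter F} (V : normedModType R) I
    (r : seq I) (f : I -> T -> V) (l : I -> V) :
  (forall i, f i @ F --> l i) ->
  (fun x => \sum_(i <- r) f i x) @ F --> \sum_(i <- r) l i.
Proof.
move=> fl; elim: r => [|i r IH].
  by rewrite big_nil; under eq_cvg do rewrite big_nil; exact: cvg_cst.
by rewrite big_cons; under eq_cvg do rewrite big_cons; exact: cvgD.
Qed.

Lemma cvg_mulmx T (F : set_system T) {FF : Filter F} m n p
    (f : T -> 'M[R]_(m, n)) (g : T -> 'M[R]_(n, p))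
    (a : 'M[R]_(m, n)) (b : 'M[R]_(n, p)) :
  f @ F --> a -> g @ F --> b -> (fun x => f x *m g x) @ F --> a *m b.
Proof.
move=> /cvg_mxP fa /cvg_mxP gb; apply/cvg_mxP => i j.
rewrite mxE (_ : (fun x => _) = fun x => \sum_q f x i q * g x q j); last first.
  by apply/funext => x; rewrite mxE.
by apply: cvg_sum => q; apply: cvgM.
Qed.

Lemma cvg_trmx T (F : set_system T) {FF : Filter F} m n
    (f : T -> 'M[R]_(m, n)) (a : 'M[R]_(m, n)) :
  f @ F --> a -> (fun x => (f x)^T) @ F --> a^T.
Proof.
move=> /cvg_mxP fa; apply/cvg_mxP => i j.
rewrite mxE (_ : (fun x => _) = (fun x => f x j i)) //.
by apply/funext => x; rewrite mxE.
Qed.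

Lemma cvg_bil T (F : set_system T) {FF : Filter F} k
    (G : T -> 'M[R]_k) (v w : T -> 'rV[R]_k) (G0 : 'M[R]_k) (v0 w0 : 'rV[R]_k) :
  G @ F --> G0 -> v @ F --> v0 -> w @ F --> w0 ->
  (fun x => bil (G x) (v x) (w x)) @ F --> bil G0 v0 w0.
Proof.
move=> hG hv hw.
have /cvg_mxP : (fun x => v x *m G x *m (w x)^T) @ F --> v0 *m G0 *m w0^T.
  by apply: cvg_mulmx; [exact: cvg_mulmx|exact: cvg_trmx].
by move=> /(_ 0 0).
Qed.

Lemma is_derive_mxP (V : normedModType R) m n (f : V -> 'M[R]_(m, n)) x v df :
  is_derive x v f df <-> forall i j, is_derive x v (fun y => f y i j) (df i j).
Proof.
split=> [[dvf <-] i j|H].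
  have /derivable_mxP := dvf => /(_ i j) dij.
  by apply: DeriveDef => //; rewrite derive_mx // mxE.
have dvf : derivable f x v by apply/derivable_mxP => i j; case: (H i j).
apply: DeriveDef => //; rewrite derive_mx //; apply/matrixP => i j.
by rewrite mxE; case: (H i j).
Qed.

Lemma is_derive_mulmx (V : normedModType R) m n p (f : V -> 'M[R]_(m, n))
    (g : V -> 'M[R]_(n, p)) x v df dg :
  is_derive x v f df -> is_derive x v g dg ->
  is_derive x v (fun y => f y *m g y) (df *m g x + f x *m dg).
Proof.
move=> /is_derive_mxP hf /is_derive_mxP hg; apply/is_derive_mxP => i j.
have -> : (fun y => (f y *m g y) i j) =
    \sum_(q < n) ((fun y => f y i q) * (fun y => g y q j)).
  by apply/funext => y; rewrite mxE fct_sumE.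
have -> : (df *m g x + f x *m dg) i j =
    \sum_q (f x i q *: dg q j + g x q j *: df i q).
  rewrite !mxE -big_split /=; apply: eq_bigr => q _.
  by rewrite /GRing.scale /= addrC [df _ _ * _]mulrC.
by apply: is_derive_sum => q; apply: is_deriveM.
Qed.

Lemma is_derive_trmx (V : normedModType R) m n (f : V -> 'M[R]_(m, n)) x v df :
  is_derive x v f df -> is_derive x v (fun y => (f y)^T) df^T.
Proof.
move=> /is_derive_mxP hf; apply/is_derive_mxP => i j; rewrite mxE.
by under [fun y => _]funext do rewrite mxE.
Qed.

(** The norm is the sup norm, so the scalar mean value theorem applies to each coordinate without
    loss in the constant. *)
Lemma mean_value_norm k (f df : R -> 'rV[R]_k) (a b c : R) : a <= b ->
  (forall t, a <= t <= b -> is_derive t 1 f (df t)) ->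
  (forall t, a <= t <= b -> `|df t| <= c) ->
  `|f b - f a| <= c * (b - a).
Proof.
move=> ab dvf dfc; have c0 : 0 <= c.
  by rewrite (le_trans _ (dfc a _)) ?lexx.
apply: mx_norm_le => [|i j]; first by rewrite mulr_ge0 // subr_ge0.
rewrite !mxE.
have dij t : a <= t <= b -> is_derive t 1 (fun s => f s i j) (df t i j).
  by move=> /dvf /is_derive_mxP.
have [||s sab ->] := @MVT_segment R (fun s => f s i j) (fun s => df s i j) a b ab.
- by move=> t /itvP tab; apply: dij; rewrite !tab.
- apply: derivable_within_continuous => t; rewrite in_itv /= => /dij.
  by case.
rewrite normrM [`|b - a|]ger0_norm ?subr_ge0 // ler_wpM2r ?subr_ge0 //.
by rewrite (le_trans (mx_norm_coord _ _ _)) // dfc // !(itvP sab).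
Qed.

Lemma antiderivative (f : R -> R) (a : R) : continuous f ->
  exists F, forall t, a < t -> is_derive t 1 F (f t).
Proof.
move=> cf; exists (fun t => \int[lebesgue_measure]_(s in `[a, t]) f s) => t at_.
have [|dF F'] := continuous_FTC1_closed (ltr_pwDr ltr01 (lexx t)) _ at_ (cf t).
  apply: continuous_compact_integrable; first exact: segment_compact.
  exact: continuous_subspaceT.
by apply: DeriveDef => //; rewrite -derive1E.
Qed.

(** A lower end [a] strictly to the left of [t0] gives a two-sided derivative at [t0] itself. *)
Lemma antiderivative_rV k (f : R -> 'rV[R]_k) (a t0 : R) w0 : continuous f ->
  exists F, F t0 = w0 /\ forall t, a < t -> is_derive t 1 F (f t).
Proof.
move=> cf.
have cfj j : continuous (fun t => f t 0 j).
  by move=> t; have /cvg_mxP := cf t; exact.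
have [F HF] := choice (fun j => antiderivative a (cfj j)).
exists (fun t => \row_j F j t - \row_j F j t0 + w0).
split=> [|t at_]; first by rewrite subrr add0r.
have dF : is_derive t 1 (fun t => \row_j F j t) (f t).
  apply/is_derive_mxP => i j; rewrite ord1.
  rewrite (_ : (fun y => _) = F j); first exact: HF.
  by apply/funext => y; rewrite mxE.
rewrite (_ : (fun _ => _) = (fun t => \row_j F j t) - cst (\row_j F j t0) + cst w0) //.
by apply: is_derive_eq; rewrite subr0 addr0.
Qed.

(** Nested intervals: [u m - 2 * D / 2 ^+ m] increases, [u m + 2 * D / 2 ^+ m] decreases, and the
    first never exceeds the second. The supremum of the lower ends is the limit, and the rate comes
    with it. *)
Lemma geometric_limit (u : nat -> R) D :
  (forall m, `|u m.+1 - u m| <= D / 2 ^+ m) ->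
  exists l, forall m, `|u m - l| <= 2 * D / 2 ^+ m.
Proof.
move=> uD.
have pw m : (2 : R) ^+ m > 0 by rewrite exprn_gt0.
have D0 m : 0 <= D / 2 ^+ m by rewrite (le_trans _ (uD m)).
have stepD m : 2 * D / 2 ^+ m.+1 = D / 2 ^+ m.
  by rewrite exprS invfM mulrACA mulfV // mul1r.
have stepD2 m : 2 * D / 2 ^+ m = D / 2 ^+ m + D / 2 ^+ m by rewrite -mulrA mulr_natl.
pose a m := u m - 2 * D / 2 ^+ m; pose b m := u m + 2 * D / 2 ^+ m.
have aS m : a m <= a m.+1.
  have := uD m; rewrite /a stepD stepD2 ler_norml => /andP[+ _]; lra.
have bS m : b m.+1 <= b m.
  have := uD m; rewrite /b stepD stepD2 ler_norml => /andP[_]; lra.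
have ab m p : a m <= b p.
  have am : a m <= a (maxn m p).
    rewrite -(subnKC (leq_maxl m p)); elim: (_ - _)%N => [|q IH]; first by rewrite addn0.
    by rewrite addnS (le_trans IH).
  have bm : b (maxn m p) <= b p.
    rewrite -(subnKC (leq_maxr m p)); elim: (_ - _)%N => [|q IH]; first by rewrite addn0.
    by rewrite addnS (le_trans _ IH).
  rewrite (le_trans am) // (le_trans _ bm) // /a /b.
  have := D0 (maxn m p); have := stepD2 (maxn m p); lra.
exists (sup (range a)) => m; rewrite ler_distlC.
have sa : has_sup (range a).
  by split; [exists (a 0), 0|exists (b 0) => _ [p _ <-]].
apply/andP; split.
  by apply: (ub_le_sup (proj2 sa)); exists m.
by apply: (ge_sup (proj1 sa)) => _ [p _ <-]; exact: ab.
Qed.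

Lemma geometric_limit_rV k (u : nat -> 'rV[R]_k) D :
  (forall m, `|u m.+1 - u m| <= D / 2 ^+ m) ->
  exists l, forall m, `|u m - l| <= 2 * D / 2 ^+ m.
Proof.
move=> uD.
have D0 m : 0 <= D / 2 ^+ m by rewrite (le_trans _ (uD m)).
have uDj j m : `|u m.+1 0 j - u m 0 j| <= D / 2 ^+ m.
  by rewrite (le_trans _ (uD m)) // (le_trans _ (mx_norm_coord _ 0 j)) // !mxE.
have [l Hl] := choice (fun j => geometric_limit (uDj j)).
exists (\row_j l j) => m; apply: mx_norm_le; first by rewrite -mulrA mulr_ge0.
by move=> i j; rewrite ord1 !mxE; exact: Hl.
Qed.

Lemma le_geometric (a b c : R) : (forall m, a <= b + c / 2 ^+ m) -> a <= b.
Proof.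
move=> H; apply/ler_addgt0Pr => e e0.
have c0 : 0 <= `|c| / e by rewrite divr_ge0 // ltW.
have [m hm] : exists m, `|c| / e < 2 ^+ m.
  exists (Num.bound (`|c| / e)); rewrite (lt_trans (archi_boundP c0)) //.
  by rewrite -natrX ltr_nat ltn_expl.
rewrite (le_trans (H m)) // lerD2l ler_pdivrMr ?exprn_gt0 //.
rewrite (le_trans (ler_norm c)) // ltW // mulrC -ltr_pdivrMr //.
Qed.

(** Composition with this 1-Lipschitz retraction extends data controlled on an interval only to the
    whole line, which the global hypotheses of [picard] demand. *)
Definition clamp (a b t : R) : R := Num.min b (Num.max a t).

Lemma clamp_in a b t : a <= b -> a <= clamp a b t <= b.
Proof. by rewrite /clamp => ab; rewrite le_min le_max ge_min ab !lexx. Qed.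

Lemma clamp_id a b t : a <= t <= b -> clamp a b t = t.
Proof.
by move=> /andP[at_ tb]; rewrite /clamp (max_idPr at_); apply/min_idPr.
Qed.

Lemma clamp_dist a b s t : `|clamp a b s - clamp a b t| <= `|s - t|.
Proof.
wlog st : s t / s <= t => [H|].
  by case: (leP s t) => [/H//|/ltW/H]; rewrite distrC [`|t - s|]distrC.
rewrite distrC [leRHS]distrC [leRHS]ger0_norm ?subr_ge0 // ler_norml.
rewrite /clamp /Num.min /Num.max.
by case: (ltP a s) => ?; case: (ltP a t) => ?; do 2 case: ltP => ?; lra.
Qed.

Lemma clamp_continuous a b : continuous (clamp a b).
Proof.
move=> t; apply/cvgrPdist_le => e e0; exists e => //= s ts.
by rewrite (le_trans (clamp_dist _ _ _ _)) // ltW.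
Qed.

End MatrixCalculus.

(** * Picard iteration for ordinary differential equations in R^k *)

Section Picard.
Context {R : realType} {k : nat}.
Implicit Types (f : R -> 'rV[R]_k -> 'rV[R]_k) (L t : R).

Lemma lipschitz_comp_continuous f L (x : R -> 'rV[R]_k) : 0 <= L ->
  (forall t v w, `|f t v - f t w| <= L * `|v - w|) ->
  (forall w, continuous (f^~ w)) -> continuous x ->
  continuous (fun t => f t (x t)).
Proof.
move=> L0 fL cf cx t; apply/cvgrPdist_le => e e0.
have L1 : 0 < L + 1 by lra.
near=> s.
rewrite (_ : _ - _ = f t (x t) - f s (x t) + (f s (x t) - f s (x s))); last first.
  by rewrite addrA subrK.
rewrite (le_trans (ler_normD _ _)) // [leRHS](splitr e) lerD //.
  by near: s; have /cvgrPdist_le := cf (x t) t; apply; rewrite divr_gt0.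
rewrite (le_trans (fL _ _ _)) // (@le_trans _ _ ((L + 1) * `|x t - x s|)) //.
  by rewrite ler_wpM2r // lerDl.
rewrite mulrC -ler_pdivlMr //; near: s.
by have /cvgrPdist_le := cx t; apply; rewrite !divr_gt0.
Unshelve. all: by end_near. Qed.

(* The bound [L * tau <= 1/2] makes the Picard iterates converge geometrically. *)
Lemma picard f L c t0 tau w0 : 0 <= tau -> 0 <= L -> L * tau <= 2^-1 ->
  (forall t v w, `|f t v - f t w| <= L * `|v - w|) ->
  (forall w, continuous (f^~ w)) ->
  (forall t, t0 <= t <= t0 + tau -> `|f t w0| <= c) ->
  exists x : R -> 'rV[R]_k, x t0 = w0 /\ forall t, t0 <= t <= t0 + tau ->
    is_derive t 1 x (f t (x t)) /\ `|x t - w0| <= 2 * (c * tau).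
Proof.
move=> tau0 L0 Ltau fL cf fc.
have t0tau : t0 <= t0 + tau by rewrite lerDl.
have c0 : 0 <= c by rewrite (le_trans _ (fc t0 _)) ?lexx.
pose cl := clamp t0 (t0 + tau).
have clJ t : t0 <= cl t <= t0 + tau by exact: clamp_in.
have clE t : t0 <= t <= t0 + tau -> cl t = t by exact: clamp_id.
have ccl : continuous cl by exact: clamp_continuous.
have cfx x : continuous x -> continuous (fun t => f t (x t)).
  exact: lipschitz_comp_continuous fL cf.
(* The Picard integral operator; its value at discontinuous functions is arbitrary. *)
have [I HI] : {I : (R -> 'rV[R]_k) -> R -> 'rV[R]_k & forall x, continuous x ->
    I x t0 = w0 /\ forall t, t0 - 1 < t -> is_derive t 1 (I x) (f t (x t))}.
  apply: (@choice _ _ (fun x y => continuous x ->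
    y t0 = w0 /\ forall t, t0 - 1 < t -> is_derive t 1 y (f t (x t)))) => x.
  have [cx|ncx] := pselect (continuous x); last by exists x.
  by have [y Hy] := antiderivative_rV (t0 - 1) t0 w0 (cfx x cx); exists y.
have dI x t : continuous x -> t0 <= t <= t0 + tau -> is_derive t 1 (I x) (f t (x t)).
  by move=> /HI[_ +] /andP[t0t _]; apply; lra.
have cI x : continuous x -> continuous (I x \o cl).
  move=> cx t; apply: continuous_comp; first exact: ccl.
  apply: differentiable_continuous; apply/derivable1_diffP.
  by have [] := dI x _ cx (clJ t).
have I_lip x y e : continuous x -> continuous y -> 0 <= e ->
    (forall t, t0 <= t <= t0 + tau -> `|x t - y t| <= e) ->
    forall t, t0 <= t <= t0 + tau -> `|I x t - I y t| <= e / 2.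
  move=> cx cy e0 xy t /andP[t0t tt].
  have -> : I x t - I y t = (I x - I y) t - (I x - I y) t0.
    by rewrite !fctE (proj1 (HI x cx)) (proj1 (HI y cy)) subrr subr0.
  have sJ s : t0 <= s <= t -> t0 <= s <= t0 + tau.
    by case/andP=> -> st; rewrite (le_trans st).
  have dxy s : t0 <= s <= t -> is_derive s 1 (I x - I y) (f s (x s) - f s (y s)).
    by move=> /sJ sJs; apply: is_deriveB; apply: dI.
  rewrite (le_trans (mean_value_norm (c := L * e) t0t dxy _)) //.
    move=> s /sJ/xy xys; rewrite (le_trans (fL _ _ _)) // ler_wpM2l //.
  rewrite (@le_trans _ _ (L * e * tau)) // ?ler_wpM2l ?mulr_ge0 //; first lra.
  by rewrite mulrAC mulrC ler_wpM2l.
(* Clamping the time keeps every iterate continuous on the whole line, so that [HI] applies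
   again. *)
pose X m := iter m (fun x => I x \o cl) (cst w0).
have cX m : continuous (X m).
  by elim: m => [|m IH] /=; [move=> t; exact: cvg_cst|exact: cI].
pose D := c * tau.
have D0 m : 0 <= D / 2 ^+ m by rewrite divr_ge0 ?mulr_ge0 // exprn_ge0.
have Xstep m t : `|X m.+1 t - X m t| <= D / 2 ^+ m.
  elim: m t => [|m IH] t.
    have -> : X 1 t - X 0 t = I (X 0) (cl t) - I (X 0) t0.
      by rewrite (proj1 (HI _ (cX 0))).
    rewrite divr1.
    have /andP[ct ct2] := clJ t.
    have sJ s : t0 <= s <= cl t -> t0 <= s <= t0 + tau.
      by case/andP=> -> st; rewrite (le_trans st).
    have dx s : t0 <= s <= cl t -> is_derive s 1 (I (X 0)) (f s w0).
      by move=> /sJ; apply: dI (cX 0).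
    rewrite (le_trans (mean_value_norm (c := c) ct dx _)) //.
      by move=> s /sJ; exact: fc.
    by rewrite ler_wpM2l //; lra.
  rewrite exprS invfM mulrCA mulrC.
  by apply: (I_lip _ _ _ (cX m.+1) (cX m)) => // s _; exact: IH.
have [x Hx] := choice (fun t => geometric_limit_rV (fun m => Xstep m t)).
have cx : continuous x.
  move=> t; apply/cvgrPdist_le => e e0.
  have [m Hm] : exists m, 2 * D / 2 ^+ m <= e / 3.
    have c1 : 0 <= (2 * D) / (e / 3) by rewrite !divr_ge0 ?mulr_ge0 // ltW.
    exists (Num.bound ((2 * D) / (e / 3))).
    rewrite ler_pdivrMr ?exprn_gt0 // [leRHS]mulrC -ler_pdivrMr ?divr_gt0 //.
    by rewrite ltW // (lt_trans (archi_boundP c1)) // -natrX ltr_nat ltn_expl.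
  near=> s.
  have -> : x t - x s = (x t - X m t) + (X m t - X m s) + (X m s - x s).
    by rewrite !addrA !subrK.
  have -> : e = e / 3 + e / 3 + e / 3 by lra.
  rewrite (le_trans (ler_normD _ _)) // lerD //; last by rewrite (le_trans (Hx _ m)).
  rewrite (le_trans (ler_normD _ _)) // lerD //.
    by rewrite distrC (le_trans (Hx _ m)).
  by near: s; have /cvgrPdist_le := cX m t; apply; rewrite divr_gt0.
have xI t : t0 <= t <= t0 + tau -> I x t = x t.
  move=> tJ; apply/eqP; rewrite -subr_eq0 -normr_le0.
  apply: (@le_geometric _ _ _ (2 * D)) => m; rewrite add0r.
  have -> : I x t - x t = (I x t - X m.+1 t) + (X m.+1 t - x t).
    by rewrite addrA subrK.
  have -> : 2 * D / 2 ^+ m = 2 * D / 2 ^+ m / 2 + 2 * D / 2 ^+ m.+1.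
    by rewrite exprS invfM; field; rewrite expf_neq0.
  rewrite (le_trans (ler_normD _ _)) // lerD //.
  rewrite /X iterS -/(X m) /= clE //.
  apply: I_lip => //; first by rewrite -mulrA mulr_ge0.
  by move=> s _; rewrite distrC.
(* The limit [x] is frozen outside the interval and might lack a two-sided derivative at the end
   points. [I x] agrees with it on the interval and is differentiable beyond. *)
exists (I x); split; first by case: (HI x cx).
move=> t tJ; rewrite xI //; split; first exact: dI.
by rewrite distrC; have := Hx t 0%N; rewrite divr1.
Unshelve. all: by end_near. Qed.

End Picard.

(** * Directional derivatives from continuous partial derivatives *)

Section DirectionalDerivatives.
Context {R : realType}.

Lemma is_derive_line (X Y : normedModType R) (f : X -> Y) (y v : X) (r : R) df :
  is_derive (y + r *: v) v f df -> is_derive r 1 (fun s => f (y + s *: v)) df.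
Proof.
move=> [dvf df_].
have E : (fun h : R => h^-1 *: (((fun s : R => f (y + s *: v)) \o shift r) (h *: 1)
    - f (y + r *: v))) =
    (fun h => h^-1 *: ((f \o shift (y + r *: v)) (h *: v) - f (y + r *: v))).
  apply/funext => h /=; congr (_ *: (f _ - _)).
  by rewrite [h *: 1]mulr1 scalerDl addrCA.
by apply: DeriveDef; rewrite /derivable /derive E.
Qed.

Lemma mean_value_line n (f df : 'rV[R]_n -> R) (z v : 'rV[R]_n) (s : R) :
  (forall r : R, `|r| <= `|s| -> is_derive (z + r *: v) v f (df (z + r *: v))) ->
  exists2 r, `|r| <= `|s| & f (z + s *: v) - f z = s * df (z + r *: v).
Proof.
move=> dvf; pose g (r : R) := f (z + r *: v).
have dg (r : R) : `|r| <= `|s| -> is_derive r 1 g (df (z + r *: v)).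
  by move=> /dvf; exact: is_derive_line.
have g0 : g 0 = f z by rewrite /g scale0r addr0.
have [s0|s0] := leP 0 s.
  have sJ (r : R) : r \in `[0, s] -> `|r| <= `|s|.
    by rewrite in_itv /= => /andP[r0 rs]; rewrite !ger0_norm.
  have [r||r /sJ rs E] := @MVT_segment R g (fun r => df (z + r *: v)) 0 s s0.
  - by move=> /subset_itv_oo_cc /sJ; exact: dg.
  - by apply: derivable_within_continuous => r /sJ /dg[].
  by exists r => //; rewrite -g0 -/(g s) E subr0 mulrC.
have sJ (r : R) : r \in `[s, 0] -> `|r| <= `|s|.
  by rewrite in_itv /= => /andP[r0 rs]; rewrite !ler0_norm ?lerN2 // ltW.
have [r||r /sJ rs E] := @MVT_segment R g (fun r => df (z + r *: v)) s 0 (ltW s0).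
- by move=> /subset_itv_oo_cc /sJ; exact: dg.
- by apply: derivable_within_continuous => r /sJ /dg[].
by exists r => //; rewrite -g0 -/(g s) -opprB E sub0r mulrN opprK mulrC.
Qed.

(** The solution of the PDE is only known to have continuous partial derivatives, so directional
    derivatives have to be deduced from them. The step from [y] to [y + h *: v] is broken into
    axis-parallel pieces, and the mean value theorem is applied to each. *)
Lemma partials_is_derive n (f : 'rV[R]_n -> R) (df : 'I_n -> 'rV[R]_n -> R)
    (y v : 'rV[R]_n) :
  (\forall z \near y, forall a, is_derive z (delta_mx 0 a) f (df a z)) ->
  (forall a, {for y, continuous (df a)}) ->
  is_derive y v f (\sum_a v 0 a * df a y).
Proof.
move=> pf cf.
suff H : (fun h : R => h^-1 *: ((f \o shift y) (h *: v) - f y)) @ 0^' -->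
    (\sum_a v 0 a * df a y : R).
  by apply: DeriveDef; [apply/cvg_ex; eexists; exact: H|exact: cvg_lim H].
apply/cvgrPdist_le => e e0.
pose d := e / (\sum_a `|v 0 a| + 1).
have s0 : 0 <= \sum_a `|v 0 a| by apply: sumr_ge0.
have d0 : 0 < d by rewrite divr_gt0 // ltr_wpDl.
have : \forall z \near y, forall a, is_derive z (delta_mx 0 a) f (df a z) /\
    `|df a y - df a z| <= d.
  near=> z => a; split; first by move: a; near: z.
  move: a; near: z; apply: filter_forall => a.
  by have /cvgrPdist_le := cf a; exact.
move=> /nbhs_ballP[rho rho0 Hrho].
have v1 : 0 < `|v| + 1 by rewrite ltr_wpDl.
near=> h.
have h0 : h != 0 by near: h; exact: nbhs_dnbhs_neq.
have hv : `|h| * `|v| < rho.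
  rewrite (@le_lt_trans _ _ (`|h| * (`|v| + 1))) ?ler_wpM2l ?lerDl //.
  by rewrite -ltr_pdivlMr //; near: h; apply: dnbhs0_lt; rewrite divr_gt0.
(* Corners of the path: [z m] has already moved in its first [m] coordinates. *)
pose z (m : nat) := y + h *: (\row_j (if (j < m)%N then v 0 j else 0)).
have z0 : z 0%N = y.
  by rewrite /z (_ : \row_j _ = 0) ?scaler0 ?addr0 //; apply/rowP => j; rewrite !mxE.
have zn : z n = h *: v + y.
  rewrite /z addrC; congr (_ *: _ + _); apply/rowP => j.
  by rewrite !mxE ltn_ord.
have zS (a : 'I_n) : z a.+1 = z a + (h * v 0 a) *: delta_mx 0 a.
  rewrite /z -addrA -scalerA -scalerDr; congr (_ + _ *: _).
  apply/rowP => j; rewrite !mxE ltnS leq_eqVlt eqxx /=.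
  have [->|ja] := eqVneq j a; first by rewrite eqxx ltnn mulr1 add0r.
  by rewrite val_eqE (negbTE ja) /= mulr0 addr0.
have near_y (a : 'I_n) (r : R) : `|r| <= `|h * v 0 a| ->
    ball y rho (z a + r *: delta_mx 0 a).
  move=> rh; rewrite -ball_normE /ball_ /= (le_lt_trans _ hv) //.
  rewrite /z -addrA opprD addNKr normrN.
  apply: mx_norm_le => [|i j]; first by rewrite mulr_ge0.
  rewrite ord1 !mxE eqxx /=.
  have [->|ja] := eqVneq j a.
    rewrite ltnn mulr0 add0r mulr1 (le_trans rh) // normrM ler_wpM2l //.
    exact: mx_norm_coord.
  rewrite mulr0 addr0; case: ifP => _; last by rewrite mulr0 normr0 mulr_ge0.
  by rewrite normrM; apply: ler_pM; rewrite // mx_norm_coord.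
have step (a : 'I_n) : `|v 0 a * df a y - h^-1 * (f (z a.+1) - f (z a))| <=
    `|v 0 a| * d.
  rewrite zS; have [r|r rh ->] :=
      @mean_value_line n f (df a) (z a) (delta_mx 0 a) (h * v 0 a).
    by move=> /near_y/Hrho/(_ a)[].
  rewrite -[h * _ * _]mulrA (mulKf h0) -mulrBr normrM ler_wpM2l //.
  by have /Hrho/(_ a)[] := near_y _ _ rh.
have -> : h^-1 *: ((f \o shift y) (h *: v) - f y) =
    \sum_(a < n) h^-1 * (f (z a.+1) - f (z a)).
  rewrite -mulr_sumr -(big_mkord xpredT (fun a => f (z a.+1) - f (z a))).
  by rewrite telescope_sumr // z0 zn.
rewrite -sumrB (le_trans (ler_norm_sum _ _ _)) //.
rewrite (le_trans (ler_sum _ (fun a _ => step a))) // -mulr_suml /d.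
by rewrite mulrCA ler_piMr ?(ltW e0) // ler_pdivrMr ?mul1r ?lerDl // ltr_wpDl.
Unshelve. all: by end_near. Qed.

End DirectionalDerivatives.

(** * Smooth maps *)

Section Smoothness.
Context {R : realType}.

Lemma near_eq_differentiable (X Y : normedModType R) (f g : X -> Y) (p : X) :
  (\forall q \near p, f q = g q) -> differentiable f p -> differentiable g p.
Proof.
move=> fg df; suff de : differentiable (g - f) p.
  by rewrite -(subrK f g); exact: differentiableD.
have E : (g - f) \o shift p = cst ((g - f) p) + \0 +o_ (0 : X) id.
  apply/eqaddoP => e e0; have fg0 : \forall h \near (0 : X), f (h + p) = g (h + p).
    by move: fg; rewrite (near_shift 0) subr0.
  near=> h; rewrite !fctE /= !(nbhs_singleton fg) subrr addr0 subr0.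
  by rewrite (near fg0 h) // subrr normr0 mulr_ge0 // ltW.
apply/diff_locallyP; rewrite (diff_unique _ E); last exact: cst_continuous.
by split=> //; exact: cst_continuous.
Unshelve. all: by end_near. Qed.

(** [smooth_open] cut off at order [m], to allow induction on the order. The derivatives of order at
    most [m] are themselves differentiable, so [Ck 0] already means differentiable. *)
Definition Ck {X Y : normedModType R} (m : nat) (O : set X) (f : X -> Y) :=
  forall vs, (size vs <= m)%N -> forall p, O p ->
    differentiable (foldr (fun v g => fun q => 'D_v g q) f vs) p.

Lemma smooth_openE (X Y : normedModType R) (O : set X) (f : X -> Y) :
  smooth_open O f <-> forall m, Ck m O f.
Proof. by split=> [sf m vs _|sf vs p Op]; [exact: sf|exact: (sf (size vs))]. Qed.

Section Fixed.
Context {X Y : normedModType R} (O : set X) (oO : open O).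
Implicit Types f g : X -> Y.

Lemma Ck_differentiable m f p : Ck m O f -> O p -> differentiable f p.
Proof. by move=> /(_ [::]) H Op; exact: H. Qed.

(** The derivative split off is the innermost one, the last vector of the list. Thus rules for sums,
    products and compositions need to be known for a single derivative only. *)
Lemma CkS m f : Ck m.+1 O f <->
  (forall p, O p -> differentiable f p) /\ forall v, Ck m O (fun q => 'D_v f q).
Proof.
split=> [H|[H0 H1] vs].
  split=> [p Op|v vs svs p Op]; first exact: (H [::]).
  by have := H (rcons vs v); rewrite size_rcons foldr_rcons; exact.
elim/last_ind: vs => [_|vs v _]; first exact: H0.
by rewrite size_rcons foldr_rcons => svs p Op; exact: H1.
Qed.

Lemma CkW m f : Ck m.+1 O f -> Ck m O f.
Proof. by move=> H vs svs; apply: H; exact: leqW. Qed.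

Lemma derive_germ f g v : {in O, f =1 g} ->
  {in O, (fun q => 'D_v f q) =1 (fun q => 'D_v g q)}.
Proof.
move=> fg p /set_mem Op; apply: near_eq_derive.
by apply: filterS (open_nbhs_nbhs (conj oO Op)) => q Oq; apply: fg; exact: mem_set.
Qed.

Lemma Ck_germ m f g : {in O, f =1 g} -> Ck m O f -> Ck m O g.
Proof.
move=> fg Hf vs svs p Op.
have E : {in O, foldr (fun v g => fun q => 'D_v g q) f vs =1
               foldr (fun v g => fun q => 'D_v g q) g vs}.
  by elim: vs {svs} => //= v vs; exact: derive_germ.
have := Hf vs svs p Op; apply: near_eq_differentiable.
by apply: filterS (open_nbhs_nbhs (conj oO Op)) => q Oq; apply: E; exact: mem_set.
Qed.

Lemma Ck_cst m (c : Y) : Ck m O (cst c).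
Proof.
elim: m c => [|m IH] c; first by case=> // _ p _; exact: differentiable_cst.
apply/CkS; split=> [p _|v]; first exact: differentiable_cst.
rewrite (_ : (fun q => _) = cst 0) //; apply/funext => q; exact: derive_cst.
Qed.

Lemma CkD m f g : Ck m O f -> Ck m O g -> Ck m O (fun x => f x + g x).
Proof.
elim: m f g => [|m IH] f g Cf Cg.
  by case=> // _ p Op; apply: differentiableD; [exact: (Cf [::])|exact: (Cg [::])].
apply/CkS; split=> [p Op|v].
  by apply: differentiableD; [exact: (Cf [::])|exact: (Cg [::])].
have /CkS[df /(_ v) Df] := Cf; have /CkS[dg /(_ v) Dg] := Cg.
apply: Ck_germ (IH _ _ Df Dg) => p /set_mem Op.
by rewrite deriveD //; apply: diff_derivable; [exact: df|exact: dg].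
Qed.

Lemma Ck_sum m I (r : seq I) (f : I -> X -> Y) :
  (forall i, Ck m O (f i)) -> Ck m O (fun x => \sum_(i <- r) f i x).
Proof.
move=> Cf; elim: r => [|i r IH].
  by under [fun x => _]funext do rewrite big_nil; exact: Ck_cst.
by under [fun x => _]funext do rewrite big_cons; exact: CkD.
Qed.

End Fixed.

Lemma CkM (X : normedModType R) (O : set X) m (f g : X -> R) : open O ->
  Ck m O f -> Ck m O g -> Ck m O (fun x => f x * g x).
Proof.
move=> oO; elim: m f g => [|m IH] f g Cf Cg.
  by case=> // _ p Op; apply: differentiableM; [exact: (Cf [::])|exact: (Cg [::])].
apply/CkS; split=> [p Op|v].
  by apply: differentiableM; [exact: (Cf [::])|exact: (Cg [::])].
have /CkS[df /(_ v) Df] := Cf; have /CkS[dg /(_ v) Dg] := Cg.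
have := CkD oO (IH _ _ (CkW Cf) Dg) (IH _ _ (CkW Cg) Df).
apply: Ck_germ => // p /set_mem Op.
by rewrite deriveM //; apply: diff_derivable; [exact: df|exact: dg].
Qed.

Lemma differentiable_mxP (X : normedModType R) m n (f : X -> 'M[R]_(m, n)) p :
  differentiable f p <-> forall i j, differentiable (fun x => f x i j) p.
Proof.
split=> [df i j|df].
  apply: (differentiable_comp df (g := fun A : 'M[R]_(m, n) => A i j)).
  exact: differentiable_coord.
rewrite (_ : f = \sum_i \sum_j fun x => f x i j *: delta_mx i j).
  by apply: differentiable_sum => i; apply: differentiable_sum => j;
    exact: differentiableZl.
apply/funext => x; rewrite [LHS]matrix_sum_delta fct_sumE.
by apply: eq_bigr => i _; rewrite fct_sumE.
Qed.

Lemma Ck_mxP (X : normedModType R) (O : set X) k m n (f : X -> 'M[R]_(m, n)) :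
  open O -> Ck k O f <-> forall i j, Ck k O (fun x => f x i j).
Proof.
move=> oO; elim: k f => [|k IH] f.
  split=> [Cf i j|Cf] [] // _ p Op /=; last first.
    by apply/differentiable_mxP => i j; exact: (Cf i j [::]).
  by have /differentiable_mxP := Cf [::] isT p Op; exact.
have DE v : (forall p, O p -> differentiable f p) -> forall i j,
    {in O, (fun q => ('D_v f q) i j) =1 (fun q => 'D_v (fun x => f x i j) q)}.
  move=> df i j p /set_mem Op; rewrite derive_mx ?mxE //.
  by apply: diff_derivable; exact: df.
split=> [/CkS[df Df] i j|Cf].
  apply/CkS; split=> [p /df/differentiable_mxP //|v].
  by have /IH/(_ i j) := Df v; apply: Ck_germ => //; exact: DE.
have df p : O p -> differentiable f p.
  by move=> Op; apply/differentiable_mxP => i j; exact: (Ck_differentiable (Cf i j)).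
apply/CkS; split=> // v; apply/IH => i j.
have /CkS[_ /(_ v)] := Cf i j; apply: Ck_germ => //.
by move=> p Op; rewrite -(DE v df i j).
Qed.

(** The chain rule writes a derivative of [f \o phi] as a sum of products of a coordinate of
    ['D_v phi] with a partial derivative of [f] composed with [phi]; the latter falls under the
    induction hypothesis. *)
Lemma Ck_comp_real (X : normedModType R) (O' : set X) n (O : set 'rV[R]_n) m
    (phi : X -> 'rV[R]_n) (f : 'rV[R]_n -> R) : open O' -> open O ->
  (forall x, O' x -> O (phi x)) -> Ck m O' phi -> Ck m O f -> Ck m O' (f \o phi).
Proof.
move=> oO' oO O'O; elim: m f => [|m IH] f Cphi Cf.
  case=> // _ p Op; apply: differentiable_comp; first exact: (Cphi [::]).
  by apply: (Cf [::]) => //; exact: O'O.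
have /CkS[dphi Dphi] := Cphi; have /CkS[df Df] := Cf.
apply/CkS; split=> [p Op|v].
  by apply: differentiable_comp; [exact: dphi|apply: df; exact: O'O].
have E : {in O', (fun q => \sum_a ('D_v phi q) 0 a * 'D_(delta_mx 0 a) f (phi q)) =1
    (fun q => 'D_v (f \o phi) q)}.
  move=> q /set_mem Oq.
  have dfq := df _ (O'O _ Oq); have dpq := dphi _ Oq.
  rewrite [RHS]deriveE; last exact: differentiable_comp.
  rewrite diff_comp // /= -(deriveE v dpq) [in RHS](row_sum_delta ('D_v phi q)).
  rewrite linear_sum; apply: eq_bigr => a _.
  by rewrite linearZ /= (deriveE _ dfq).
apply: Ck_germ E _ => //; apply: Ck_sum => // a; apply: CkM => //.
  by have /(Ck_mxP _ _ oO') := Dphi v; exact.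
exact: (IH _ (CkW Cphi) (Df (delta_mx 0 a))).
Qed.

Lemma smooth_comp (X : normedModType R) (O' : set X) n (O : set 'rV[R]_n) p q
    (phi : X -> 'rV[R]_n) (f : 'rV[R]_n -> 'M[R]_(p, q)) : open O' -> open O ->
  (forall x, O' x -> O (phi x)) -> smooth_open O' phi -> smooth_open O f ->
  smooth_open O' (f \o phi).
Proof.
move=> oO' oO O'O /smooth_openE Cphi /smooth_openE Cf.
apply/smooth_openE => m; apply/(Ck_mxP _ _ oO') => i j.
apply: (Ck_comp_real oO' oO O'O (Cphi m) (f := fun y => f y i j)).
by have /(Ck_mxP _ _ oO) := Cf m; exact.
Qed.

Lemma smooth_line (X : normedModType R) (O : set R) (y v : X) :
  smooth_open O (fun r : R => y + r *: v).
Proof.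
have ds (q : R) : is_diff q (fun r : R => r *: v) (fun r : R => r *: v).
  exact: is_diff_scalel.
have dl (q : R) : differentiable (fun r : R => y + r *: v) q.
  by apply: (@differentiableD _ _ _ (cst y) (fun r : R => r *: v)); case: (ds q).
have Cl m : Ck m setT (fun r : R => y + r *: v).
  case: m => [|m]; first by case.
  apply/CkS; split=> [p _|w]; first exact: dl.
  rewrite (_ : (fun q => _) = cst (w *: v)); first exact: Ck_cst.
  apply/funext => q; rewrite deriveE; last exact: dl.
  rewrite (@diffD _ _ _ (cst y) (fun r : R => r *: v)) /=; last 2 first.
  - exact: differentiable_cst.
  - by case: (ds q).
  by rewrite diff_cst add0r; case: (ds q) => _ ->.
by move=> vs p _; exact: (Cl (size vs)).
Qed.

End Smoothness.

(** * Charts and the total space *)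

Section Charts.
Context {R : realType} {n : nat} {M : manifold R n}.
Implicit Types (i j : cidx M) (x : M) (y : 'rV[R]_n).

Lemma cimg_cdom i y : cimg i y -> cdom i (cinv i y).
Proof. by move=> [x xi <-]; rewrite cmapK. Qed.

Lemma cinvK i y : cimg i y -> cmap i (cinv i y) = y.
Proof. by move=> [x xi <-]; rewrite cmapK. Qed.

Lemma cimg_cmap i x : cdom i x -> cimg i (cmap i x).
Proof. by exists x. Qed.

Lemma chart_ex x : exists i y, cimg i y /\ x = cinv i y.
Proof.
have [i xi] := cdom_cover x; exists i, (cmap i x).
by split; [exact: cimg_cmap|rewrite cmapK].
Qed.

Lemma near_cimg i y : cimg i y -> \forall z \near y, cimg i z.
Proof. by move=> iy; apply: open_nbhs_nbhs; split=> //; exact: cimg_open. Qed.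

Lemma cinv_cvg i y : cimg i y -> cinv i @ y --> cinv i y.
Proof.
move=> iy; have := @cinv_continuous _ _ M i.
rewrite continuous_open_subspace; last exact: cimg_open.
by apply; exact: mem_set.
Qed.

Lemma cmap_cvg i x : cdom i x -> cmap i @ x --> cmap i x.
Proof.
move=> ix; have := @cmap_continuous _ _ M i.
rewrite continuous_open_subspace; last exact: cdom_open.
by apply; exact: mem_set.
Qed.

Definition overlap i j : set 'rV[R]_n := [set y | cimg i y /\ cdom j (cinv i y)].

Lemma overlapE i j : overlap i j = @cmap _ _ M i @` (cdom i `&` cdom j).
Proof.
apply/seteqP; split=> [y [[x xi <-]]|_ [x [xi xj] <-]].
  by rewrite cmapK // => xj; exists x.
by split; [exact: cimg_cmap|rewrite cmapK].
Qed.

Lemma overlap_open i j : open (overlap i j).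
Proof.
rewrite openE => y [iy jy]; apply: filterI; first exact: near_cimg.
by apply: (cinv_cvg iy); apply: open_nbhs_nbhs; split=> //; exact: cdom_open.
Qed.

Lemma ctrans_smooth_overlap i j :
  smooth_open (overlap i j) (@cmap _ _ M j \o cinv i).
Proof. by rewrite overlapE; exact: ctrans_smooth. Qed.

End Charts.

(** [tinv V i x] is known to be linear only for [x] in the chart domain, so it is not a bundled
    linear map; linearity is packed on the spot. *)
Lemma mul_rV_lin1_linear (R : pzRingType) m n (f : 'rV[R]_m -> 'rV[R]_n) u :
  linear f -> u *m lin1_mx f = f u.
Proof.
move=> fl; pose g : {linear 'rV[R]_m -> 'rV[R]_n} :=
  HB.pack f (GRing.isLinear.Build _ _ _ _ f fl).
exact: (mul_rV_lin1 g).
Qed.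

Section BundleCharts.
Context {R : realType} {n k : nat} {M : manifold R n} {V : vbundle M k}.
Implicit Types (i j : cidx M) (x : M) (y : 'rV[R]_n) (w : 'rV[R]_k).

Lemma triv_inj i x : cdom i x -> injective (triv V i x).
Proof. by move=> xi; exact: can_inj (trivK xi). Qed.

Lemma tinv_linear i x : cdom i x -> linear (tinv V i x).
Proof.
move=> xi c v w; apply: (triv_inj xi).
by rewrite linearP !tinvK.
Qed.

Lemma ttransE i j y w : overlap i j y ->
  triv V j (cinv i y) (tinv V i (cinv i y) w) = w *m ttrans V i j y.
Proof.
move=> [iy jy]; rewrite mul_rV_lin1_linear // => c v v' /=.
by rewrite tinv_linear ?linearP //; exact: cimg_cdom.
Qed.

Lemma ttrans_smooth_overlap i j : smooth_open (overlap i j) (ttrans V i j).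
Proof. by rewrite overlapE; exact: ttrans_smooth. Qed.

Definition vec i y w : total_space V := Tot (tinv V i (cinv i y) w).

Lemma vec_cvg i y w : cimg i y ->
  (fun p => vec i p.1 p.2) @ (y, w) --> vec i y w.
Proof.
move=> iy W; rewrite nbhsE; move=> [B [oB Bw] BW].
have := oB i => oi; apply: (@filterS _ _ _ [set p : 'rV[R]_n * 'rV[R]_k |
    cimg i p.1 /\ B (Tot (tinv V i (cinv i p.1) p.2))]).
  by move=> p [_ /BW].
exact: open_nbhs_nbhs.
Qed.

Lemma triv_cvg i (v : total_space V) : cdom i (tot_base v) ->
  (fun v => triv V i (tot_base v) (tot_vec v)) @ v -->
  triv V i (tot_base v) (tot_vec v).
Proof.
move=> iv W; rewrite nbhsE; move=> [B [oB Bv] BW].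
suff oi : open [set v : total_space V | cdom i (tot_base v) /\
    B (triv V i (tot_base v) (tot_vec v))].
  apply: filterS (open_nbhs_nbhs (conj oi _)); last by split.
  by move=> v' [_ /BW].
move=> j; rewrite openE; move=> [y w] /= [jy [iy Bw]].
have ov : overlap j i y by [].
have dt : {for y, continuous (ttrans V j i)}.
  by apply: differentiable_continuous; exact: (@ttrans_smooth_overlap j i [::]).
have ct : (fun p : 'rV[R]_n * 'rV[R]_k => p.2 *m ttrans V j i p.1) @ (y, w) -->
    w *m ttrans V j i y.
  apply: cvg_mulmx; first exact: cvg_snd.
  by apply: (@cvg_comp _ _ _ fst (ttrans V j i)); [exact: cvg_fst|exact: dt].
have nO : nbhs (w *m ttrans V j i y) B.
  by apply: open_nbhs_nbhs; split=> //; rewrite -ttransE.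
have nov : \forall p \near ((y, w) : 'rV[R]_n * 'rV[R]_k), overlap j i p.1.
  have c1 : fst @ ((y, w) : 'rV[R]_n * 'rV[R]_k) --> y by exact: cvg_fst.
  apply: (c1 (overlap j i)).
  by apply: open_nbhs_nbhs; split=> //; exact: overlap_open.
apply: filterS2 nov (ct _ nO) => -[z w'] /= ovz Bz.
by case: (ovz) => jz iz; rewrite /= ttransE.
Qed.

Context (h : bundle_metric V).

Definition gram i y : 'M[R]_k := \matrix_(p < k, q < k)
  h (cinv i y) (tinv V i (cinv i y) (basis_vec p)) (tinv V i (cinv i y) (basis_vec q)).

Lemma hmet_suml x I (r : seq I) (f : I -> V x) (v : V x) :
  h x (\sum_(a <- r) f a) v = \sum_(a <- r) h x (f a) v.
Proof.
elim: r => [|a r IH]; last by rewrite !big_cons -IH -[f a]scale1r hmet_lin mul1r scale1r.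
by rewrite !big_nil; have := hmet_lin h (-1) 0 0 v; rewrite scaler0 addr0; lra.
Qed.

Lemma hmetZl x c (v w : V x) : h x (c *: v) w = c * h x v w.
Proof.
have h0 : h x 0 w = 0.
  by have := hmet_lin h (-1) 0 0 w; rewrite scaler0 addr0; lra.
by rewrite -[c *: v]addr0 hmet_lin h0 addr0.
Qed.

Lemma hmetE i y (v w : V (cinv i y)) : cimg i y ->
  h (cinv i y) v w =
  bil (gram i y) (triv V i (cinv i y) v) (triv V i (cinv i y) w).
Proof.
move=> iy; have di := cimg_cdom iy.
have dec u : u = \sum_p (triv V i (cinv i y) u) 0 p *: tinv V i (cinv i y) (basis_vec p).
  apply: (triv_inj di); rewrite linear_sum [LHS]row_sum_delta.
  by apply: eq_bigr => p _; rewrite linearZ /= tinvK.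
rewrite {1}(dec v) hmet_suml bilE; apply: eq_bigr => p _.
rewrite hmetZl hmet_sym {1}(dec w) hmet_suml mulr_sumr; apply: eq_bigr => q _.
by rewrite hmetZl hmet_sym mxE; ring.
Qed.

Lemma gram_posdef i y : cimg i y -> posdef (gram i y).
Proof.
move=> iy; have di := cimg_cdom iy; split=> [|v v0].
  by apply/matrixP => p q; rewrite !mxE hmet_sym.
have -> : bil (gram i y) v v =
    h (cinv i y) (tinv V i (cinv i y) v) (tinv V i (cinv i y) v).
  by rewrite hmetE // tinvK.
apply: hmet_pos; apply: contra_neq v0 => tv0.
by rewrite -(tinvK V di v) tv0 linear0.
Qed.

Lemma gram_differentiable i y : cimg i y -> differentiable (gram i) y.
Proof. by move=> iy; exact: (@hmet_smooth _ _ _ _ _ h i [::]). Qed.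

End BundleCharts.

Arguments vec {R n k M} V i y w.

(** * Parallel transport along segments of a chart *)

Section SmoothOn.
Context {R : realType}.

Lemma smooth_on_within_cvg (X Y : normedModType R) (A : set X) (f : X -> Y) p :
  smooth_on A f -> A p -> f @ within A (nbhs p) --> f p.
Proof.
move=> sf Ap; have [B [f' [oB Bp sf' ff']]] := sf p Ap.
rewrite (ff' p Bp Ap).
have cf' : {for p, continuous f'}.
  by apply: differentiable_continuous; exact: (sf' [::]).
move=> W /cf' W'; rewrite /within /=.
apply: filterS2 (open_nbhs_nbhs (conj oB Bp)) W' => q Bq Wq Aq.
by rewrite /= ff'.
Qed.

Lemma smooth_on_cylinder_differentiable n (M : manifold R n) T (i : cidx M)
    (Y : normedModType R) (f : 'rV[R]_n * R -> Y) t y :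
  smooth_on (cylinder T i) f -> 0 <= t <= T -> cimg i y ->
  differentiable (fun z => f (z, t)) y.
Proof.
move=> sf tT iy; have cyt : cylinder T i (y, t) by [].
have [B [f' [oB Bp sf' ff']]] := sf (y, t) cyt.
have dpair z : differentiable (fun z : 'rV[R]_n => (z, t)) z.
  by apply: differentiable_pair => //; exact: differentiable_cst.
have cpair z := differentiable_continuous (dpair z).
apply: (@near_eq_differentiable _ _ _ (f' \o fun z => (z, t))).
  have nB : \forall z \near y, B (z, t).
    exact: (cpair y B (open_nbhs_nbhs (conj oB Bp))).
  by apply: filterS2 nB (near_cimg iy) => z Bz iz /=; rewrite -ff'.
by apply: differentiable_comp; [exact: dpair|exact: (sf' [::])].
Qed.

End SmoothOn.

Lemma bil_basis (R : realType) k (B : 'M[R]_k) p q :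
  bil B (basis_vec p) (basis_vec q) = B p q.
Proof. by rewrite /bil -rowE trmx_delta -colE !mxE. Qed.

Section Transport.
Context {R : realType} {n k : nat} {M : manifold R n} {V : vbundle M k}.
Context {T : R} (A : connection_family V T).
Implicit Types (i j : cidx M) (x : M) (y : 'rV[R]_n) (w : 'rV[R]_k).

Lemma ttransE_point i j x w : cdom i x -> cdom j x ->
  triv V j x (tinv V i x w) = w *m ttrans V i j (cmap i x).
Proof.
move=> xi xj; have := @ttransE _ _ _ _ V i j (cmap i x) w.
by rewrite cmapK //; apply; split; [exact: cimg_cmap|rewrite cmapK].
Qed.

Definition conn_dir t i y (v : 'rV[R]_n) : 'M[R]_k := \sum_a v 0 a *: A t i y a.

(** These are the test sections for [metric_compatible]: their components are constant in chart [i],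
    so there only the connection matrix contributes to the covariant derivative. *)
Lemma smooth_constant_section i w :
  smooth_section (cdom i) (fun x => tinv V i x w).
Proof.
move=> j; rewrite -overlapE.
have := @smooth_comp R 'rV[R]_n (overlap j i) n (overlap i j) 1 k
  (@cmap _ _ M i \o cinv j) (fun y => w *m ttrans V i j y).
move=> /(_ (@overlap_open _ _ _ _ _) (@overlap_open _ _ _ _ _)) H.
have ov y : overlap j i y -> overlap i j (cmap i (cinv j y)).
  by move=> [jy iy]; split; [exact: cimg_cmap|rewrite cmapK //; exact: cimg_cdom].
have {}H : smooth_open (overlap j i)
    ((fun y => w *m ttrans V i j y) \o (@cmap _ _ M i \o cinv j)).
  apply: H => //; first exact: ctrans_smooth_overlap.
  apply/smooth_openE => m; apply/Ck_mxP => [|a b]; first exact: overlap_open.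
  have -> : (fun y => (w *m ttrans V i j y) a b) =
      (fun y => \sum_c w a c * ttrans V i j y c b).
    by apply/funext => y; rewrite mxE.
  apply: Ck_sum => [|c]; first exact: overlap_open.
  apply: CkM; [exact: overlap_open|exact: Ck_cst|].
  have /smooth_openE/(_ m) := @ttrans_smooth_overlap _ _ _ _ V i j.
  by move=> /(Ck_mxP _ _ (@overlap_open _ _ _ i j)); exact.
apply/smooth_openE => m; move/smooth_openE : H => /(_ m).
apply: Ck_germ; first exact: overlap_open.
move=> y /set_mem [jy iy]; rewrite /lrep /= ttransE_point //.
exact: cimg_cdom.
Qed.

(** Metric compatibility applied to pairs of sections with constant basis components gives the
    partial derivatives; differentiability of the Gram matrix extends the formula linearly to
    [v]. *)
Lemma gram_derive (h : bundle_metric V) t i y v : metric_compatible A h ->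
  0 <= t <= T -> cimg i y ->
  is_derive y v (gram h i)
    (conn_dir t i y v *m gram h i y + gram h i y *m (conn_dir t i y v)^T).
Proof.
move=> Ah tT iy.
have dG := gram_differentiable h iy.
apply: DeriveDef; first exact: diff_derivable.
have part a : 'D_(delta_mx 0 a) (gram h i) y =
    A t i y a *m gram h i y + gram h i y *m (A t i y a)^T.
  rewrite derive_mx; last exact: diff_derivable.
  apply/matrixP => p q; rewrite mxE.
  have di := cimg_cdom iy.
  have := Ah t (cdom i) _ _ tT (cdom_open i) (smooth_constant_section (basis_vec p))
    (smooth_constant_section (basis_vec q)) i (cinv i y) a di di.
  rewrite cinvK //=.
  have lrepE w : cov_deriv A t i a (lrep i (fun x => tinv V i x w)) y =
      w *m A t i y a.
    rewrite /cov_deriv.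
    have E : \forall z \near y, lrep i (fun x => tinv V i x w) z = w.
      apply: filterS (near_cimg iy) => z iz; rewrite /lrep tinvK //.
      exact: cimg_cdom.
    rewrite (nbhs_singleton E) (near_eq_derive (g := cst w)) //.
    by rewrite derive_cst add0r.
  rewrite !lrepE (_ : (fun z => _) = (fun z => gram h i z p q)); last first.
    by apply/funext => z; rewrite mxE.
  move=> ->; rewrite !hmetE // !tinvK //.
  rewrite [RHS]mxE -2!bil_basis; congr (_ + _).
    by rewrite /bil !mulmxA.
  by rewrite /bil trmx_mul !mulmxA.
rewrite deriveE // {1}(row_sum_delta v) linear_sum /=.
rewrite linear_sum mulmx_suml mulmx_sumr -big_split; apply: eq_bigr => a _ /=.
by rewrite linearZ /= -deriveE // part linearZ /= -scalemxAl -scalemxAr -scalerDr.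
Qed.

End Transport.

(** * One-sided derivatives on intervals *)

Section DerivWithin.
Context {R : realType} {Y : normedModType R}.

Lemma is_derive_deriv_within (J : set R) (f : R -> Y) (s : R) (l : Y) :
  is_derive s 1 f l -> deriv_within J f s l.
Proof.
move=> [df dl]; have {df dl} :
    (fun h : R => h^-1 *: ((f \o shift s) (h *: 1) - f s)) @ 0^' --> l.
  by rewrite -dl; exact: df.
move=> /cvgrPdist_le H; apply/cvgrPdist_le => e e0.
have /= [d d0 Hd] := H e e0.
exists d => //= r rs rns _; have := Hd (r - s).
rewrite /ball_ /= sub0r normrN distrC subr_eq0 => /(_ rs rns).
by rewrite [_ *: 1]mulr1 subrK.
Qed.

Lemma deriv_within_eq (J : set R) (f g : R -> Y) (s : R) (l : Y) :
  (\forall r \near s, J r -> f r = g r) -> f s = g s ->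
  deriv_within J f s l -> deriv_within J g s l.
Proof.
move=> fg fgs H; rewrite /deriv_within -fgs; apply: cvg_trans H.
apply: near_eq_cvg.
have fg' : s^' [set r | J r -> f r = g r] by exact: (@cvg_within _ (nbhs s)).
by apply: (@filterS _ s^' _ _ _ _ fg') => r /= fgr /fgr ->.
Qed.

Lemma within_itv_proper (a b s : R) : a < b -> a <= s <= b ->
  ProperFilter (within `[a, b] s^').
Proof.
move=> ab /andP[as_ sb]; apply: Build_ProperFilter => //.
rewrite /within /= => -[d /= d0 H].
have [sb'|sb'] := ltP s b.
  pose r := s + Num.min (d / 2) (b - s).
  have m0 : 0 < Num.min (d / 2) (b - s) by rewrite lt_min divr_gt0 // subr_gt0.
  have md : Num.min (d / 2) (b - s) < d by rewrite gt_min; apply/orP; left; lra.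
  have mb : Num.min (d / 2) (b - s) <= b - s by rewrite ge_min lexx orbT.
  apply: (H r) => /=.
  - by rewrite /ball_ /= /r opprD addNKr normrN gtr0_norm.
  - by rewrite /r -subr_eq0 addrAC subrr add0r gt_eqF.
  - by rewrite in_itv /= /r; lra.
have {sb'}sb : s = b by apply/eqP; rewrite eq_le sb.
pose r := s - Num.min (d / 2) (s - a).
have m0 : 0 < Num.min (d / 2) (s - a) by rewrite lt_min divr_gt0 // subr_gt0 sb.
have md : Num.min (d / 2) (s - a) < d by rewrite gt_min; apply/orP; left; lra.
have mb : Num.min (d / 2) (s - a) <= s - a by rewrite ge_min lexx orbT.
apply: (H r) => /=.
- by rewrite /ball_ /= /r opprB addrC subrK gtr0_norm.
- by rewrite /r -subr_eq0 addrAC subrr add0r oppr_eq0 gt_eqF.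
- by rewrite in_itv /= /r; lra.
Qed.

Lemma deriv_within_unique (a b : R) (f : R -> Y) (s : R) (l l' : Y) :
  a < b -> a <= s <= b ->
  deriv_within `[a, b] f s l -> deriv_within `[a, b] f s l' -> l = l'.
Proof.
move=> ab sab; have := within_itv_proper ab sab => FF Hl Hl'.
exact: (cvg_unique _ Hl Hl').
Qed.

End DerivWithin.

Lemma derive_rV (R : realType) n (Y : normedModType R) (f : 'rV[R]_n -> Y) y v :
  differentiable f y -> 'D_v f y = \sum_a v 0 a *: 'D_(delta_mx 0 a) f y.
Proof.
move=> df; rewrite deriveE // {1}(row_sum_delta v) linear_sum.
by apply: eq_bigr => a _; rewrite linearZ deriveE.
Qed.

Section ParallelTransport.
Context {R : realType} {n k : nat} {M : manifold R n} {V : vbundle M k}.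
Context {T : R} (A : connection_family V T).
Implicit Types (i j : cidx M) (x : M) (y v : 'rV[R]_n) (w : 'rV[R]_k) (t r : R).

(** [parallel] tests the equation in every chart [j], while [W] solves it in chart [i]. The
    transformation law of the connection matrices carries it over: the derivative of [ttrans] it
    contains cancels the one from the product rule. *)
Lemma segment_parallel t i y v (W : R -> 'rV[R]_k) : 0 <= t <= T ->
  (forall r, 0 <= r <= 1 -> cimg i (y + r *: v)) ->
  (forall r, 0 <= r <= 1 ->
     is_derive r 1 W (- (W r *m conn_dir A t i (y + r *: v) v))) ->
  parallel A t (fun r => vec V i (y + r *: v) (W r)).
Proof.
move=> tT seg dW j r vel r01 /= jr Hvel.
set z := y + r *: v; have iz : cimg i z by exact: seg.
have oz : overlap i j z by [].
have dphi : differentiable (cmap j \o cinv i) z.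
  exact: (@ctrans_smooth_overlap _ _ _ i j [::]).
have dtt : differentiable (ttrans V i j) z.
  exact: (@ttrans_smooth_overlap _ _ _ _ V i j [::]).
(* [vel] is an arbitrary derivative within [[0, 1]]; uniqueness of such derivatives identifies
   it. *)
have velE : vel = v *m jacobian (cmap j \o cinv i) z.
  apply: (deriv_within_unique ltr01 r01 Hvel).
  apply: is_derive_deriv_within; rewrite -deriveEjacobian //.
  apply: (@is_derive_line _ _ _ (cmap j \o cinv i)).
  by apply: DeriveDef => //; exact: diff_derivable.
have dWt : is_derive r 1 (fun q => W q *m ttrans V i j (y + q *: v))
    (- (W r *m conn_dir A t i z v) *m ttrans V i j z + W r *m 'D_v (ttrans V i j) z).
  apply: is_derive_mulmx; first exact: dW.
  apply: (@is_derive_line _ _ _ (ttrans V i j)).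
  by apply: DeriveDef => //; exact: diff_derivable.
have near_ov : \forall q \near r, overlap i j (y + q *: v).
  have cl : {for r, continuous (fun q : R => y + q *: v)}.
    by apply: differentiable_continuous; exact: (@smooth_line _ _ setT _ _ [::]).
  apply: (cl (overlap i j)); apply: open_nbhs_nbhs.
  by split=> //; exact: overlap_open.
apply: (@deriv_within_eq _ _ _ (fun q => W q *m ttrans V i j (y + q *: v))).
- by apply: filterS near_ov => q oq _; rewrite ttransE.
- by rewrite ttransE.
have connE : conn_dir A t i z v *m ttrans V i j z = 'D_v (ttrans V i j) z +
    \sum_b vel 0 b *: (ttrans V i j z *m A t j (cmap j (cinv i z)) b).
  rewrite /conn_dir mulmx_suml derive_rV // velE.
  under [X in _ = _ + X]eq_bigr do rewrite mxE scaler_suml.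
  rewrite exchange_big -big_split; apply: eq_bigr => a _ /=.
  have := @conn_trans _ _ _ _ _ _ A t i j (cinv i z) a tT (cimg_cdom iz) jr.
  rewrite /= cinvK // -scalemxAl => ->; rewrite scalerDr scaler_sumr.
  by congr (_ + _); apply: eq_bigr => b _; rewrite scalerA.
have -> : - (\sum_a vel 0 a *: (triv V j (cinv i z) (tinv V i (cinv i z) (W r)) *m
      A t j (cmap j (cinv i z)) a)) =
    - (W r *m conn_dir A t i z v) *m ttrans V i j z + W r *m 'D_v (ttrans V i j) z.
  rewrite ttransE // mulNmx -mulmxA connE mulmxDr opprD addrAC addNr add0r.
  congr (- _); rewrite mulmx_sumr; apply: eq_bigr => b _.
  by rewrite -scalemxAr mulmxA.
exact: is_derive_deriv_within.
Qed.

Lemma segment_smooth_curve i y v :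
  (forall r, 0 <= r <= 1 -> cimg i (y + r *: v)) ->
  smooth_curve (fun r => cinv i (y + r *: v)).
Proof.
move=> seg.
have cl r : {for r, continuous (fun q : R => y + q *: v)}.
  by apply: differentiable_continuous; exact: (@smooth_line _ _ setT _ _ [::]).
split.
  apply/subspace_continuousP => r; rewrite /= in_itv /= => /seg ir.
  apply: cvg_within_filter.
  apply: (@cvg_comp _ _ _ (fun q : R => y + q *: v) (cinv i)); first exact: cl.
  exact: cinv_cvg.
move=> j r [r01 jr].
have oo : open ((fun q : R => y + q *: v) @^-1` overlap i j).
  by apply: open_comp; [move=> q _; exact: cl|exact: overlap_open].
exists ((fun q : R => y + q *: v) @^-1` overlap i j),
  ((cmap j \o cinv i) \o (fun q : R => y + q *: v)); split=> //.
- by split=> //; exact: seg.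
- apply: (@smooth_comp _ _ _ _ (overlap i j) 1 n) => //.
  + exact: overlap_open.
  + exact: smooth_line.
  + exact: ctrans_smooth_overlap.
Qed.

Lemma parallel_invariant_segment t i y v (W : R -> 'rV[R]_k) K : 0 <= t <= T ->
  parallel_invariant A t K ->
  (forall r, 0 <= r <= 1 -> cimg i (y + r *: v)) ->
  (forall r, 0 <= r <= 1 ->
     is_derive r 1 W (- (W r *m conn_dir A t i (y + r *: v) v))) ->
  K (vec V i y (W 0)) -> K (vec V i (y + v) (W 1)).
Proof.
move=> tT Kinv seg dW.
have := Kinv (fun r => vec V i (y + r *: v) (W r))
  (segment_smooth_curve seg) (segment_parallel tT seg dW).
by rewrite /= scale0r addr0 scale1r.
Qed.

(** Near [(y0, t0)] the connection matrices are bounded, so on short segments the linear transport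
    equation has a small Lipschitz constant, and a single use of [picard] covers the parameters from
    0 to 1. The size [d] is uniform in the time, the segment and the initial vector. *)
Lemma segment_transport i y0 t0 : cimg i y0 -> 0 <= t0 <= T ->
  exists C d, [/\ 0 <= C, 0 < d & forall t y v, 0 <= t <= T -> `|t - t0| < d ->
    `|y - y0| < d -> `|y + v - y0| < d ->
    (forall r, 0 <= r <= 1 -> cimg i (y + r *: v)) /\
    forall w, exists W, W 0 = w /\ forall r, 0 <= r <= 1 ->
      is_derive r 1 W (- (W r *m conn_dir A t i (y + r *: v) v)) /\
      `|W r - w| <= C * `|v| * `|w|].
Proof.
move=> iy0 t0T; have cyl0 : cylinder T i (y0, t0) by [].
pose c := \sum_a (`|A t0 i y0 a| + 1).
have c0 : 0 <= c by apply: sumr_ge0 => a _; rewrite addr_ge0.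
have : \forall p \near ((y0, t0) : 'rV[R]_n * R), cimg i p.1 /\
    forall a, 0 <= p.2 <= T -> `|A p.2 i p.1 a| <= `|A t0 i y0 a| + 1.
  have n1 : \forall p \near ((y0, t0) : 'rV[R]_n * R), cimg i p.1.
    have c1 : fst @ ((y0, t0) : 'rV[R]_n * R) --> y0 by exact: cvg_fst.
    exact: (c1 _ (near_cimg iy0)).
  have n2 : \forall p \near ((y0, t0) : 'rV[R]_n * R),
      forall a, cylinder T i p -> `|A p.2 i p.1 a| <= `|A t0 i y0 a| + 1.
    apply: (@filter_forall _ _ (fun a (p : 'rV[R]_n * R) => cylinder T i p ->
      `|A p.2 i p.1 a| <= `|A t0 i y0 a| + 1) _ (nbhs_filter _)) => a.
    have /cvgrPdist_le/(_ 1 ltr01) :=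
      smooth_on_within_cvg (@conn_smooth _ _ _ _ _ _ A i a) cyl0.
    rewrite near_withinE; apply: filterS => p /= H pc; move: (H pc) => {}H.
    rewrite -(subrK (A t0 i y0 a) (A p.2 i p.1 a)) addrC (le_trans (ler_normD _ _)) //.
    by rewrite lerD2l distrC.
  by apply: filterS2 n1 n2 => p ip Hp; split=> // a pT; exact: Hp.
move=> /nbhs_ballP[e /= e0 He].
pose L0 := k%:R * c.
have L00 : 0 <= L0 by rewrite mulr_ge0.
(* Both ends lie within [d] of [y0], so [v] has norm at most [2 * d], and the Lipschitz constant
   [L0] times this norm is at most 1/2, as [picard] requires. *)
pose d := Num.min e (4^-1 / (L0 + 1)).
have d0 : 0 < d by rewrite lt_min e0 divr_gt0 // ltr_wpDl.
have de : d <= e by rewrite ge_min lexx.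
have dL : L0 * (2 * d) <= 2^-1.
  have : d * (L0 + 1) <= 4^-1 by rewrite -ler_pdivlMr ?ltr_wpDl // ge_min lexx orbT.
  by rewrite mulrDr mulr1 [L0 * _]mulrCA [L0 * d]mulrC; lra.
exists (2 * L0), d; split=> //; first by rewrite mulr_ge0.
move=> t y v tT td yd yvd.
have near_seg r : 0 <= r <= 1 -> ball ((y0, t0) : 'rV[R]_n * R) e (y + r *: v, t).
  move=> /andP[r0 r1]; split; rewrite -ball_normE /ball_ /= distrC ?(lt_le_trans td) //.
  have -> : y + r *: v - y0 = (1 - r) *: (y - y0) + r *: (y + v - y0).
    by rewrite scalerBl scale1r !scalerBr scalerDr; apply/rowP => a; rewrite !mxE; ring.
  rewrite (le_lt_trans (ler_normD _ _)) // !normrZ !ger0_norm ?subr_ge0 //.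
  rewrite (lt_le_trans _ de) // (@le_lt_trans _ _ (Num.max `|y - y0| `|y + v - y0|)) //.
    have : `|y - y0| <= Num.max `|y - y0| `|y + v - y0| by rewrite le_max lexx.
    have : `|y + v - y0| <= Num.max `|y - y0| `|y + v - y0| by rewrite le_max lexx orbT.
    nra.
  by rewrite gt_max yd.
have seg r : 0 <= r <= 1 -> cimg i (y + r *: v) by move=> /near_seg/He[].
have v2d : `|v| <= 2 * d.
  rewrite (_ : v = (y + v - y0) - (y - y0)); last by apply/rowP => a; rewrite !mxE; ring.
  by rewrite (le_trans (ler_normB _ _)) // mulr_natl mulr2n ltW // ltrD.
split=> // w.
pose B r := conn_dir A t i (y + clamp 0 1 r *: v) v.
have cl r : 0 <= clamp 0 1 r <= 1 by exact: clamp_in.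
have Bc r : `|B r| <= c * `|v|.
  rewrite /B /conn_dir (le_trans (ler_norm_sum _ _ _)) // mulr_suml ler_sum // => a _.
  rewrite normrZ mulrC ler_pM // ?mx_norm_coord //.
  by have /He[_ /(_ a tT)] := near_seg _ (cl r).
have cB : continuous B.
  move=> r; apply: (@cvg_sum _ _ _ _ _ _ _
    (fun a q => v 0 a *: A t i (y + clamp 0 1 q *: v) a)) => a; apply: cvgZl_tmp.
  have /seg ir := cl r.
  apply: (@cvg_comp _ _ _ (fun q => y + clamp 0 1 q *: v) (fun z => A t i z a)).
    apply: cvgD; first exact: cvg_cst.
    by apply: cvgZr_tmp; exact: clamp_continuous.
  have := smooth_on_cylinder_differentiable (@conn_smooth _ _ _ _ _ _ A i a) tT ir.
  exact: differentiable_continuous.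
have mulB w' r : `|w' *m B r| <= L0 * `|v| * `|w'|.
  rewrite (le_trans (mx_norm_mulmx _ _)) //.
  rewrite (le_trans (ler_wpM2l _ (Bc r))) ?mulr_ge0 // /L0.
  by rewrite mulrACA -!mulrA; do ! rewrite ler_wpM2l //; rewrite mulrC.
have [|||r w1 w2|w'|r _|W [W0 HW]] := @picard R k (fun r w' => - (w' *m B r))
    (L0 * `|v|) (L0 * `|v| * `|w|) 0 1 w.
- exact: ler01.
- by rewrite mulr_ge0.
- by rewrite mulr1 (le_trans _ dL) // ler_wpM2l.
- by rewrite -opprD normrN -mulmxBl; exact: mulB.
- by move=> r; apply: cvgN; apply: cvg_mulmx; [exact: cvg_cst|exact: cB].
- by rewrite normrN.
exists W; split=> // r r01; have [|dW Wb] := HW r; first by rewrite add0r.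
by move: dW; rewrite /B clamp_id // => dW; split=> //; rewrite -!mulrA in Wb *; lra.
Qed.

End ParallelTransport.

(** * The flow of the ODE in a fiber *)

Lemma cvg_pair_nbhs T (F : set_system T) {FF : Filter F} (X Y : topologicalType)
    (f : T -> X) (g : T -> Y) (x : X) (y : Y) :
  f @ F --> x -> g @ F --> y -> (fun t => (f t, g t)) @ F --> (x, y).
Proof. by move=> fx gy; exact: (@cvg_pair _ _ _ F (nbhs x) (nbhs y)). Qed.

Section FiberFlow.
Context {R : realType} {n k : nat} {M : manifold R n} {V : vbundle M k}.
Context (h : bundle_metric V) (T : R) (U : set (total_space V)) (U_open : open U).
Context (F : forall x : M, V x -> R -> V x).
Context (F_cont : continuous_field T U F) (F_lip : lipschitz_field T U F h).
Implicit Types (i j : cidx M) (x : M) (y : 'rV[R]_n) (w : 'rV[R]_k) (t r : R).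

Definition Frep i y w t : 'rV[R]_k :=
  triv V i (cinv i y) (F (tinv V i (cinv i y) w) t).

Lemma hnormE i y (v : V (cinv i y)) : cimg i y -> hnorm h v =
  Num.sqrt (bil (gram h i y) (triv V i (cinv i y) v) (triv V i (cinv i y) v)).
Proof. by move=> iy; rewrite /hnorm hmetE. Qed.

Lemma vec_fiber_cvg i y w : cimg i y -> vec V i y @ w --> vec V i y w.
Proof.
move=> iy; apply: (@cvg_comp _ _ _ (fun w => (y, w)) (fun p => vec V i p.1 p.2) _
  (nbhs ((y, w) : 'rV[R]_n * 'rV[R]_k)) _ _ (vec_cvg iy)).
apply: (@cvg_pair_nbhs _ (nbhs w) _ _ _ (cst y) id); last exact: cvg_id.
exact: cvg_cst.
Qed.

Lemma vec_time_cvg i y w t : cimg i y ->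
  (fun p => (vec V i y p.1, p.2)) @ ((w, t) : 'rV[R]_k * R) --> (vec V i y w, t).
Proof.
move=> iy; apply: cvg_pair_nbhs.
  apply: (@cvg_comp _ _ _ fst (vec V i y) _ (nbhs w)); first exact: cvg_fst.
  exact: vec_fiber_cvg.
exact: cvg_snd.
Qed.

Lemma Frep_cvg i y w t : cimg i y -> U (vec V i y w) -> 0 <= t <= T ->
  (fun p => Frep i y p.1 p.2) @
    within [set p | 0 <= p.2 <= T] (nbhs ((w, t) : 'rV[R]_k * R)) --> Frep i y w t.
Proof.
move=> iy Uw tT; have di := cimg_cdom iy.
have /subspace_continuousP /(_ (vec V i y w, t) (conj Uw tT)) cF := F_cont.
have ct := @triv_cvg _ _ _ _ V i (Tot (F (tinv V i (cinv i y) w) t)) di.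
have c1 := cvg_comp _ _ cF ct.
move=> W /c1; rewrite /within /= => W1; have := @vec_time_cvg i y w t iy _ W1.
have nU : \forall p \near ((w, t) : 'rV[R]_k * R), U (vec V i y p.1).
  have := @vec_time_cvg i y w t iy [set p | U p.1]; apply.
  have c2 : fst @ (vec V i y w, t) --> vec V i y w by exact: cvg_fst.
  by apply: (c2 U); exact: open_nbhs_nbhs.
by apply: filterS2 nU => p Up Wp pT; apply: Wp; split.
Qed.

(** Passes from the norm of [h] to the sup norm used by [picard]: coercivity of the Gram matrix
    bounds the left side, [bil_le] the right side. The absolute value of [L] is taken because [L]
    has no sign. *)
Lemma Frep_lipschitz i y w t : cimg i y -> U (vec V i y w) -> 0 <= t <= T ->
  exists L e, [/\ 0 <= L, 0 < e & forall w1 w2 r, 0 <= r <= T -> `|r - t| < e ->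
    `|w1 - w| < e -> `|w2 - w| < e ->
    `|Frep i y w1 r - Frep i y w2 r| <= L * `|w1 - w2|].
Proof.
move=> iy Uw tT; have di := cimg_cdom iy; have Gp := gram_posdef h iy.
have [N [L [nN HL]]] := F_lip Uw tT.
have nU : nbhs (vec V i y w, t) [set p | U p.1].
  have c2 : fst @ (vec V i y w, t) --> vec V i y w by exact: cvg_fst.
  by apply: (c2 U); exact: open_nbhs_nbhs.
have : nbhs ((w, t) : 'rV[R]_k * R)
    [set p | (N `&` [set q | U q.1]) (vec V i y p.1, p.2)].
  by apply: (@vec_time_cvg i y w t iy); exact: filterI.
move=> /nbhs_ballP[e /= e0 He].
have [c c0 Hc] := posdef_coercive Gp.
pose C := k%:R ^+ 2 * `|gram h i y|.
have C0 : 0 <= C by rewrite mulr_ge0.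
exists (`|L| * Num.sqrt C / Num.sqrt c), e; split=> //.
move=> w1 w2 r rT rt w1w w2w.
have inb w' : `|w' - w| < e -> (N `&` [set p | U p.1]) (vec V i y w', r).
  by move=> ww; apply: (He (w', r)); split; rewrite -ball_normE /ball_ /= distrC.
have [N1 U1] := inb w1 w1w; have [N2 U2] := inb w2 w2w.
have := HL r (cinv i y) _ _ rT U1 U2 N1 N2.
rewrite !hnormE // !linearB /= !tinvK // -/(Frep i y w1 r) -/(Frep i y w2 r).
set D := _ - _; set d := w1 - w2 => H.
have sc : 0 < Num.sqrt c by rewrite sqrtr_gt0.
rewrite mulrAC ler_pdivlMr // [leLHS]mulrC.
have -> : `|D| = Num.sqrt (`|D| ^+ 2) by rewrite sqrtr_sqr normr_id.
rewrite -sqrtrM ?(ltW c0) // (le_trans (ler_wsqrtr (Hc D))) // (le_trans H) //.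
rewrite (@le_trans _ _ (`|L| * Num.sqrt (bil (gram h i y) d d))) //.
  by rewrite ler_wpM2r ?sqrtr_ge0 // ler_norm.
rewrite -mulrA ler_wpM2l //.
have -> : `|d| = Num.sqrt (`|d| ^+ 2) by rewrite sqrtr_sqr normr_id.
rewrite -sqrtrM // ler_wsqrtr // (le_trans (ler_norm _)) //.
by rewrite (le_trans (bil_le _ _ _)) // -mulrA -expr2.
Qed.

Context (K : R -> set (total_space V)).
Context (K_sub_U : forall t, 0 <= t <= T -> K t `<=` U).
Context (ode_invariance : forall (x : M) (t0 t1 : R) (s : R -> V x),
     0 <= t0 -> t0 < t1 -> t1 <= T ->
     ode_solution U F t0 t1 s -> K t0 (Tot (s t0)) ->
     forall t, t0 <= t <= t1 -> K t (Tot (s t))).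

Definition box_proj (w0 : 'rV[R]_k) rho w : 'rV[R]_k :=
  \row_j clamp (w0 0 j - rho) (w0 0 j + rho) (w 0 j).

Lemma box_proj_dist w0 rho w1 w2 :
  `|box_proj w0 rho w1 - box_proj w0 rho w2| <= `|w1 - w2|.
Proof.
apply: mx_norm_le => // i j; rewrite !mxE (le_trans (clamp_dist _ _ _ _)) //.
by rewrite (le_trans _ (mx_norm_coord _ 0 j)) // !mxE.
Qed.

Lemma box_proj_in w0 rho w : 0 <= rho -> `|box_proj w0 rho w - w0| <= rho.
Proof.
move=> rho0; apply: mx_norm_le => // i j; rewrite ord1 !mxE ler_distl.
by apply: clamp_in; lra.
Qed.

Lemma box_proj_id w0 rho w : `|w - w0| <= rho -> box_proj w0 rho w = w.
Proof.
move=> wr; apply/rowP => j; rewrite mxE clamp_id // -ler_distl.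
by rewrite (le_trans _ wr) // (le_trans _ (mx_norm_coord _ 0 j)) // !mxE.
Qed.

(* The field is extended from a small box to the whole fiber through [box_proj],
   which is 1-Lipschitz because 'rV carries the sup norm. *)
Lemma fiber_flow i y w0 t0 e : cimg i y -> 0 <= t0 <= T -> K t0 (vec V i y w0) ->
  0 < e -> exists2 d, 0 < d & forall t t' w, 0 <= t -> t <= t' -> t' <= T ->
    `|t - t0| < d -> `|t' - t0| < d -> `|w - w0| < d -> K t (vec V i y w) ->
    exists2 w', K t' (vec V i y w') &
      `|w' - w - (t' - t) *: Frep i y w0 t0| <= e * (t' - t).
Proof.
move=> iy t0T Kw0 e0; have di := cimg_cdom iy.
have Uw0 : U (vec V i y w0) by exact: K_sub_U Kw0.
set F0 := Frep i y w0 t0.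
have [L [e1 [L0 e10 HL]]] := Frep_lipschitz iy Uw0 t0T.
have nU : \forall w \near w0, U (vec V i y w).
  exact: (@vec_fiber_cvg i y w0 iy U (open_nbhs_nbhs (conj U_open Uw0))).
have /nbhs_ballP[e2 /= e20 HU] := nU.
have /cvgrPdist_le/(_ e e0) := Frep_cvg iy Uw0 t0T.
rewrite near_withinE => /nbhs_ballP[e3 /= e30 HF].
pose rho := Num.min e1 (Num.min e2 e3) / 2.
have m0 : 0 < Num.min e1 (Num.min e2 e3) by rewrite !lt_min e10 e20.
have rho0 : 0 < rho by rewrite divr_gt0.
have rhom : rho < Num.min e1 (Num.min e2 e3) by rewrite /rho; lra.
have rho1 : rho < e1 by rewrite (lt_le_trans rhom) // ge_min lexx.
have rho2 : rho < e2 by rewrite (lt_le_trans rhom) // !ge_min lexx orbT.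
have rho3 : rho < e3 by rewrite (lt_le_trans rhom) // !ge_min lexx !orbT.
(* Times are clamped as well: [F] is controlled only for times in [[0, T]], and [t0] may be an end
   point. *)
pose a := Num.max 0 (t0 - rho); pose b := Num.min T (t0 + rho).
have ab : a <= b.
  by case/andP: t0T => t00 t0T; rewrite /a /b ge_max !le_min; apply/and3P; split; lra.
pose cl := clamp a b.
have clT t : 0 <= cl t <= T /\ `|cl t - t0| <= rho.
  have /andP[] : a <= cl t <= b by exact: clamp_in.
  move: (cl t) => r; rewrite /a /b ge_max le_min => /andP[-> tr] /andP[-> rt].
  by rewrite ler_distl tr rt.
pose pj := box_proj w0 rho.
pose f t w := Frep i y (pj w) (cl t).
pose c := `|F0| + e.
have c0 : 0 < c by rewrite ltr_wpDl.
have fF0 t w : `|f t w - F0| <= e.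
  have [clt clr] := clT t; rewrite distrC; apply: (HF (pj w, cl t)) => //.
  split; rewrite -ball_normE /ball_ /= distrC (le_lt_trans _ rho3) //.
  by apply: box_proj_in; exact: ltW.
have fc t w : `|f t w| <= c.
  rewrite -(subrK F0 (f t w)) addrC (le_trans (ler_normD _ _)) // lerD2l.
  exact: fF0.
have fL t w1 w2 : `|f t w1 - f t w2| <= L * `|w1 - w2|.
  have [clt clr] := clT t.
  rewrite (le_trans (HL _ _ _ clt _ _ _)) ?(le_lt_trans clr) //.
  - by rewrite (le_lt_trans _ rho1) // box_proj_in // ltW.
  - by rewrite (le_lt_trans _ rho1) // box_proj_in // ltW.
  - by rewrite ler_wpM2l // box_proj_dist.
have fcont w : continuous (f^~ w).
  move=> t; have [clt clr] := clT t.
  have Upw : U (vec V i y (pj w)).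
    apply: HU; rewrite -ball_normE /ball_ /= distrC (le_lt_trans _ rho2) //.
    by rewrite box_proj_in // ltW.
  have := Frep_cvg iy Upw clt.
  move=> H; apply: (@cvg_comp _ _ _ (fun t => (pj w, cl t))
    (fun p => Frep i y p.1 p.2) _ _ _ _ H).
  move=> W; rewrite /within /= => nW.
  have cc : (fun t => (pj w, cl t)) @ t --> (pj w, cl t).
    apply: (@cvg_pair_nbhs _ (nbhs t) _ _ _ (cst (pj w)) cl); first exact: cvg_cst.
    exact: clamp_continuous.
  apply: (@filterS _ (nbhs t) _ _ _ _ (cc _ nW)) => r /=; apply.
  by case: (clT r).
(* With [t' - t < 2 * d], the second entry gives the condition [L * (t' - t) <= 1/2] of [picard].
   The third bounds the displacement [2 * c * (t' - t)] by [rho / 2], and the first bounds the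
   distance of [w] from [w0] by [rho / 2]. So the solution stays in the box, where the extended
   field is the true one. *)
pose d := Num.min (rho / 2) (Num.min (4^-1 / (L + 1)) (rho / (8 * c))).
have d0 : 0 < d by rewrite !lt_min !divr_gt0 // ?ltr_wpDl // mulr_gt0.
have drho : d <= rho / 2 by rewrite ge_min lexx.
have dL : d * (L + 1) <= 4^-1.
  by rewrite -ler_pdivlMr ?ltr_wpDl // !ge_min lexx orbT.
have dc : d * (8 * c) <= rho by rewrite -ler_pdivlMr ?mulr_gt0 // !ge_min lexx !orbT.
exists d => // t t' w t_0 tt' t'T td t'd wd Kw.
have := tt'; rewrite le_eqVlt => /predU1P[<-|ltt'].
  by exists w; rewrite ?subrr ?scale0r ?subr0 ?normr0 ?mulr0.
have [ta tb] : t0 - d < t /\ t < t0 + d by move: td; rewrite ltr_distl => /andP[].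
have [t'a t'b] : t0 - d < t' /\ t' < t0 + d by move: t'd; rewrite ltr_distl => /andP[].
have tau0 : 0 <= t' - t by rewrite subr_ge0.
have [||||||X [Xt HX]] := @picard R k f L c t (t' - t) w => //.
  by have : L * (t' - t) <= L * (2 * d); [rewrite ler_wpM2l //; lra|lra].
have rJ r : t <= r <= t' -> is_derive r 1 X (f r (X r)) /\ `|X r - w0| <= rho.
  move=> /andP[tr rt']; have [|dX Xw] := HX r; first by rewrite tr addrC subrK.
  split=> //; rewrite -(subrK w (X r)) -addrA (le_trans (ler_normD _ _)) //.
  have : c * (t' - t) <= c * (2 * d) by rewrite ler_pM2l //; lra.
  by move: (ltW wd); lra.
have clr r : t <= r <= t' -> cl r = r.
  move=> /andP[tr rt']; apply: clamp_id; rewrite ge_max le_min.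
  by apply/andP; split; apply/andP; split; lra.
have fX r : t <= r <= t' -> f r (X r) = Frep i y (X r) r.
  by move=> rr; rewrite /f /pj box_proj_id ?clr //; case: (rJ r rr).
have UX r : t <= r <= t' -> U (vec V i y (X r)).
  move=> /rJ[_ Xr]; apply: HU; rewrite -ball_normE /ball_ /= distrC.
  exact: le_lt_trans rho2.
have sol : ode_solution U F t t' (fun r => tinv V i (cinv i y) (X r)).
  move=> r rr; split=> [|j jx]; first exact: UX.
  have ov : overlap i j y by [].
  apply: (@deriv_within_eq _ _ _ (fun r => X r *m ttrans V i j y)).
  - by apply: (@filterE _ (nbhs r)) => q _; rewrite ttransE.
  - by rewrite ttransE.
  apply: is_derive_deriv_within.
  rewrite -[F _ r](trivK (i := i) di) ttransE // -/(Frep i y (X r) r) -fX //.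
  have : is_derive r 1 (fun r => X r *m ttrans V i j y)
      (f r (X r) *m ttrans V i j y + X r *m 0).
    apply: (@is_derive_mulmx _ _ _ _ _ X (cst (ttrans V i j y))).
    by case: (rJ r rr).
  by rewrite mulmx0 addr0.
have KX := ode_invariance t_0 ltt' t'T sol.
exists (X t'); first by apply: KX; rewrite ?Xt // tt' lexx.
(* The derivative of [g] is the oscillation of the field around [F0], at most [e] by the choice of
   the box. *)
pose g r := X r - r *: F0.
have dg r : t <= r <= t' -> is_derive r 1 g (f r (X r) - F0).
  move=> rr; apply: is_deriveB; first by case: (rJ r rr).
  have [ds dsE] : is_diff r (fun q : R => q *: F0) (fun q : R => q *: F0).
    exact: is_diff_scalel.
  apply: DeriveDef; first exact: diff_derivable.
  by rewrite deriveE // dsE scale1r.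
have -> : X t' - w - (t' - t) *: F0 = g t' - g t.
  by rewrite /g Xt scalerBl; apply/rowP => j; rewrite !mxE; ring.
by apply: (mean_value_norm (c := e) tt' dg).
Qed.

End FiberFlow.

(** * The maximum principle *)

Lemma is_derive_direction (R : realType) (Y : normedModType R) (f : R -> Y)
    (r c : R) (df : Y) :
  is_derive r 1 f df -> is_derive r c f (c *: df).
Proof.
move=> [dvf dfE]; have df' : differentiable f r by apply/derivable1_diffP.
apply: DeriveDef; first exact: diff_derivable.
rewrite deriveE // -[c in LHS]mulr1 -[c * 1]/(c *: (1 : R)) linearZ /=.
by rewrite -deriveE // dfE.
Qed.

(** If [phi 0 > 0], or [phi 0 = 0] and [psi > 0], then [phi] is positive just to the right of 0, and
    the mean value theorem makes [f] exceed [f 0]. *)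
Lemma one_sided_max (R : realType) (f phi : R -> R) (psi : R) :
  (forall r : R, 0 <= r <= 1 -> is_derive r 1 f (phi r)) ->
  is_derive (0 : R) 1 phi psi ->
  (forall r : R, 0 <= r <= 1 -> f r <= f 0) ->
  phi 0 <= 0 /\ (phi 0 = 0 -> psi <= 0).
Proof.
move=> df [dphi dphiE] fmax.
have pos (d : R) : 0 < d -> (forall r, 0 < r -> r < d -> 0 < phi r) -> False.
  move=> d0 phi0; pose e := Num.min d 1.
  have e0 : 0 < e by rewrite lt_min d0 ltr01.
  have [e1 ed] : e <= 1 /\ e <= d by rewrite !ge_min !lexx !orbT.
  have [r||r /= re E] := @MVT R f phi 0 e e0.
  - by rewrite in_itv /= => /andP[r0 re]; apply: df; lra.
  - apply: derivable_within_continuous => r; rewrite in_itv /= => /andP[r0 re].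
    by have [] : is_derive r 1 f (phi r) by apply: df; lra.
  move: re; rewrite in_itv /= => /andP[r0 re].
  have : 0 < phi r * (e - 0).
    by rewrite mulr_gt0 ?subr0 //; apply: phi0 => //; exact: lt_le_trans ed.
  by rewrite -E subr_gt0 ltNge fmax // e1 ltW.
have cphi : {for 0, continuous phi}.
  by apply: differentiable_continuous; apply/derivable1_diffP.
split.
  rewrite leNgt; apply/negP => phi0.
  have : \forall r \near (0 : R), 0 < phi r.
    exact: (@cvgr_gt _ _ (nbhs (0 : R)) _ phi (phi 0) cphi).
  move=> /nbhs_ballP[d /= d0 Hd]; apply: (pos d d0) => r r0 rd.
  by apply: Hd; rewrite -ball_normE /ball_ /= sub0r normrN gtr0_norm.
move=> phi00; rewrite leNgt; apply/negP => psi0.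
have : (fun r : R => r^-1 *: ((phi \o shift 0) (r *: 1) - phi 0)) @ 0^' --> psi.
  by rewrite -dphiE; exact: dphi.
move=> /cvgr_gt /(_ _ psi0) [d /= d0 Hd]; apply: (pos d d0) => r r0 rd.
have := Hd r; rewrite /ball_ /= sub0r normrN gtr0_norm // rd gt_eqF //.
by move=> /(_ isT isT); rewrite phi00 subr0 addr0 [r *: 1]mulr1 pmulr_rgt0 ?invr_gt0.
Qed.

Lemma partials_is_derive_rV (R : realType) n k (f : 'rV[R]_n -> 'rV[R]_k)
    (df : 'I_n -> 'rV[R]_n -> 'rV[R]_k) (y v : 'rV[R]_n) :
  (\forall z \near y, forall a, is_derive z (delta_mx 0 a) f (df a z)) ->
  (forall a, {for y, continuous (df a)}) ->
  is_derive y v f (\sum_a v 0 a *: df a y).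
Proof.
move=> pf cf; apply/is_derive_mxP => i j; rewrite summxE.
have -> : \sum_a (v 0 a *: df a y) i j = \sum_a v 0 a * df a y i j.
  by apply: eq_bigr => a _; rewrite mxE.
apply: (@partials_is_derive _ _ (fun z => f z i j) (fun a z => df a z i j)).
  by apply: filterS pf => z pz a; have /is_derive_mxP := pz a; exact.
by move=> a; have /cvg_mxP := cf a; exact.
Qed.

(** * First and second derivative test in space *)

Section SpatialMaximum.
Context {R : realType} {n k : nat} {M : manifold R n} {V : vbundle M k}.
Context {T : R} (A : connection_family V T) (h : bundle_metric V).
Context (A_comp : metric_compatible A h).
Implicit Types (i j : cidx M) (x : M) (y v : 'rV[R]_n) (w : 'rV[R]_k) (t r : R).

Definition parallel_along t i y v (W : R -> 'rV[R]_k) :=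
  forall r, 0 <= r <= 1 ->
    is_derive r 1 W (- (W r *m conn_dir A t i (y + r *: v) v)).

(** The product rule for [h] along the segment: the term from the derivative of [W] cancels one half
    of the derivative of the Gram matrix, and the other half completes [dtau] to a covariant
    derivative. *)
Lemma bil_parallel_derive t i y v W (tau : R -> 'rV[R]_k) r dtau :
  0 <= t <= T -> 0 <= r <= 1 -> cimg i (y + r *: v) -> parallel_along t i y v W ->
  is_derive r 1 tau dtau ->
  is_derive r 1 (fun r => bil (gram h i (y + r *: v)) (tau r) (W r))
    (bil (gram h i (y + r *: v))
       (dtau + tau r *m conn_dir A t i (y + r *: v) v) (W r)).
Proof.
move=> tT r01 ir dW dt; set B := conn_dir _ _ _ _ _.
have dG : is_derive r 1 (fun r => gram h i (y + r *: v))
    (B *m gram h i (y + r *: v) + gram h i (y + r *: v) *m B^T).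
  apply: (@is_derive_line _ _ _ (gram h i)); exact: gram_derive.
have := is_derive_mulmx (is_derive_mulmx dt dG) (is_derive_trmx (dW r r01)).
move=> /is_derive_mxP /(_ 0 0) H; apply: is_derive_eq H _.
rewrite /bil -/B; congr (fun_of_matrix _ 0 0).
rewrite linearN /= trmx_mul mulmxN mulmxDr !mulmxDl !mulmxA.
by rewrite -addrA -addrA subrr addr0.
Qed.

Lemma parallel_isometry t i y v W P : 0 <= t <= T ->
  (forall r, 0 <= r <= 1 -> cimg i (y + r *: v)) ->
  parallel_along t i y v W -> parallel_along t i y v P ->
  bil (gram h i (y + v)) (P 1) (W 1) = bil (gram h i y) (P 0) (W 0).
Proof.
move=> tT seg dW dP; pose f r := bil (gram h i (y + r *: v)) (P r) (W r).
suff : f 1 = f 0 by rewrite /f scale1r scale0r addr0.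
have df r : 0 <= r <= 1 -> is_derive r 1 f 0.
  move=> r01.
  apply: is_derive_eq (bil_parallel_derive tT r01 (seg r r01) dW (dP r r01)) _.
  by rewrite addNr /bil !mul0mx mxE.
have [r||r _] := @MVT_segment R f (cst 0) 0 1 ler01.
- by rewrite in_itv /= => /andP[r0 r1]; apply: df; rewrite !ltW.
- by apply: derivable_within_continuous => r; rewrite in_itv /= => /df[].
by rewrite mul0r => /eqP; rewrite subr_eq0 => /eqP.
Qed.

(** Retraces a parallel field from [y + r *: v] back to [y], so that it can be paired with vectors
    of [K] carried back to the fiber over [y]. *)
Lemma parallel_along_rev t i y v W r : 0 <= r <= 1 -> parallel_along t i y v W ->
  parallel_along t i (y + r *: v) (- (r *: v)) (fun q => W (r + q *: - r)).
Proof.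
move=> r01 dW q q01; set p := r + q *: - r.
have p01 : 0 <= p <= 1 by rewrite /p /GRing.scale /=; nra.
have zE : y + r *: v + q *: - (r *: v) = y + p *: v.
  by apply/rowP => a; rewrite /p !mxE /GRing.scale /=; ring.
rewrite zE.
have -> : - (W p *m conn_dir A t i (y + p *: v) (- (r *: v))) =
    (- r) *: - (W p *m conn_dir A t i (y + p *: v) v).
  rewrite scaleNr scalerN opprK /conn_dir -mulmxN scalemxAr; congr (_ *m _).
  rewrite -sumrN scaler_sumr; apply: eq_bigr => a _.
  by rewrite !mxE -scaleNr opprK scalerA.
by apply: is_derive_line; apply: is_derive_direction; exact: dW.
Qed.

Context (t : R) (tT : 0 <= t <= T) (i : cidx M) (y : 'rV[R]_n) (iy : cimg i y).
Context (sig : 'rV[R]_n -> 'rV[R]_k) (d1 : 'I_n -> 'rV[R]_n -> 'rV[R]_k)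
  (d2 : 'I_n -> 'I_n -> 'rV[R]_n -> 'rV[R]_k).
Context (sig_d1 : forall z a, cimg i z -> is_derive z (delta_mx 0 a) sig (d1 a z)).
Context (d1_d2 : forall z a b, cimg i z ->
  is_derive z (delta_mx 0 b) (d1 a) (d2 a b z)).
Context (d1_cont : forall z a, cimg i z -> {for z, continuous (d1 a)}).
Context (d2_cont : forall z a b, cimg i z -> {for z, continuous (d2 a b)}).

Let cov a z := cov_deriv A t i a sig z.

Lemma sig_derive z v : cimg i z -> is_derive z v sig (\sum_a v 0 a *: d1 a z).
Proof.
move=> iz; apply: partials_is_derive_rV => [|a]; last exact: d1_cont.
by apply: filterS (near_cimg iz) => z' iz' a; exact: sig_d1.
Qed.

Lemma cov_sum z v : cimg i z ->
  \sum_a v 0 a *: cov a z = \sum_a v 0 a *: d1 a z + sig z *m conn_dir A t i z v.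
Proof.
move=> iz; rewrite /conn_dir mulmx_sumr -big_split; apply: eq_bigr => a _ /=.
rewrite -scalemxAr -scalerDr /cov /cov_deriv.
by have [_ ->] := sig_d1 a iz.
Qed.

(** Linearity in [v] is read off from an explicit formula, since [cov b] inherits only continuous
    partial derivatives from [sig]. *)
Lemma cov_derive z v b : cimg i z ->
  is_derive z v (cov b) (\sum_a v 0 a *: 'D_(delta_mx 0 a) (cov b) z).
Proof.
move=> iz.
have dA : differentiable (fun z => A t i z b) z.
  exact: (smooth_on_cylinder_differentiable (@conn_smooth _ _ _ _ _ _ A i b)).
pose X v := \sum_a v 0 a *: d2 b a z +
  ((\sum_a v 0 a *: d1 a z) *m A t i z b + sig z *m 'D_v (fun z => A t i z b) z).
have dX v' : is_derive z v' (cov b) (X v').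
  have E : \forall z' \near z, (d1 b z' + sig z' *m A t i z' b) = cov b z'.
    apply: filterS (near_cimg iz) => z' iz'; rewrite /cov /cov_deriv.
    by have [_ ->] := sig_d1 b iz'.
  apply: (near_eq_is_derive E); apply: is_deriveD.
    apply: partials_is_derive_rV => [|a]; last exact: d2_cont.
    by apply: filterS (near_cimg iz) => z' iz' a; exact: d1_d2.
  apply: is_derive_mulmx; first exact: sig_derive.
  by apply: DeriveDef => //; exact: diff_derivable.
have DE a : 'D_(delta_mx 0 a) (cov b) z = X (delta_mx 0 a) by case: (dX (delta_mx 0 a)).
apply: is_derive_eq (dX v) _.
have pick (f : 'I_n -> 'rV[R]_k) a : \sum_c (delta_mx 0 a : 'rV[R]_n) 0 c *: f c = f a.
  rewrite (bigD1 a) //= mxE !eqxx scale1r big1 ?addr0 // => c ca.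
  by rewrite mxE eqxx (negbTE ca) scale0r.
under eq_bigr do rewrite DE /X !pick !scalerDr.
rewrite !big_split /= /X mulmx_suml derive_rV // mulmx_sumr.
by congr (_ + (_ + _)); apply: eq_bigr => a _; [rewrite scalemxAl|rewrite scalemxAr].
Qed.

Lemma spatial_maximum (Kt : set (total_space V)) beta nu ks :
  parallel_invariant A t Kt -> 0 <= beta -> nu = sig y - ks ->
  bil (gram h i y) nu nu = beta ->
  (forall w, Kt (vec V i y w) -> bil (gram h i y) (w - ks) nu <= 0) ->
  (forall z, cimg i z -> exists2 w, Kt (vec V i z w) &
     bil (gram h i z) (sig z - w) (sig z - w) <= beta) ->
  (forall a, bil (gram h i y) (cov a y) nu = 0) /\
  forall v, \sum_a \sum_b v 0 a * v 0 b *
    bil (gram h i y) (cov_deriv A t i a (cov b) y) nu <= 0.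
Proof.
move=> Kinv beta0 nuE nubeta ksmin Kclose.
have [C [d [_ d0 Htr]]] := segment_transport A iy tT.
have trans0 z v : `|z - y| < d -> `|z + v - y| < d ->
    (forall r, 0 <= r <= 1 -> cimg i (z + r *: v)) /\
    forall w, exists2 W, W 0 = w & parallel_along t i z v W.
  move=> zy zvy; have [] := Htr t z v tT; rewrite ?subrr ?normr0 // => seg H.
  by split=> // w; have [W [W0 HW]] := H w; exists W => // r /HW[].
pose covv v z := \sum_a v 0 a *: cov a z.
pose cov2 v z := \sum_a \sum_b (v 0 a * v 0 b) *: cov_deriv A t i a (cov b) z.
have test v : `|v| < d ->
    bil (gram h i y) (covv v y) nu <= 0 /\
    (bil (gram h i y) (covv v y) nu = 0 -> bil (gram h i y) (cov2 v y) nu <= 0).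
  move=> vd; have [seg H] := trans0 y v ltac:(by rewrite subrr normr0)
    ltac:(by rewrite addrAC subrr add0r).
  have [N N0 dN] := H nu.
  pose f r := bil (gram h i (y + r *: v)) (sig (y + r *: v)) (N r).
  pose phi r := bil (gram h i (y + r *: v)) (covv v (y + r *: v)) (N r).
  have df r : 0 <= r <= 1 -> is_derive r 1 f (phi r).
    move=> r01; have ir := seg r r01; rewrite /phi /covv cov_sum //.
    apply: (bil_parallel_derive tT r01 ir dN).
    by apply: is_derive_line; exact: sig_derive.
  have z01 : 0 <= (0 : R) <= 1 by rewrite lexx ler01.
  have dphi : is_derive (0 : R) 1 phi (bil (gram h i (y + 0 *: v))
      (cov2 v (y + 0 *: v)) (N 0)).
    have i0 := seg 0 z01.
    have := bil_parallel_derive tT z01 i0 dN (tau := fun r => covv v (y + r *: v)).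
    have dc : is_derive (y + (0 : R) *: v) v (covv v) (\sum_b v 0 b *:
        \sum_a v 0 a *: 'D_(delta_mx 0 a) (cov b) (y + 0 *: v)).
      rewrite /covv (_ : (fun z => _) = \sum_b (fun z => v 0 b *: cov b z)).
        apply: is_derive_sum => b; apply: is_deriveZ; exact: cov_derive.
      by apply/funext => z; rewrite fct_sumE.
    move=> /(_ _ (is_derive_line dc)) H'; apply: is_derive_eq H' _.
    congr (bil _ _ _); rewrite /cov2 exchange_big /covv mulmx_suml -big_split.
    apply: eq_bigr => b _ /=; rewrite scaler_sumr -scalemxAl /conn_dir mulmx_sumr.
    rewrite scaler_sumr -big_split; apply: eq_bigr => a _ /=.
    rewrite -scalemxAr !scalerA [v 0 b * _]mulrC -scalerDr.
    by [].
  (* Write [s = (s - w) + w] at [y + r *: v], with a nearby [w] in [K]. By Cauchy-Schwarz and the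
     constant squared length [beta] of [N], the first part pairs with [N] to at most [beta]. The
     second, transported back to [y], is a point of [K] and pairs with [nu] to at most [h(ks, nu)].
     The sum is the value at [r = 0]. *)
  have [|p1 p2] := one_sided_max df dphi.
    move=> r r01; have ir := seg r r01.
    have [w Kw wb] := Kclose _ ir.
    have Gp := gram_posdef h ir.
    have yrd : `|y + r *: v - y| < d.
      rewrite addrAC subrr add0r normrZ (le_lt_trans _ vd) // ler_piMl //.
      by case/andP: r01 => r0 r1; rewrite ger0_norm.
    have [seg' H'] := trans0 (y + r *: v) (- (r *: v)) yrd
      ltac:(by rewrite addrK subrr normr0).
    have [P P0 dP] := H' w.
    have dN' := parallel_along_rev r01 dN.
    have := parallel_isometry tT seg' dN' dP.
    rewrite /= addrK scale1r subrr scale0r addr0 P0 N0 => iso.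
    have := parallel_invariant_segment tT Kinv seg' dP; rewrite P0 addrK => /(_ Kw) KP.
    have isoN := parallel_isometry tT seg' dN' dN'.
    move: isoN; rewrite /= addrK scale1r subrr scale0r addr0 N0 nubeta => isoN.
    have cs : bil (gram h i (y + r *: v)) (sig (y + r *: v) - w) (N r) <= beta.
      have := bil_cauchy_schwarz (sig (y + r *: v) - w) (N r) Gp.
      rewrite -isoN => cs; apply: le_trans (ler_norm _) _.
      rewrite -ler_sqr ?nnegrE // real_normK ?num_real //.
      by rewrite (le_trans cs) // expr2 ler_wpM2r.
    have := ksmin _ KP; rewrite !bilBl subr_le0 => mn.
    rewrite /f scale0r addr0 N0.
    have -> : sig y = nu + ks by rewrite nuE subrK.
    rewrite bilDl nubeta -[sig (y + r *: v)](subrK w) bilDl lerD //.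
    by rewrite -iso; exact: mn.
  rewrite /phi scale0r addr0 N0 in p1 p2.
  by split.
have small v : exists2 c, 0 < c & `|c *: v| < d.
  have v1 : 0 < `|v| + 1 by rewrite ltr_wpDl.
  exists (d / (`|v| + 1)); first by rewrite divr_gt0.
  rewrite normrZ gtr0_norm ?divr_gt0 // mulrAC ltr_pdivrMr // ltr_pM2l //.
  by rewrite ltrDl.
have covvZ c v : covv (c *: v) y = c *: covv v y.
  by rewrite /covv scaler_sumr; apply: eq_bigr => a _; rewrite mxE scalerA.
have cov2Z c v : cov2 (c *: v) y = c ^+ 2 *: cov2 v y.
  rewrite /cov2 scaler_sumr; apply: eq_bigr => a _.
  rewrite scaler_sumr; apply: eq_bigr => b _; rewrite !mxE scalerA.
  by congr (_ *: _); ring.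
(* The test is one-sided; the opposite vector supplies the reverse inequality after rescaling [v] to
   a short vector. *)
have covv0 v : bil (gram h i y) (covv v y) nu = 0.
  have [c c0 cd] := small v.
  have [+ _] := test _ cd; rewrite covvZ bilZl pmulr_rle0 // => le0.
  have [|+ _] := test (- (c *: v)); first by rewrite normrN.
  rewrite -scaleN1r scalerA covvZ bilZl mulN1r mulNr oppr_le0 pmulr_rge0 // => ge0.
  by apply/eqP; rewrite eq_le le0.
split=> [a|v].
  rewrite -[RHS](covv0 (delta_mx 0 a)); congr (bil _ _ _).
  rewrite /covv (bigD1 a) //= mxE !eqxx scale1r big1 ?addr0 // => c ca.
  by rewrite mxE eqxx (negbTE ca) scale0r.
have [c c0 cd] := small v.
have [_ /(_ (covv0 _))] := test _ cd.
rewrite cov2Z bilZl pmulr_rle0 ?exprn_gt0 // /cov2 bil_suml.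
by under eq_bigr do rewrite bil_suml; under eq_bigr do
  under eq_bigr do rewrite bilZl.
Qed.

End SpatialMaximum.

Lemma near_chart (R : realType) n (M : manifold R n) (Z : topologicalType)
    (P : M -> Z -> Prop) (i : cidx M) (y : 'rV[R]_n) (z : Z) : cimg i y ->
  (\forall p \near ((y, z) : 'rV[R]_n * Z), cimg i p.1 -> P (cinv i p.1) p.2) ->
  \forall p \near ((cinv i y, z) : M * Z), P p.1 p.2.
Proof.
move=> iy H; have di := cimg_cdom iy.
have cc : (fun p => (cmap i p.1, p.2)) @ ((cinv i y, z) : M * Z) --> (y, z).
  apply: cvg_pair_nbhs; last exact: cvg_snd.
  rewrite -[y in X in _ --> X](cinvK iy).
  apply: (@cvg_comp _ _ _ fst (cmap i) _ (nbhs (cinv i y))); first exact: cvg_fst.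
  exact: cmap_cvg.
have nd : \forall p \near ((cinv i y, z) : M * Z), cdom i p.1.
  have c1 : fst @ ((cinv i y, z) : M * Z) --> cinv i y by exact: cvg_fst.
  apply: (c1 (cdom i)); apply: open_nbhs_nbhs; split=> //; exact: cdom_open.
apply: filterS2 nd (cc _ H) => -[x z'] /= xi.
by rewrite cmapK // => /(_ (cimg_cmap xi)).
Qed.

(** * The distance to [K] as time varies *)

Section Estimates.
Context {R : realType} {n k : nat} {M : manifold R n} {V : vbundle M k}.
Context (h : bundle_metric V) (T : R) (U : set (total_space V)) (U_open : open U).
Context (F : forall x : M, V x -> R -> V x).
Context (F_cont : continuous_field T U F) (F_lip : lipschitz_field T U F h).
Context (K : R -> set (total_space V)).
Context (K_sub_U : forall t, 0 <= t <= T -> K t `<=` U).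
Context (K_track : closed [set p : total_space V * R | 0 <= p.2 <= T /\ K p.2 p.1]).
Context (ode_invariance : forall (x : M) (t0 t1 : R) (s : R -> V x),
     0 <= t0 -> t0 < t1 -> t1 <= T ->
     ode_solution U F t0 t1 s -> K t0 (Tot (s t0)) ->
     forall t, t0 <= t <= t1 -> K t (Tot (s t))).
Context (t0 : R) (t00 : 0 <= t0) (t0T : t0 < T) (s : R -> forall x : M, V x).
Context (s_in_U : forall t x, t0 <= t <= T -> U (Tot (s t x))).
Context (s_cont : forall i : cidx M,
  {within [set p : 'rV[R]_n * R | cimg i p.1 /\ t0 <= p.2 <= T],
    continuous (fun p => lrep i (s p.2) p.1)}).
Implicit Types (i j : cidx M) (x : M) (y : 'rV[R]_n) (w : 'rV[R]_k) (t r : R).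

Let timeT t : t0 <= t <= T -> 0 <= t <= T.
Proof. by move=> /andP[t0t ->]; rewrite (le_trans t00). Qed.

Lemma sol_cvg i y t : cimg i y -> t0 <= t <= T ->
  (fun p => lrep i (s p.2) p.1) @
    within [set p | t0 <= p.2 <= T] (nbhs ((y, t) : 'rV[R]_n * R)) -->
  lrep i (s t) y.
Proof.
move=> iy tT; have /subspace_continuousP /(_ (y, t) (conj iy tT)) cs := @s_cont i.
move=> W /cs; rewrite /within /= => nW.
have c1 : fst @ ((y, t) : 'rV[R]_n * R) --> y by exact: cvg_fst.
have n1 : \forall p \near ((y, t) : 'rV[R]_n * R), cimg i p.1.
  exact: (c1 _ (near_cimg iy)).
by apply: filterS2 n1 nW => p ip Wp pT; apply: Wp.
Qed.

Lemma sol_time_cvg i y t : cimg i y -> t0 <= t <= T ->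
  (fun r => lrep i (s r) y) @ within [set r | t0 <= r <= T] (nbhs t) --> lrep i (s t) y.
Proof.
move=> iy tT W /(sol_cvg iy tT); rewrite /within /= => nW.
have cc : (fun r => (y, r)) @ t --> (y, t).
  apply: (@cvg_pair_nbhs _ (nbhs t) _ _ _ (cst y) id); last exact: cvg_id.
  exact: cvg_cst.
exact: (cc _ nW).
Qed.

(** Continuity of the Gram matrix costs half of the coercivity constant at [y0]. *)
Lemma coercive_near i y0 : cimg i y0 -> exists2 c, 0 < c &
  \forall y \near y0, forall w, c * `|w| ^+ 2 <= bil (gram h i y) w w.
Proof.
move=> iy; have [c c0 Hc] := posdef_coercive (gram_posdef h iy).
exists (c / 2); first by rewrite divr_gt0.
pose e := c / 2 / (k%:R ^+ 2 + 1).
have k0 : 0 < (k%:R ^+ 2 + 1 : R) by rewrite ltr_wpDl // sqr_ge0.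
have e0 : 0 < e by rewrite !divr_gt0.
have cG := differentiable_continuous (gram_differentiable h iy).
have /cvgrPdist_le/(_ e e0) := cG; apply: filterS => y Gy w.
have -> : bil (gram h i y) w w =
    bil (gram h i y0) w w - bil (gram h i y0 - gram h i y) w w.
  by rewrite /bil !mulmxBr !mulmxBl !mxE; ring.
have : `|bil (gram h i y0 - gram h i y) w w| <= c / 2 * `|w| ^+ 2.
  rewrite (le_trans (bil_le _ _ _)) // -mulrA -expr2 ler_wpM2r ?sqr_ge0 //.
  rewrite (@le_trans _ _ (k%:R ^+ 2 * e)) // ?ler_wpM2l ?sqr_ge0 //.
  by rewrite /e mulrCA ler_piMr ?divr_ge0 ?(ltW c0) // ler_pdivrMr // mul1r lerDl.
by rewrite ler_norml => /andP[_]; have := Hc w; lra.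
Qed.

(* [b] bounds the square of the distance. *)
Definition close t b x :=
  exists2 v : V x, K t (Tot v) & h x (s t x - v) (s t x - v) <= b.

Lemma closeP t b i y : cimg i y -> close t b (cinv i y) <->
  exists2 w, K t (vec V i y w) &
    bil (gram h i y) (lrep i (s t) y - w) (lrep i (s t) y - w) <= b.
Proof.
move=> iy; have di := cimg_cdom iy; split=> [[v Kv vb]|[w Kw wb]].
  exists (triv V i (cinv i y) v); first by rewrite /vec trivK.
  by move: vb; rewrite hmetE // !linearB.
by exists (tinv V i (cinv i y) w) => //; rewrite hmetE // !linearB /= tinvK.
Qed.

Let closed_fiber_near i y t w : cimg i y -> 0 <= t <= T -> ~ K t (vec V i y w) ->
  \forall p \near ((w, t) : 'rV[R]_k * R), 0 <= p.2 <= T -> ~ K p.2 (vec V i y p.1).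
Proof.
move=> iy tT nK.
have no : nbhs (vec V i y w, t)
    (~` [set p : total_space V * R | 0 <= p.2 <= T /\ K p.2 p.1]).
  by apply: open_nbhs_nbhs; split; [exact: closed_openC|move=> [_ /nK]].
have H := @vec_time_cvg _ _ _ _ V i y w t iy _ no.
by apply: (@filterS _ (nbhs ((w, t) : 'rV[R]_k * R)) _ _ _ _ H) => p /= nKp pT Kp;
  apply: nKp.
Qed.

(* For [W = set0] this gives the closedness of [close] under limits in time, for
   [W] a ball around the nearest point the convergence of almost nearest points. *)
Lemma far_stable i y t1 (beta : R -> R) (W : set 'rV[R]_k) :
  cimg i y -> t0 <= t1 <= T -> continuous beta -> open W ->
  (forall w, ~ W w -> K t1 (vec V i y w) ->
    beta t1 < bil (gram h i y) (lrep i (s t1) y - w) (lrep i (s t1) y - w)) ->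
  \forall t \near t1, t0 <= t <= T -> forall w, ~ W w -> K t (vec V i y w) ->
    beta t < bil (gram h i y) (lrep i (s t) y - w) (lrep i (s t) y - w).
Proof.
move=> iy t1T cb oW far; have Gp := gram_posdef h iy.
set G := gram h i y; pose sg t := lrep i (s t) y.
have [c c0 Hc] := posdef_coercive Gp.
pose m := `|beta t1| + 1.
have m0 : 0 < m by rewrite ltr_wpDl.
(* By coercivity, vectors of norm above [rho] have squared distance above [m] from [sg t] for [t]
   near [t1], while [beta t <= m] there. Only the compact set [B] remains. *)
pose rho := `|sg t1| + 1 + Num.sqrt (m / c) + 1.
pose B := [set w : 'rV[R]_k | `|w| <= rho] `\` W.
have cB : compact B.
  apply: bounded_closed_compact.
    exists rho; split=> [|r rr w [/= wr _] /=]; first exact: num_real.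
    by rewrite (le_trans wr) // ltW.
  apply: closedI; last exact: open_closedC.
  rewrite (_ : mkset _ = closed_ball_ (fun v : 'rV[R]_k => `|v|) 0 rho).
    exact: closed_closed_ball_.
  by apply/seteqP; split=> w; rewrite /closed_ball_ /= sub0r normrN.
have nS : \forall t \near t1, t0 <= t <= T -> `|sg t| <= `|sg t1| + 1 /\ beta t <= m.
  have := sol_time_cvg iy t1T => /cvgrPdist_le/(_ 1 ltr01).
  rewrite near_withinE => n1.
  have /cvgrPdist_le/(_ 1 ltr01) n2 := cb t1.
  apply: filterS2 n1 n2 => t Ht Hb tT; split.
    rewrite -(subrK (sg t1) (sg t)) addrC (le_trans (ler_normD _ _)) // lerD2l.
    by rewrite distrC; exact: Ht.
  move: Hb; rewrite distrC ler_norml /m => /andP[_ +].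
  by have := ler_norm (beta t1); lra.
(* Around a point of [K t1] the strict inequality persists by continuity; around any other point the
   closed track leaves no points of [K t]. Compactness makes the time neighbourhood uniform. *)
have nB : \forall t \near t1, B `<=` [set w | t0 <= t <= T -> K t (vec V i y w) ->
    beta t < bil G (sg t - w) (sg t - w)].
  apply: ((proj1 (compact_near_coveringP B) cB) R (nbhs t1)
    (fun t w => t0 <= t <= T -> K t (vec V i y w) ->
    beta t < bil G (sg t - w) (sg t - w)) (nbhs_filter t1)) => w [_ nW].
  have [Kw|nKw] := pselect (K t1 (vec V i y w)); last first.
    have := closed_fiber_near iy (timeT t1T) nKw.
    by apply: filterS => -[w' t] /= H tT Kt; case: (H (timeT tT) Kt).
  have lt1 := far w nW Kw.
  have n1 : (fun p => bil G (sg p.2 - p.1) (sg p.2 - p.1) - beta p.2) @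
      within [set p | t0 <= p.2 <= T] (nbhs ((w, t1) : 'rV[R]_k * R)) -->
      bil G (sg t1 - w) (sg t1 - w) - beta t1.
    have c2 : snd @ within [set p | t0 <= p.2 <= T] (nbhs ((w, t1) : 'rV[R]_k * R)) -->
        within [set r | t0 <= r <= T] (nbhs t1).
      move=> Z; rewrite /within /= => nZ.
      have c3 : snd @ ((w, t1) : 'rV[R]_k * R) --> t1 by exact: cvg_snd.
      exact: (c3 _ nZ).
    have cs := cvg_comp _ _ c2 (sol_time_cvg iy t1T).
    have cw : fst @ within [set p | t0 <= p.2 <= T] (nbhs ((w, t1) : 'rV[R]_k * R)) --> w.
      by apply: cvg_within_filter; exact: cvg_fst.
    have cbt : (fun p => beta p.2) @ within [set p | t0 <= p.2 <= T]
        (nbhs ((w, t1) : 'rV[R]_k * R)) --> beta t1.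
      apply: cvg_within_filter; apply: (@cvg_comp _ _ _ snd beta); last exact: cb.
      exact: cvg_snd.
    apply: cvgB => //; apply: cvg_bil; [exact: cvg_cst|exact: cvgB|exact: cvgB].
  have lt2 : 0 < bil G (sg t1 - w) (sg t1 - w) - beta t1 by rewrite subr_gt0.
  have n2 : \forall p \near ((w, t1) : 'rV[R]_k * R), t0 <= p.2 <= T ->
      0 < bil G (sg p.2 - p.1) (sg p.2 - p.1) - beta p.2.
    by have H := cvgr_gt _ n1 _ lt2; rewrite near_withinE in H; exact: H.
  by apply: filterS n2 => -[w' t] /= H tT _; rewrite -subr_gt0; exact: H.
apply: filterS2 nS nB => t Ht HB tT w nW Kw.
have [wr|wr] := leP `|w| rho; first by apply: HB.
have [st bt] := Ht tT.
rewrite (le_lt_trans bt) // (lt_le_trans _ (Hc _)) // mulrC -ltr_pdivrMr //.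
have mc0 : 0 <= m / c by rewrite divr_ge0 // ltW.
rewrite -(sqr_sqrtr mc0) ltr_sqr ?nnegrE ?sqrtr_ge0 //.
have : `|w| <= `|sg t| + `|sg t - w|.
  by rewrite -{1}(subKr (sg t) w) (le_trans (ler_normB _ _)).
by rewrite /rho in wr; lra.
Qed.

Lemma close_left_closed i y t1 (beta : R -> R) : cimg i y -> t0 < t1 -> t1 <= T ->
  continuous beta -> (forall t, t0 <= t < t1 -> close t (beta t) (cinv i y)) ->
  close t1 (beta t1) (cinv i y).
Proof.
move=> iy t01 t1T cb cl; apply/closeP => //; apply: contrapT => nex.
have t1J : t0 <= t1 <= T by rewrite (ltW t01).
have := @far_stable i y t1 beta set0 iy t1J cb open0.
case=> [w _ Kw|d /= d0 Hd].
  by rewrite ltNge; apply/negP => wb; apply: nex; exists w.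
pose t := Num.max t0 (t1 - d / 2).
have tt1 : t < t1 by rewrite gt_max t01 /=; lra.
have t0t : t0 <= t by rewrite le_max lexx.
have td : t1 - d / 2 <= t by rewrite le_max lexx orbT.
have /(closeP _ _ iy) [w Kw wb] := cl t ltac:(by rewrite t0t).
have := Hd t; rewrite /ball_ /= gtr0_norm ?subr_gt0 //.
move=> /(_ ltac:(lra) ltac:(by rewrite t0t (ltW (lt_le_trans tt1 t1T))) w (fun f => f) Kw).
by rewrite ltNge wb.
Qed.

(** One number [eta] serves as squared radius of the tube and as inverse Lipschitz constant. Every
    sufficiently small [eta] then works locally, so compactness of [M] times [[t0, T]] can be used
    along [eta] tending to 0 from the right. *)
Lemma uniform_lipschitz : compact [set: M] -> exists2 eta, 0 < eta &
  forall i y t w, cimg i y -> t0 <= t <= T -> K t (vec V i y w) ->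
    let sg := lrep i (s t) y in
    bil (gram h i y) (sg - w) (sg - w) <= eta ->
    bil (gram h i y) (sg - w) (Frep F i y sg t - Frep F i y w t) <=
      eta^-1 * bil (gram h i y) (sg - w) (sg - w).
Proof.
move=> Mc.
pose P eta (p : M * R) := t0 <= p.2 <= T -> forall v : V p.1, K p.2 (Tot v) ->
  h p.1 (s p.2 p.1 - v) (s p.2 p.1 - v) <= eta ->
  h p.1 (s p.2 p.1 - v) (F (s p.2 p.1) p.2 - F v p.2) <=
    eta^-1 * h p.1 (s p.2 p.1 - v) (s p.2 p.1 - v).
have cMT : compact ([set: M] `*` `[t0, T]).
  by apply: compact_setX => //; exact: segment_compact.
have local x t1 : t0 <= t1 <= T -> exists2 e, 0 < e &
    \forall p \near ((x, t1) : M * R), forall eta, 0 < eta -> eta < e -> P eta p.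
  move=> t1T; have [i [y0 [iy0 ->]]] := chart_ex x.
  have di := cimg_cdom iy0.
  pose w0 := lrep i (s t1) y0.
  have vw0 : vec V i y0 w0 = Tot (s t1 (cinv i y0)) by rewrite /vec /w0 /lrep trivK.
  have Uw0 : U (vec V i y0 w0) by rewrite vw0; exact: s_in_U.
  have [N [L [nN HL]]] := F_lip Uw0 (timeT t1T).
  have nU : nbhs (vec V i y0 w0, t1) [set p | U p.1].
    have c2 : fst @ (vec V i y0 w0, t1) --> vec V i y0 w0 by exact: cvg_fst.
    by apply: (c2 U); exact: open_nbhs_nbhs.
  have cv : (fun p => (vec V i p.1.1 p.1.2, p.2)) @
      ((y0, w0, t1) : 'rV[R]_n * 'rV[R]_k * R) --> (vec V i y0 w0, t1).
    apply: cvg_pair_nbhs; last exact: cvg_snd.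
    apply: (@cvg_comp _ _ _ fst (fun p => vec V i p.1 p.2) _
      (nbhs ((y0, w0) : 'rV[R]_n * 'rV[R]_k))); first exact: cvg_fst.
    exact: vec_cvg.
  have : nbhs ((y0, w0, t1) : 'rV[R]_n * 'rV[R]_k * R)
      [set p | (N `&` [set q | U q.1]) (vec V i p.1.1 p.1.2, p.2)].
    exact: (cv _ (filterI nN nU)).
  move=> /nbhs_ballP[e /= e0 He].
  have [c c0 Hc] := coercive_near iy0.
  (* The first entry turns the bound on the squared distance into sup norm distance below [e / 2];
     the second makes [L] at most [eta^-1]. *)
  pose e1 := Num.min (c * (e / 2) ^+ 2) (`|L| + 1)^-1.
  have L1 : 0 < `|L| + 1 by rewrite ltr_wpDl.
  exists e1; first by rewrite lt_min invr_gt0 L1 mulr_gt0 ?exprn_gt0 ?divr_gt0.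
  apply: (@near_chart _ _ _ _
    (fun x t => forall eta, 0 < eta -> eta < e1 -> P eta (x, t)) i y0 t1 iy0).
  have e20 : 0 < e / 2 by rewrite divr_gt0.
  have n1 : \forall p \near ((y0, t1) : 'rV[R]_n * R), t0 <= p.2 <= T ->
      `|lrep i (s p.2) p.1 - w0| < e / 2.
    have H := @sol_cvg i y0 t1 iy0 t1T.
    have /cvgrPdist_lt/(_ _ e20) := H; rewrite near_withinE.
    by apply: filterS => p Hp /Hp; rewrite distrC.
  have n2 : \forall p \near ((y0, t1) : 'rV[R]_n * R),
      (forall w, c * `|w| ^+ 2 <= bil (gram h i p.1) w w).
    have c1 : fst @ ((y0, t1) : 'rV[R]_n * R) --> y0 by exact: cvg_fst.
    exact: (c1 _ Hc).
  have n3 : \forall p \near ((y0, t1) : 'rV[R]_n * R), ball (y0, t1) e p.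
    exact: nbhsx_ballx.
  apply: filterS3 n1 n2 n3 => -[y t] /= n1' n2' [/= yb tb] iy eta eta0 etae.
  rewrite /P /= => tT v Kv vb.
  have di' := cimg_cdom iy.
  pose w := triv V i (cinv i y) v; pose sg := lrep i (s t) y.
  have vw : vec V i y w = Tot v by rewrite /vec trivK.
  have vs : vec V i y sg = Tot (s t (cinv i y)) by rewrite /vec /sg /lrep trivK.
  have Gp := gram_posdef h iy.
  have hE : h (cinv i y) (s t (cinv i y) - v) (s t (cinv i y) - v) =
      bil (gram h i y) (sg - w) (sg - w) by rewrite hmetE // !linearB.
  have sgw0 : `|sg - w0| < e / 2 by exact: n1'.
  have sw : `|sg - w| < e / 2.
    rewrite -ltr_sqr ?nnegrE ?(ltW e20) // -(ltr_pM2l c0).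
    rewrite (le_lt_trans (n2' _)) // -hE (le_lt_trans vb) //.
    by rewrite (lt_le_trans etae) // ge_min lexx.
  have inb w' : `|w' - w0| < e -> (N `&` [set q | U q.1]) (vec V i y w', t).
    move=> ww; apply: (He (y, w', t)); split=> //; split=> //.
    by rewrite -ball_normE /ball_ /= distrC.
  have [N1 U1] := inb sg ltac:(lra).
  have [|N2 U2] := inb w.
    rewrite (_ : w - w0 = (sg - w0) - (sg - w)); last first.
      by rewrite opprB [RHS]addrC addrA subrK.
    by rewrite (le_lt_trans (ler_normB _ _)) // (splitr e) ltrD.
  rewrite vs in N1 U1; rewrite vw in N2 U2.
  have := HL t (cinv i y) _ _ (timeT tT) U1 U2 N1 N2.
  rewrite /hnorm; set D := F _ t - F _ t; set d := s t (cinv i y) - v => HD.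
  have dd0 : 0 <= h (cinv i y) d d by rewrite hE; exact: posdef_ge0.
  have DD0 : 0 <= h (cinv i y) D D by rewrite hmetE //; exact: posdef_ge0.
  have cs : h (cinv i y) d D <= Num.sqrt (h (cinv i y) d d) * Num.sqrt (h (cinv i y) D D).
    rewrite -sqrtrM // (le_trans (ler_norm _)) // -sqrtr_sqr ler_wsqrtr //.
    by rewrite !hmetE //; exact: bil_cauchy_schwarz.
  rewrite (le_trans cs) // (le_trans (ler_wpM2l _ HD)) ?sqrtr_ge0 //.
  rewrite mulrCA -expr2 sqr_sqrtr // ler_wpM2r //.
  rewrite (le_trans (ler_norm L)) // (@le_trans _ _ (`|L| + 1)) ?lerDl //.
  rewrite -[leLHS]invrK lef_pV2 ?posrE ?invr_gt0 //.
  by rewrite ltW // (lt_le_trans etae) // ge_min lexx orbT.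
have nP : \forall eta \near (0 : R)^'+, ([set: M] `*` `[t0, T]) `<=` P eta.
  apply: ((proj1 (compact_near_coveringP _) cMT) R ((0 : R)^'+) P) => -[x t1] [_ /=].
  rewrite in_itv /= => t1T; have [e e0 He] := local x t1 t1T.
  have n2 : \forall eta \near (0 : R)^'+, 0 < eta < e.
    by near=> eta; apply/andP; split; near: eta; [exact: nbhs_right_gt|exact: nbhs_right_lt].
  exists ([set p | forall eta, 0 < eta -> eta < e -> P eta p], [set eta | 0 < eta < e]).
    by split.
  by move=> [p eta] [/= Hp /andP[eta0 etae]]; exact: Hp.
have [eta [eta0 Heta]] : exists eta : R, 0 < eta /\ ([set: M] `*` `[t0, T]) `<=` P eta.
  have n2 : \forall eta \near (0 : R)^'+, 0 < eta by exact: nbhs_right_gt.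
  by have [eta []] := filter_ex (filterI n2 nP); exists eta.
exists eta => // i y t w iy tT Kw /= wb.
have di := cimg_cdom iy.
have := Heta (cinv i y, t); rewrite /P /= in_itv /= => /(_ (conj I tT) tT _ Kw).
by rewrite !hmetE // !linearB /= !tinvK // /Frep /lrep trivK //; apply.
Unshelve. all: by end_near. Qed.

(** The witness [w0] is moved by the ODE in its own fiber up to time [t], then by parallel transport
    at time [t] to the fiber over [z]. Strictness absorbs both displacements, and the neighbourhood
    is joint in space and time, as the covering of [M] needs. *)
Lemma close_right_open (A : connection_family V T) i y t1 (beta : R -> R) w0 :
  (forall t, 0 <= t <= T -> parallel_invariant A t (K t)) -> continuous beta ->
  cimg i y -> t0 <= t1 <= T -> K t1 (vec V i y w0) ->
  bil (gram h i y) (lrep i (s t1) y - w0) (lrep i (s t1) y - w0) < beta t1 ->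
  \forall p \near ((cinv i y, t1) : M * R), t1 <= p.2 <= T -> close p.2 (beta p.2) p.1.
Proof.
move=> Kpar cb iy t1T Kw0 lt0.
have t1T' := timeT t1T.
have [d1 d10 Hflow] :=
  fiber_flow U_open F_cont F_lip K_sub_U ode_invariance iy t1T' Kw0 ltr01.
have [C [d2 [C0 d20 Htr]]] := segment_transport A iy t1T'.
pose Phi (q : 'rV[R]_n * R * 'rV[R]_k) :=
  bil (gram h i q.1.1) (lrep i (s q.1.2) q.1.1 - q.2) (lrep i (s q.1.2) q.1.1 - q.2)
  - beta q.1.2.
have nPhi : \forall q \near ((y, t1, w0) : 'rV[R]_n * R * 'rV[R]_k),
    t0 <= q.1.2 <= T -> Phi q < 0.
  pose FF := within [set q : 'rV[R]_n * R * 'rV[R]_k | t0 <= q.1.2 <= T]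
    (nbhs ((y, t1, w0) : 'rV[R]_n * R * 'rV[R]_k)).
  have c1 : fst @ ((y, t1, w0) : 'rV[R]_n * R * 'rV[R]_k) --> (y, t1) by exact: cvg_fst.
  have c2 : snd @ FF --> w0 by apply: cvg_within_filter; exact: cvg_snd.
  have c3 : (fun q => q.1.1) @ FF --> y.
    apply: cvg_within_filter; apply: (@cvg_comp _ _ _ fst fst _ _ _ c1).
    exact: cvg_fst.
  have c4 : (fun q => q.1.2) @ FF --> t1.
    apply: cvg_within_filter; apply: (@cvg_comp _ _ _ fst snd _ _ _ c1).
    exact: cvg_snd.
  have c5 : (fun q => lrep i (s q.1.2) q.1.1) @ FF --> lrep i (s t1) y.
    move=> W /(sol_cvg iy t1T); rewrite /within /= => nW; exact: (c1 _ nW).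
  have c6 : (fun q => gram h i q.1.1) @ FF --> gram h i y.
    have cG := differentiable_continuous (gram_differentiable h iy).
    exact: (cvg_comp _ _ c3 cG).
  have c7 : (fun q => beta q.1.2) @ FF --> beta t1.
    exact: (cvg_comp _ _ c4 (cb t1)).
  have c8 : Phi @ FF --> (bil (gram h i y) (lrep i (s t1) y - w0) (lrep i (s t1) y - w0)
      - beta t1).
    by apply: cvgB => //; apply: cvg_bil => //; apply: cvgB.
  have lt1 : bil (gram h i y) (lrep i (s t1) y - w0) (lrep i (s t1) y - w0) - beta t1 < 0.
    by rewrite subr_lt0.
  have H := cvgr_lt _ c8 _ lt1; rewrite near_withinE in H; exact: H.
have /nbhs_ballP[e /= e0 He] := nPhi.
apply: (@near_chart _ _ _ _ (fun x t => t1 <= t <= T -> close t (beta t) x) i y t1 iy).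
pose c1 := `|Frep F i y w0 t1| + 1.
have c10 : 0 < c1 by rewrite ltr_wpDl.
pose c2 := C * (`|w0| + 1).
have c20 : 0 <= c2 by rewrite mulr_ge0 // addr_ge0.
(* The flow displaces [w0] by at most [e' * c1], the transport by at most [c2] times the distance of
   [z] from [y]; each is kept within [e / 2]. The entry [c1^-1] ensures that [kap] has norm at most
   that of [w0] plus 1, which [c2] presupposes. *)
pose e' := Num.min (Num.min d1 d2)
  (Num.min (e / 2 / (c2 + 1)) (Num.min e (Num.min (e / 2 / c1) c1^-1))).
have e'0 : 0 < e'.
  by rewrite !lt_min d10 d20 e0 invr_gt0 c10 !divr_gt0 // ltr_wpDl.
have e'd1 : e' <= d1 by rewrite !ge_min lexx.
have e'd2 : e' <= d2 by rewrite !ge_min lexx !orbT.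
have e'e : e' <= e by rewrite !ge_min lexx !orbT.
have e'c2 : e' * (c2 + 1) <= e / 2.
  by rewrite -ler_pdivlMr ?ltr_wpDl // !ge_min lexx !orbT.
have e'c1 : e' * c1 <= e / 2 by rewrite -ler_pdivlMr // !ge_min lexx !orbT.
have e'c1' : e' * c1 <= 1 by rewrite -ler_pdivlMr // mul1r !ge_min lexx !orbT.
have n3 : \forall p \near ((y, t1) : 'rV[R]_n * R), ball (y, t1) e' p.
  exact: nbhsx_ballx.
apply: filterS n3 => -[z t] [/= zb tb] iz tt.
move: zb tb; rewrite -!ball_normE /ball_ /= => zb tb.
have /andP[t1t tT] := tt.
have tT0 : t0 <= t <= T by case/andP: t1T => t01 _; rewrite tT (le_trans t01).
have [||||kap Kkap kapb] := Hflow t1 t w0 _ t1t tT _ _ _ Kw0; rewrite ?subrr ?normr0 //.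
- by case/andP: t1T'.
- by rewrite distrC (lt_le_trans tb).
have kw : `|kap - w0| <= e' * c1.
  rewrite -(subrK ((t - t1) *: Frep F i y w0 t1) (kap - w0)) (le_trans (ler_normD _ _)) //.
  rewrite (le_trans (lerD kapb (lexx _))) // normrZ mul1r ger0_norm ?subr_ge0 //.
  rewrite -[X in X + _]mulr1 -mulrDr [1 + _]addrC ler_wpM2r ?(ltW c10) //.
  move: tb; rewrite distrC ger0_norm ?subr_ge0 //. exact: ltW.
have [|||seg Htr'] := Htr t y (z - y) (timeT tT0); rewrite ?subrr ?normr0 //.
- by rewrite distrC (lt_le_trans tb).
- by rewrite addrAC subrr add0r distrC (lt_le_trans zb).
have [W [W0 HW]] := Htr' kap.
have KW : K t (vec V i z (W 1)).
  have := @parallel_invariant_segment _ _ _ _ _ _ A t i y (z - y) W (K t) (timeT tT0)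
    (Kpar t (timeT tT0)) seg (fun r r01 => proj1 (HW r r01)).
  by rewrite W0 [y + _]addrC subrK; apply.
have [_ Wb] := HW 1 ltac:(by rewrite ler01 lexx).
have kapn : `|kap| <= `|w0| + 1.
  by rewrite -(subrK w0 kap) addrC (le_trans (ler_normD _ _)) // lerD2l (le_trans kw).
have Ww0 : `|W 1 - w0| < e.
  have -> : W 1 - w0 = (W 1 - kap) + (kap - w0) by rewrite addrA subrK.
  rewrite (le_lt_trans (ler_normD _ _)) // (splitr e) ltr_leD //; last exact: le_trans e'c1.
  rewrite (le_lt_trans Wb) // (lt_le_trans _ e'c2) //.
  rewrite (@le_lt_trans _ _ (c2 * `|z - y|)) //.
    by rewrite /c2 [leLHS]mulrAC ler_wpM2r // ler_wpM2l.
  rewrite (@le_lt_trans _ _ ((c2 + 1) * `|z - y|)) ?ler_wpM2r ?lerDl //.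
  by rewrite mulrC ltr_pM2r ?ltr_wpDl // distrC.
apply/closeP => //; exists (W 1) => //.
rewrite -subr_le0 ltW //.
apply: (He (z, t, W 1)) => //; split; last by rewrite -ball_normE /ball_ /= distrC.
by split; rewrite -ball_normE /ball_ /= (lt_le_trans _ e'e).
Qed.

(** For [t = t1 - del] a point [w] of [K t] within [beta t] flows to [kap] in [K t1], and no point
    of [K t1] is closer than [beta t1]. Expanding the square of [sg t1 - kap] around [sg t - w]
    bounds the difference quotient of [beta] by [Psi], whose limit is [2 h(nu, Y)]. Thus the
    distance itself is never differentiated. *)
Lemma time_maximum i y t1 (beta : R -> R) dbeta X ks :
  cimg i y -> t0 < t1 -> t1 <= T -> continuous beta -> is_derive t1 1 beta dbeta ->
  (forall t, t0 <= t < t1 -> close t (beta t) (cinv i y)) ->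
  deriv_within `[t0, T] (fun r => lrep i (s r) y) t1 X ->
  K t1 (vec V i y ks) ->
  let nu := lrep i (s t1) y - ks in
  bil (gram h i y) nu nu = beta t1 ->
  (forall w, w != ks -> K t1 (vec V i y w) ->
    beta t1 < bil (gram h i y) (lrep i (s t1) y - w) (lrep i (s t1) y - w)) ->
  dbeta <= 2 * bil (gram h i y) nu (X - Frep F i y ks t1).
Proof.
move=> iy t01 t1T cb db cl dX Kks nu nub ksuniq.
set G := gram h i y; set Y := X - _; pose sg t := lrep i (s t) y.
have t1J : t0 <= t1 <= T by rewrite ltW.
have Gp := gram_posdef h iy.
rewrite leNgt; apply/negP => lt.
pose m := (dbeta + 2 * bil G nu Y) / 2.
have [m1 m2] : 2 * bil G nu Y < m /\ m < dbeta by rewrite /m; split; lra.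
pose Psi (q : 'rV[R]_k * 'rV[R]_k * R) := 2 * bil G q.1.1 q.1.2 + q.2 * bil G q.1.2 q.1.2.
have nPsi : \forall q \near ((nu, Y, 0) : 'rV[R]_k * 'rV[R]_k * R), Psi q < m.
  pose FF := nbhs ((nu, Y, 0) : 'rV[R]_k * 'rV[R]_k * R).
  have c1 : fst @ FF --> (nu, Y) by exact: cvg_fst.
  have c2 : snd @ FF --> (0 : R) by exact: cvg_snd.
  have c3 : (fun q => q.1.1) @ FF --> nu.
    by apply: (@cvg_comp _ _ _ fst fst _ _ _ c1); exact: cvg_fst.
  have c4 : (fun q => q.1.2) @ FF --> Y.
    by apply: (@cvg_comp _ _ _ fst snd _ _ _ c1); exact: cvg_snd.
  have c5 : Psi @ FF --> (2 * bil G nu Y + 0 * bil G Y Y).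
    apply: cvgD; first by apply: cvgM; [exact: cvg_cst|apply: cvg_bil => //; exact: cvg_cst].
    by apply: cvgM => //; apply: cvg_bil => //; exact: cvg_cst.
  by apply: (cvgr_lt _ c5); rewrite mul0r addr0.
have /nbhs_ballP[e /= e0 He] := nPsi.
pose e1 := e / 4.
have e10 : 0 < e1 by rewrite divr_gt0.
have [d1 d10 Hflow] :=
  fiber_flow U_open F_cont F_lip K_sub_U ode_invariance iy (timeT t1J) Kks e10.
pose e2 := Num.min d1 e1.
have e20 : 0 < e2 by rewrite lt_min d10.
(* Uniqueness of the nearest point at [t1] confines the witnesses at nearby times to a small ball
   around [ks], where the flow estimate at [ks] is valid. *)
have nfar : \forall t \near t1, t0 <= t <= T -> forall w, ~ ball ks e2 w ->
    K t (vec V i y w) -> beta t < bil G (sg t - w) (sg t - w).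
  apply: far_stable => //; first exact: ball_open.
  move=> w nb Kw; apply: ksuniq => //; apply: contra_notN nb => /eqP ->.
  exact: ballxx.
have nsg : \forall t \near t1, t0 <= t <= T -> `|sg t1 - sg t| <= e1.
  by have /cvgrPdist_le/(_ _ e10) := sol_time_cvg iy t1J; rewrite near_withinE.
have nX : \forall t \near t1, t != t1 -> t0 <= t <= T ->
    `|X - (t - t1)^-1 *: (sg t - sg t1)| <= e1.
  by have /cvgrPdist_le/(_ _ e10) := dX; rewrite near_withinE /dnbhs near_withinE;
    apply: filterS => t H /H; rewrite /= in_itv.
have nbeta : \forall t \near t1, t != t1 -> m < (t - t1)^-1 *: (beta t - beta t1).
  have := is_derive_deriv_within setT db.
  by rewrite /deriv_within => /cvgr_gt /(_ _ m2); rewrite near_withinE /dnbhs near_withinE;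
    apply: filterS => t H /H; apply.
have [rho [rho0 Hfar Hsg HX Hbeta]] : exists rho, [/\ 0 < rho,
    forall t, `|t1 - t| < rho -> t0 <= t <= T -> forall w, ~ ball ks e2 w ->
      K t (vec V i y w) -> beta t < bil G (sg t - w) (sg t - w),
    forall t, `|t1 - t| < rho -> t0 <= t <= T -> `|sg t1 - sg t| <= e1,
    forall t, `|t1 - t| < rho -> t != t1 -> t0 <= t <= T ->
      `|X - (t - t1)^-1 *: (sg t - sg t1)| <= e1 &
    forall t, `|t1 - t| < rho -> t != t1 -> m < (t - t1)^-1 *: (beta t - beta t1)].
  have /nbhs_ballP[r1 /= r10 H1] := nfar; have /nbhs_ballP[r2 /= r20 H2] := nsg.
  have /nbhs_ballP[r3 /= r30 H3] := nX; have /nbhs_ballP[r4 /= r40 H4] := nbeta.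
  exists (Num.min (Num.min r1 r2) (Num.min r3 r4)); rewrite !lt_min r10 r20 r30 r40.
  by split=> // t; rewrite !lt_min => /andP[/andP[b1 b2] /andP[b3 b4]];
    [exact: H1|exact: H2|exact: H3|exact: H4].
pose del := Num.min (rho / 2) (Num.min (t1 - t0) (Num.min (d1 / 2) (e / 2))).
have del0 : 0 < del by rewrite !lt_min !divr_gt0 // subr_gt0 t01.
have delrho : del <= rho / 2 by rewrite !ge_min lexx.
have delt : del <= t1 - t0 by rewrite !ge_min lexx orbT.
have deld : del <= d1 / 2 by rewrite !ge_min lexx !orbT.
have dele : del <= e / 2 by rewrite !ge_min lexx !orbT.
pose t := t1 - del.
have tJ : t0 <= t <= T by rewrite /t; lra.
have tt1 : t < t1 by rewrite /t; lra.
have tb : `|t1 - t| < rho by rewrite /t opprB addrC subrK gtr0_norm //; lra.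
move: (Hfar _ tb) (Hsg _ tb) (HX _ tb) (Hbeta _ tb) => {}Hfar {}Hsg {}HX {}Hbeta.
have tn : t != t1 by rewrite lt_eqF.
have [w Kw wb] := (closeP t (beta t) iy).1 (cl t ltac:(by case/andP: tJ => -> _)).
have wks : `|w - ks| < e2.
  have [|/Hfar] := pselect (ball ks e2 w); first by rewrite -ball_normE /ball_ /= distrC.
  by move=> /(_ tJ) H; have := H Kw; rewrite ltNge wb.
have [|||||kap Kkap kapb] := Hflow t t1 w _ _ t1T _ _ _ Kw.
- by case/andP: (timeT tJ).
- exact: ltW.
- by rewrite /t addrAC subrr add0r normrN gtr0_norm //; lra.
- by rewrite subrr normr0.
- by rewrite (lt_le_trans wks) // ge_min lexx.
have t1t : t1 - t = del by rewrite /t opprB addrC subrK.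
rewrite t1t in kapb.
(* Relative velocity of the solution and the ODE trajectory: its two parts approximate [X] and the
   field at [ks], so [Z] is near [Y]. *)
pose Z := del^-1 *: ((sg t1 - sg t) - (kap - w)).
have sgE : sg t1 - kap = (sg t - w) + del *: Z.
  rewrite /Z scalerA mulfV ?gt_eqF // scale1r.
  by apply/rowP => j; rewrite !mxE; ring.
have ZY : `|Z - Y| < e.
  have -> : Z - Y = - (X - (t - t1)^-1 *: (sg t - sg t1)) -
      del^-1 *: (kap - w - del *: Frep F i y ks t1).
    have -> : t - t1 = - del by rewrite -t1t opprB.
    rewrite invrN; apply/rowP => j; rewrite /Z /Y !mxE; field.
    exact: lt0r_neq0.
  rewrite (le_lt_trans (ler_normB _ _)) // normrN normrZ gtr0_norm ?invr_gt0 //.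
  have h1 := HX tn tJ.
  have h2 : del^-1 * `|kap - w - del *: Frep F i y ks t1| <= e1.
    by rewrite mulrC ler_pdivrMr.
  by move: h1 h2; rewrite /e1; lra.
have Anu : `|(sg t - w) - nu| < e.
  have -> : sg t - w - nu = - (sg t1 - sg t) - (w - ks).
    by apply/rowP => j; rewrite /nu !mxE; ring.
  rewrite (le_lt_trans (ler_normB _ _)) // normrN.
  have h1 := Hsg tJ.
  have h2 : `|w - ks| < e1 by rewrite (lt_le_trans wks) // ge_min lexx orbT.
  by move: h1 h2; rewrite /e1; lra.
have Psim : Psi (sg t - w, Z, del) < m.
  apply: He; split; first by split; rewrite -ball_normE /ball_ /= distrC.
  by rewrite -ball_normE /ball_ /= sub0r normrN gtr0_norm //; lra.
have b1 : beta t1 <= bil G (sg t1 - kap) (sg t1 - kap).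
  have [->|kk] := eqVneq kap ks; first by rewrite -nub.
  exact/ltW/ksuniq.
have expand (a b : 'rV[R]_k) : bil G (a + del *: b) (a + del *: b) =
    bil G a a + (2 * bil G a b + del * bil G b b) * del.
  by rewrite bilDl !bilDr !bilZl !bilZr (bilC b a) ?(proj1 Gp) //; ring.
rewrite sgE expand in b1.
have := Hbeta tn; have -> : t - t1 = - del by rewrite -t1t opprB.
rewrite invrN scaleNr -scalerN opprB [_ *: _]mulrC ltr_pdivlMr // => b2.
have b3 : Psi (sg t - w, Z, del) * del < m * del by rewrite ltr_pM2r.
rewrite /Psi /= in b3; move: wb; rewrite -/(sg t) -/G; lra.
Qed.

End Estimates.

(** If [w - ks] had positive product with [nu], moving from [ks] slightly towards [w] would decrease
    the distance. Conversely, the product being nonpositive, the expansion of the square of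
    [nu - (w - ks)] gives strict minimality. *)
Lemma nearest_point (R : realType) k (G : 'M[R]_k) (Cv : set 'rV[R]_k) sg ks :
  posdef G ->
  (forall w w' (a : R), 0 <= a <= 1 -> Cv w -> Cv w' -> Cv (a *: w + (1 - a) *: w')) ->
  Cv ks -> (forall w, Cv w -> bil G (sg - ks) (sg - ks) <= bil G (sg - w) (sg - w)) ->
  (forall w, Cv w -> bil G (w - ks) (sg - ks) <= 0) /\
  (forall w, w != ks -> Cv w -> bil G (sg - ks) (sg - ks) < bil G (sg - w) (sg - w)).
Proof.
move=> Gp cvx Cks mn; set nu := sg - ks.
have expand a (v d : 'rV[R]_k) :
    bil G (v - a *: d) (v - a *: d) = bil G v v - 2 * a * bil G d v + a ^+ 2 * bil G d d.
  by rewrite bilBl !bilBr !bilZl !bilZr (bilC v d) ?(proj1 Gp) //; ring.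
have le0 w : Cv w -> bil G (w - ks) nu <= 0.
  move=> Cw; set d := w - ks; rewrite leNgt; apply/negP => dn.
  have dd0 := posdef_ge0 d Gp.
  (* Small enough for the linear gain [2 * a * bil G d nu] to beat the quadratic loss
     [a ^+ 2 * bil G d d]; the 1 avoids division by zero. *)
  pose a := Num.min 1 (bil G d nu / (bil G d d + 1)).
  have a0 : 0 < a by rewrite lt_min ltr01 divr_gt0 // ltr_wpDl.
  have a1 : a <= 1 by rewrite ge_min lexx.
  have ad : a * (bil G d d + 1) <= bil G d nu.
    by rewrite -ler_pdivlMr ?ltr_wpDl // ge_min lexx orbT.
  have := mn _ (cvx w ks a ltac:(by rewrite ltW) Cw Cks).
  have -> : sg - (a *: w + (1 - a) *: ks) = nu - a *: d.
    by apply/rowP => j; rewrite /nu /d !mxE; ring.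
  rewrite expand -/nu => H.
  have : 0 <= a * (a * bil G d d - 2 * bil G d nu) by move: H; rewrite expr2; lra.
  by rewrite pmulr_rge0 //; lra.
split=> // w wks Cw; have := expand 1 nu (w - ks).
have -> : nu - 1 *: (w - ks) = sg - w by apply/rowP => j; rewrite /nu !mxE; ring.
move=> ->; have := le0 w Cw.
have : 0 < bil G (w - ks) (w - ks) by case: Gp => _; apply; rewrite subr_eq0.
by rewrite expr1n; lra.
Qed.

Lemma convex_fiber (R : realType) n k (M : manifold R n) (V : vbundle M k)
    (K : set (total_space V)) (i : cidx M) (y : 'rV[R]_n) : cimg i y ->
  convex_set ([set v | K (Tot v)] : set (V (cinv i y))) ->
  forall w w' (a : R), 0 <= a <= 1 -> K (vec V i y w) -> K (vec V i y w') ->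
    K (vec V i y (a *: w + (1 - a) *: w')).
Proof.
move=> iy cvx w w' a /andP[a0 a1] Kw Kw'.
have := cvx (tinv V i (cinv i y) w) (tinv V i (cinv i y) w') (Itv01 a0 a1)
  (mem_set Kw) (mem_set Kw') => /set_mem /=.
rewrite /vec (_ : tinv V i (cinv i y) (_ + _) =
  a *: tinv V i (cinv i y) w + (1 - a) *: tinv V i (cinv i y) w') //.
apply: (triv_inj (cimg_cdom iy)); rewrite linearD !linearZ /= !tinvK //;
  exact: cimg_cdom.
Qed.

Lemma riemannian_posdef (R : realType) n (M : manifold R n) (T : R)
    (g : riemannian_family M T) t (i : cidx M) (y : 'rV[R]_n) :
  0 <= t <= T -> cimg i y -> posdef (g t i y).
Proof.
by move=> tT iy; split; [exact: gmet_sym|move=> v v0; exact: gmet_pos].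
Qed.

(** * The continuation argument in time *)

Section MaximumPrinciple.
Context {R : realType} {n k : nat} {M : manifold R n} (M_closed : compact [set: M]).
Context {T : R} {g : riemannian_family M T} (D : levi_civita g).
Context {V : vbundle M k} (h : bundle_metric V).
Context (A : connection_family V T) (A_compatible : metric_compatible A h).
Context (U : set (total_space V)) (U_open : open U).
Context (K : R -> set (total_space V)).
Context (K_sub_U : forall t, 0 <= t <= T -> K t `<=` U).
Context (K_parallel : forall t, 0 <= t <= T -> parallel_invariant A t (K t)).
Context (K_fibers : forall t x, 0 <= t <= T ->
     let Kx : set (V x) := [set v | K t (Tot v)] in
     [/\ Kx !=set0,
         forall i, cdom i x -> closed (triv V i x @` Kx) &
         convex_set Kx]).
Context (K_track : closed [set p : total_space V * R | 0 <= p.2 <= T /\ K p.2 p.1]).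
Context (u : diagonal_family M T) (F : forall x : M, V x -> R -> V x).
Context (F_continuous : continuous_field T U F) (F_lipschitz : lipschitz_field T U F h).
Context (ode_invariance : forall (x : M) (t0 t1 : R) (s : R -> V x),
     0 <= t0 -> t0 < t1 -> t1 <= T ->
     ode_solution U F t0 t1 s -> K t0 (Tot (s t0)) ->
     forall t, t0 <= t <= t1 -> K t (Tot (s t))).
Context (t0 : R) (s : R -> forall x : M, V x) (t00 : 0 <= t0) (t0T : t0 < T).
Context (s_sol : pde_solution U F A D u t0 T s) (s_t0 : forall x, K t0 (Tot (s t0 x))).

Let timeT t : t0 <= t <= T -> 0 <= t <= T.
Proof. by move=> /andP[t0t ->]; rewrite (le_trans t00). Qed.

Let s_in_U : forall t x, t0 <= t <= T -> U (Tot (s t x)).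
Proof. by case: s_sol. Qed.

Let s_cont (i : cidx M) : {within [set p : 'rV[R]_n * R | cimg i p.1 /\ t0 <= p.2 <= T],
    continuous (fun p => lrep i (s p.2) p.1)}.
Proof. by case: s_sol => _ /(_ i)[]. Qed.

Let slice_continuous (i : cidx M) t (Y : topologicalType) (f : 'rV[R]_n * R -> Y) :
  t0 <= t <= T ->
  {within [set p : 'rV[R]_n * R | cimg i p.1 /\ t0 <= p.2 <= T], continuous f} ->
  forall z, cimg i z -> {for z, continuous (fun z => f (z, t))}.
Proof.
move=> tT /subspace_continuousP cf z iz W.
move=> /(cf (z, t) (conj iz tT)); rewrite /within /= => nW.
have cc : (fun z => (z, t)) @ z --> (z, t).
  apply: (@cvg_pair_nbhs _ (nbhs z) _ _ _ id (cst t)); first exact: cvg_id.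
  exact: cvg_cst.
by apply: filterS2 (near_cimg iz) (cc _ nW) => z' iz' /= Wz; exact: Wz.
Qed.

(* At a spatial maximum only the reaction term survives. *)
Lemma diffusion_le0 (i : cidx M) y t1 beta ks : cimg i y -> t0 <= t1 <= T ->
  let sg := lrep i (s t1) in let nu := sg y - ks in
  0 <= beta -> bil (gram h i y) nu nu = beta ->
  (forall w, K t1 (vec V i y w) -> bil (gram h i y) (w - ks) nu <= 0) ->
  (forall x, close h K s t1 beta x) ->
  bil (gram h i y) (laplacian A D t1 i sg y +
    \sum_a (u t1 i y) 0 a *: cov_deriv A t1 i a sg y) nu <= 0.
Proof.
move=> iy t1T sg nu beta0 nub ksmin cl.
have t1T' := timeT t1T.
have [_ /(_ i) [ds dds cs cds cdds] _] := s_sol.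
have [|||||cov0 cov2] := @spatial_maximum R n k M V T A h A_compatible t1 t1T' i y iy sg
  (fun a z => 'D_(basis_vec a) sg z)
  (fun a b z => 'D_(basis_vec b) (fun z => 'D_(basis_vec a) sg z) z)
  _ _ _ _ (K t1) beta nu ks (K_parallel t1T') beta0 erefl nub ksmin.
- by move=> z a iz; apply: derivableP; exact: (ds (z, t1)).
- by move=> z a b iz; apply: derivableP; exact: (dds (z, t1)).
- by move=> z a iz; exact: (slice_continuous t1T (cds a) iz).
- by move=> z a b iz; exact: (slice_continuous t1T (cdds a b) iz).
- by move=> z iz; apply/closeP.
have u0 : bil (gram h i y) (\sum_a (u t1 i y) 0 a *: cov_deriv A t1 i a sg y) nu = 0.
  by rewrite bil_suml big1 // => a _; rewrite bilZl cov0 mulr0.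
rewrite bilDl u0 addr0 /laplacian bil_suml.
under eq_bigr do rewrite bil_suml.
have := trace_posdef_le0 (riemannian_posdef g t1T' iy) cov2.
apply: le_trans; rewrite le_eqVlt; apply/orP; left; apply/eqP.
apply: eq_bigr => a _; apply: eq_bigr => b _.
rewrite bilZl /hat_deriv bilBl [X in _ - X]bil_suml [X in _ - X]big1 ?subr0 // => c _.
by rewrite bilZl cov0 mulr0.
Qed.

(** [eta], and with it the growth rate [C], is fixed before [theta], so [theta] may afterwards be
    made arbitrarily small. *)
Lemma exponential_closeness : exists2 eta, 0 < eta & forall theta, 0 < theta -> theta <= eta ->
  forall t x, t0 <= t <= T -> close h K s t theta x.
Proof.
have [eta eta0 Hlip] := @uniform_lipschitz _ _ _ _ _ h T U U_open F F_lipschitz K t0 t00 s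
  s_in_U s_cont M_closed.
exists eta => // theta th0 theta_eta.
pose C := eta^-1 + 1.
pose beta t := theta * expR (2 * C * (t - T)).
have dbeta (t : R) : is_derive t 1 beta (2 * C * beta t).
  have d1 : is_derive t 1 (fun r : R => 2 * C * (r - T)) (2 * C).
    rewrite (_ : (fun r => _) = (2 * C) *: ((id : R -> R) - cst T)) //.
    by apply: is_derive_eq; rewrite subr0 [_ *: _]mulr1.
  have d2 : is_derive t 1 (expR \o (fun r : R => 2 * C * (r - T)))
      (expR (2 * C * (t - T)) * (2 * C)) by apply: is_derive1_comp.
  have d3 := is_deriveZ theta d2.
  by apply: is_derive_eq d3 _; rewrite /beta /GRing.scale /=; ring.
have cbeta : continuous beta.
  by move=> t; apply: differentiable_continuous; apply/derivable1_diffP; case: (dbeta t).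
have C0 : 0 < C by rewrite ltr_wpDl // invr_ge0 ltW.
have beta0 t : 0 < beta t by rewrite mulr_gt0 ?expR_gt0.
have betale t : t <= T -> beta t <= theta.
  move=> tT; rewrite /beta ler_piMr ?(ltW th0) // -expR0 ler_expR.
  by rewrite mulr_ge0_le0 ?subr_le0 // mulr_ge0 // ltW.
suff good t : t0 <= t <= T -> forall x, close h K s t (beta t) x.
  move=> t x tT; have [v Kv vb] := good t tT x; exists v => //.
  by rewrite (le_trans vb) // betale //; case/andP: tT.
move: t; pose S := [set t | t0 <= t <= T /\
  forall r, t0 <= r <= t -> forall x, close h K s r (beta r) x].
have hxx0 x (v : V x) : h x (v - v) (v - v) = 0.
  by rewrite subrr -(scale0r 0) hmetZl mul0r.
have good0 x : close h K s t0 (beta t0) x.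
  by exists (s t0 x) => //; rewrite hxx0 ltW.
have S0 : S t0.
  split; first by rewrite lexx ltW.
  by move=> r; rewrite -eq_le => /eqP <-.
have Ssup : has_sup S by split; [exists t0|exists T => r [/andP[]]].
pose t1 := sup S.
have t01 : t0 <= t1 by apply: ub_le_sup => //; exact: (proj2 Ssup).
have t1T : t1 <= T by apply: (ge_sup (proj1 Ssup)) => r [/andP[]].
have t1J : t0 <= t1 <= T by rewrite t01.
have before r : t0 <= r < t1 -> forall x, close h K s r (beta r) x.
  move=> /andP[t0r rt1].
  have [r' Sr'] := sup_adherent (ltac:(by rewrite subr_gt0) : 0 < t1 - r) Ssup.
  rewrite -/t1 subKr => rr'; case: Sr' => _; apply.
  by rewrite t0r ltW.
have good1 x : close h K s t1 (beta t1) x.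
  have [i [y [iy ->]]] := chart_ex x.
  have [tlt|] := ltP t0 t1; last first.
    by move=> le; have -> : t1 = t0 by apply/eqP; rewrite eq_le le.
  by apply: (close_left_closed K_track t00 s_cont iy tlt t1T cbeta) => r rr; exact: before.
suff t1E : t1 = T.
  move=> t /andP[t0t]; rewrite le_eqVlt => /predU1P[->|tT]; first by rewrite -t1E.
  by apply: before; rewrite t0t t1E.
apply/eqP; rewrite eq_le t1T /= leNgt; apply/negP => t1ltT.
have strict x : \forall p \near ((x, t1) : M * R), t1 <= p.2 <= T ->
    close h K s p.2 (beta p.2) p.1.
  have [i [y [iy ->]]] := chart_ex x.
  have Gp := gram_posdef h iy; have t1T' := timeT t1J.
  set sg := lrep i (s t1) y.
  have [[w0 Kw0 lt0]|nstrict] := pselect (exists2 w0, K t1 (vec V i y w0) &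
      bil (gram h i y) (sg - w0) (sg - w0) < beta t1).
    exact: (close_right_open U_open F_continuous F_lipschitz K_sub_U ode_invariance t00
      s_cont K_parallel cbeta iy t1J Kw0 lt0).
  (* At [t0] the solution lies in [K], so its distance 0 is strictly below [beta]; contact can only
     occur later. *)
  have tlt : t0 < t1.
    rewrite lt_neqAle t01 andbT; apply/negP => /eqP t01E; apply: nstrict.
    exists sg; last by rewrite subrr /bil !mul0mx mxE.
    rewrite /vec /sg /lrep trivK; last exact: cimg_cdom.
    by rewrite -t01E.
  have [ks Kks ksb] := (closeP h K s t1 (beta t1) iy).1 (good1 _).
  have far w : K t1 (vec V i y w) -> beta t1 <= bil (gram h i y) (sg - w) (sg - w).
    by move=> Kw; rewrite leNgt; apply/negP => wlt; apply: nstrict; exists w.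
  set nu := sg - ks.
  have nub : bil (gram h i y) nu nu = beta t1 by apply/eqP; rewrite eq_le ksb far.
  have [_ _ cvx] := K_fibers (cinv i y) t1T'.
  have [ksmin ksuniq] := nearest_point (Cv := [set w | K t1 (vec V i y w)]) (sg := sg)
    Gp (convex_fiber iy cvx) Kks ltac:(by rewrite -/nu nub; exact: far).
  have [_ _ /(_ t1 i y t1J iy) dX] := s_sol.
  have := time_maximum U_open F_continuous F_lipschitz K_sub_U K_track ode_invariance t00
    s_cont iy tlt t1T cbeta (dbeta t1) (fun r rr => before r rr (cinv i y)) dX Kks nub.
  rewrite -/sg -/nu -nub => /(_ ksuniq).
  have := diffusion_le0 iy t1J (ltW (beta0 t1)) nub ksmin good1.
  rewrite -/sg -/nu; set Lap := laplacian _ _ _ _ _ _ + _ => lap0.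
  have Feq : triv V i (cinv i y) (F (s t1 (cinv i y)) t1) = Frep F i y sg t1.
    by rewrite /Frep /sg /lrep trivK //; exact: cimg_cdom.
  rewrite Feq -[Lap + _ - _]addrA (bilDr _ nu Lap) (bilC nu Lap) ?(proj1 Gp) // => H.
  have := Hlip i y t1 ks iy t1J Kks; rewrite /= -/sg -/nu nub => lip.
  have {}lip := lip ltac:(by rewrite (le_trans (betale _ t1T))).
  have b0 := beta0 t1.
  by rewrite nub in H; rewrite /C in H; nra.
(* Compactness of [M] makes the continuation beyond [t1] uniform in [x], which contradicts the
   choice of [t1] as a supremum. *)
have : \forall r \near t1, [set: M] `<=` [set x | t1 <= r <= T -> close h K s r (beta r) x].
  apply: ((proj1 (compact_near_coveringP [set: M]) M_closed) R (nbhs t1)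
    (fun r x => t1 <= r <= T -> close h K s r (beta r) x) (nbhs_filter t1)) => x _.
  exact: strict.
move=> /nbhs_ballP[d /= d0 Hd].
pose r := Num.min T (t1 + d / 2).
have t1r : t1 < r by rewrite lt_min t1ltT ltrDl divr_gt0.
have rT : r <= T by rewrite ge_min lexx.
have rd : r <= t1 + d / 2 by rewrite ge_min lexx orbT.
have Sr : S r.
  split; first by rewrite rT andbT ltW // (le_lt_trans t01).
  move=> r' /andP[t0r' r'r] x; have [r't1|t1r'] := ltP r' t1.
    by apply: before; rewrite t0r'.
  apply: (Hd r') => //; last by rewrite t1r' (le_trans r'r).
  by rewrite -ball_normE /ball_ /= distrC ger0_norm ?subr_ge0 //; lra.
by have := ub_le_sup (proj2 Ssup) Sr; rewrite -/t1 leNgt t1r.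
Qed.

(** Arbitrarily small [theta] puts the solution in the closure of the fiber of [K t], which is
    closed; coercivity converts [theta] into sup norm distance. *)
Lemma solution_stays t x : t0 <= t <= T -> K t (Tot (s t x)).
Proof.
move=> tT; have [eta eta0 Hcl] := exponential_closeness.
have [i [y [iy ->]]] := chart_ex x; have di := cimg_cdom iy.
have [_ /(_ i di) Kcl _] := K_fibers (cinv i y) (timeT tT).
set sg := triv V i (cinv i y) (s t (cinv i y)).
suff : (triv V i (cinv i y) @` [set v | K t (Tot v)]) sg.
  by move=> [v Kv /(triv_inj di) <-].
apply: Kcl => B /nbhs_ballP[e /= e0 He].
have [c c0 Hc] := posdef_coercive (gram_posdef h iy).
pose theta := Num.min eta (c * e ^+ 2 / 2).
have th0 : 0 < theta by rewrite lt_min eta0 !mulr_gt0 ?exprn_gt0 ?invr_gt0.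
have the : theta <= eta by rewrite ge_min lexx.
have thc : theta <= c * e ^+ 2 / 2 by rewrite ge_min lexx orbT.
have [w Kw wb] := (closeP h K s t theta iy).1 (Hcl theta th0 the t (cinv i y) tT).
exists w; split; first by exists (tinv V i (cinv i y) w) => //; rewrite tinvK.
apply: He; rewrite -ball_normE /ball_ /=.
rewrite -ltr_sqr ?nnegrE ?(ltW e0) // -(ltr_pM2l c0).
rewrite (le_lt_trans (Hc _)) // (le_lt_trans wb) // (le_lt_trans thc) //.
by rewrite ltr_pdivrMr // ltr_pMr ?ltr1n // mulr_gt0 ?exprn_gt0.
Qed.

End MaximumPrinciple.

Theorem theorem3 (R : realType) (n k : nat)
  (M : manifold R n) (M_closed : compact [set: M]) (M_oriented : oriented M)
  (T : R) (T_gt0 : 0 < T)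
  (g : riemannian_family M T) (D : levi_civita g)
  (V : vbundle M k) (h : bundle_metric V)
  (A : connection_family V T) (A_compatible : metric_compatible A h)
  (U : set (total_space V)) (U_open : open U)
  (K : R -> set (total_space V))
  (K_closed : forall t, 0 <= t <= T -> closed (K t))
  (K_sub_U : forall t, 0 <= t <= T -> K t `<=` U)
  (K_parallel : forall t, 0 <= t <= T -> parallel_invariant A t (K t))
  (K_fibers : forall t x, 0 <= t <= T ->
     let Kx : set (V x) := [set v | K t (Tot v)] in
     [/\ Kx !=set0,
         forall i, cdom i x -> closed (triv V i x @` Kx) &
         convex_set Kx])
  (K_track : closed [set p : total_space V * R | 0 <= p.2 <= T /\ K p.2 p.1])
  (u : diagonal_family M T)
  (F : forall x : M, V x -> R -> V x)
  (F_continuous : continuous_field T U F)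
  (F_lipschitz : lipschitz_field T U F h)
  (ode_invariance : forall (x : M) (t0 t1 : R) (s : R -> V x),
     0 <= t0 -> t0 < t1 -> t1 <= T ->
     ode_solution U F t0 t1 s -> K t0 (Tot (s t0)) ->
     forall t, t0 <= t <= t1 -> K t (Tot (s t))) :
  forall (t0 : R) (s : R -> forall x : M, V x),
    0 <= t0 -> t0 < T ->
    pde_solution U F A D u t0 T s ->
    (forall x, K t0 (Tot (s t0 x))) ->
    forall t x, t0 <= t <= T -> K t (Tot (s t x)).
Proof.
move=> t0 s t00 t0T s_sol s_t0.
exact: (solution_stays M_closed A_compatible U_open K_sub_U K_parallel K_fibers
  K_track F_continuous F_lipschitz ode_invariance t00 t0T s_sol s_t0).
Qed.
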